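(* Let $\Omega$ be a centrally symmetric convex hexagon in $\mathbb{R}^2$. Then $\Omega$ has a unique spectrum up to translation; that is, $\Omega$ has a spectrum, and any two spectra of $\Omega$ are translates of each other.
   Context: Let $\Omega\subset\mathbb{R}^d$ be a bounded, measurable set of positive Lebesgue measure. A countable set $\Lambda\subset\mathbb{R}^d$ is called a spectrum for $\Omega$ if the system of exponential functions $E(\Lambda)=\{e_\lambda\}_{\lambda\in\Lambda}$, $e_\lambda(x)=e^{2\pi i\langle\lambda,x\rangle}$, is an orthogonal basis in $L^2(\Omega)$ (orthogonal and complete). A set $S\subset\mathbb{R}^d$ is centrally symmetric if there is a point $x\in\mathbb{R}^d$ with $S-x=-S+x$. *)

(* Defs.v *)
From HB Require Import structures.
From mathcomp Require Import all_boot all_order all_algebra.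
From mathcomp Require Import all_classical all_reals all_analysis.
From mathcomp Require Import complex.
Set Implicit Arguments.
Unset Strict Implicit.
Unset Printing Implicit Defensive.
Import Order.TTheory GRing.Theory Num.Theory.
Import numFieldNormedType.Exports.
Local Open Scope classical_set_scope.
Local Open Scope ring_scope.
Local Open Scope complex_scope.

(* The plane is R * R, with the Borel sigma-algebra. Restricting to Borel
   functions loses nothing in L^2: every class of Lebesgue measurable functions
   modulo null sets contains a Borel one. *)
Notation leb2 R := (@lebesgue_measure R \x @lebesgue_measure R)%E.

Section polygons.
Context {R : realType}.
Implicit Type S : set (R * R).

Definition convex_hull S : set (R * R) := smallest (@convex_set R (R * R)%type) S.

(* Six points in convex position: no v i lies in the convex hull of the other
   five. They are therefore distinct, no three of them are collinear, and the
   (closed) hexagon they span has nonempty interior. *)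
Definition convex_hexagon S : Prop :=
  exists v : 'I_6 -> R * R,
    (forall i, ~ convex_hull [set v j | j in [set j | j != i]] (v i)) /\
    S = convex_hull (range v).

Definition translate S (t : R * R) : set (R * R) := [set s + t | s in S].

Definition centrally_symmetric S : Prop :=
  exists x : R * R, translate S (- x) = translate [set - s | s in S] x.

End polygons.

Section spectra.
Context {R : realType}.
Implicit Types (Omega Lambda : set (R * R)) (f g : R * R -> R[i]).

Definition dot (x y : R * R) : R := x.1 * y.1 + x.2 * y.2.

Definition expchar (l x : R * R) : R[i] :=
  cos (2 * pi * dot l x) +i* sin (2 * pi * dot l x).

Definition cintegral Omega f : R[i] :=
  (\int[leb2 R]_(x in Omega) complex.Re (f x))%R +i*
  (\int[leb2 R]_(x in Omega) complex.Im (f x))%R.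

Definition innerL2 Omega f g : R[i] := cintegral Omega (fun x => f x * (g x)^*).

Definition sqnormL2 Omega f : \bar R :=
  (\int[leb2 R]_(x in Omega)
     (complex.Re (f x) ^+ 2 + complex.Im (f x) ^+ 2)%:E)%E.

Definition memL2 Omega f : Prop :=
  [/\ measurable_fun Omega (fun x => complex.Re (f x)),
      measurable_fun Omega (fun x => complex.Im (f x)) &
      (sqnormL2 Omega f < +oo)%E].

Definition orthogonal_exp Omega Lambda : Prop :=
  forall l m, Lambda l -> Lambda m -> l != m ->
    innerL2 Omega (expchar l) (expchar m) = 0.

(* The linear span of E(Lambda) is dense in L^2(Omega). *)
Definition complete_exp Omega Lambda : Prop :=
  forall f, memL2 Omega f -> forall e : R, 0 < e ->
    exists (s : seq (R * R)) (c : R * R -> R[i]),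
      (forall l, l \in s -> Lambda l) /\
      (sqnormL2 Omega (fun x => (f x - \sum_(l <- s) c l * expchar l x)%R)
         < (e ^+ 2)%:E)%E.

Definition is_spectrum Omega Lambda : Prop :=
  [/\ countable Lambda, orthogonal_exp Omega Lambda & complete_exp Omega Lambda].

End spectra.

(* Main.v *)
Require Import Defs.
From HB Require Import structures.
From mathcomp Require Import all_boot all_order all_algebra.
From mathcomp Require Import all_classical all_reals all_analysis.
From mathcomp Require Import measurable_realfun.
From mathcomp Require Import complex ring lra.
Set Implicit Arguments.
Unset Strict Implicit.
Unset Printing Implicit Defensive.
Import Order.TTheory GRing.Theory Num.Theory.
Import numFieldNormedType.Exports.
Local Open Scope classical_set_scope.
Local Open Scope ring_scope.
Local Open Scope complex_scope.

(** A centrally symmetric hexagon has three pairs of parallel edges; up to a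
    linear change of coordinates it is given by two edge vectors [a], [c] and by
    two positive numbers [P], [Q] with third edge vector [b = P a + Q c]
    ([symmetric_hexagonP]). The reflection through the centre permutes the six
    vertices because they are the extreme points of the hexagon; the antipodal
    pairs of vertices then give [a], [b] and [c].

    Such a hexagon tiles the plane by translations along the lattice generated
    by [a + b] and [b + c]. Its spectra are the translates of the dual lattice
    [dual_lattice a c P Q] of this one, and nothing else.

    The dual lattice is a spectrum ([dual_lattice_spectrum]). Cutting the hexagon
    into three parallelograms gives its Fourier transform in closed form
    ([hexagon_ftE]), which vanishes on the dual lattice except at [0]. For
    completeness ([complete_exp_of_packing]), a Borel subset of the hexagon
    coincides there almost everywhere with a Borel set periodic under the
    translation lattice, because translates of the interior do not overlap.
    Periodic Borel sets are generated by the preimages of arcs under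
    [x |-> dot d x] modulo [1] with [d] in the dual lattice. An arc is a
    superlevel set of a cosine, whose indicator function is a limit of
    polynomials in that cosine; and the sets whose indicator is an [L^2] limit
    of trigonometric polynomials form a sigma-algebra.

    Conversely, let [Lambda] be a spectrum ([spectrum_hexagonE]). Differences of
    points of [Lambda] are zeros of the Fourier transform. Along the strip where
    [dot x a] stays in a compact subinterval of the open interval from [-1] to
    [1], the zeros approach the lines where [dot x (b + c)] is an integer as
    [dot x c] tends to infinity ([hexagon_ft_zero_asymptotic]). Completeness
    provides, in every such strip of fixed width less than [1], points [nu] of
    [Lambda] arbitrarily far out ([spectrum_meets_strip]): the hexagon contains
    a chord parallel to [a] and strictly longer than [a], and a half-wave of a
    sine along that chord has a fixed proportion of its energy in a frequency
    window narrower than [1]. Comparing two points [l], [m] of [Lambda] with the same far away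
    [nu] shows that [dot (l - m) (b + c)] is arbitrarily close to integers,
    hence is an integer, first when [dot l a] and [dot m a] are close, then in
    general by chaining ([in_class_all]). Exchanging the roles of [a] and [c],
    all differences lie in the dual lattice. So [Lambda] is contained in a
    translate of it, and equal to it: the missing characters would be orthogonal
    to a complete system. *)

(** * Linear changes of variables in the plane *)

Section affine.
Context {R : realType}.
Notation mR := (measurableTypeR R).
Notation pl := (mR * mR)%type.
Notation la := (@lebesgue_measure R).

Lemma measurable_affine1 (k c : R) : measurable_fun [set: mR] (fun x : mR => k * x + c : mR).
Proof. by apply: measurable_funD => //; exact: measurable_funM. Qed.

(** Lebesgue measure is the only measure giving every half-open interval its
    length, so it suffices to compare the two sides on such intervals. *)
Lemma lebesgue_measure_affine (k c : R) (A : set mR) : k != 0 ->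
  measurable A ->
  pushforward la (fun x : mR => k * x + c : mR) A = ((`|k|^-1)%:E * la A)%E.
Proof.
move=> k0 mA; rewrite -[LHS]mul1e.
have k1 : (0 <= `|k|)%R by [].
suff : (la A = (`|k|)%:E * pushforward la (fun x : mR => (k * x + c)%R : mR) A)%E.
  move=> ->; rewrite muleA -EFinM mulVf ?normr_eq0// .
pose nu := mscale (NngNum k1) (pushforward la (fun x : mR => k * x + c : mR)).
transitivity (nu (measurable_affine1 k c) A); last by [].
apply: (lebesgue_measure_unique _ mA).
move=> _ [[a b]] _ <- /=; rewrite /nu /mscale /= /pushforward /=.
have [kp|kn|k00] := ltgtP k 0; last by rewrite k00 eqxx in k0.
- have -> : (fun x : R => k * x + c) @^-1` `]a, b]%classic = `[(b - c) / k, (a - c) / k[%classic.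
    apply/seteqP; split => x; rewrite /= !in_itv/= => /andP[].
      by rewrite ler_ndivrMr// ltr_ndivlMr// => *; apply/andP; split; lra.
    by rewrite ler_ndivrMr// ltr_ndivlMr// => *; apply/andP; split; lra.
  rewrite !lebesgue_measure_itv/= !lte_fin ltr_ndivlMr// divfK//.
  rewrite ltrBlDr subrK; case: ifPn => ab; last by rewrite mule0.
  rewrite -EFinM; congr EFin; rewrite ltr0_norm//; field; exact: ltr0_neq0.
- have -> : (fun x : R => k * x + c) @^-1` `]a, b]%classic = `](a - c) / k, (b - c) / k]%classic.
    apply/seteqP; split => x; rewrite /= !in_itv/= => /andP[].
      by rewrite ltr_pdivrMr// ler_pdivlMr// => *; apply/andP; split; lra.
    by rewrite ltr_pdivrMr// ler_pdivlMr// => *; apply/andP; split; lra.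
  rewrite !lebesgue_measure_itv/= !lte_fin ltr_pdivlMr// divfK//.
  rewrite ltrBlDr subrK; case: ifPn => ab; last by rewrite mule0.
  rewrite -EFinM; congr EFin; rewrite gtr0_norm//; field; exact: lt0r_neq0.
Qed.

Lemma ge0_integral_affine1 (k c : R) (f : mR -> \bar R) : k != 0 ->
  measurable_fun setT f -> (forall x, 0 <= f x)%E ->
  (\int[la]_x f (k * x + c)%R = (`|k|^-1)%:E * \int[la]_x f x)%E.
Proof.
move=> k0 mf f0.
have k1 : (0 <= `|k|^-1)%R by rewrite invr_ge0.
rewrite -(@ge0_integral_mscale _ _ _ la setT measurableT (NngNum k1))//.
have /= := @ge0_integral_pushforward _ _ _ _ _ _ (measurable_affine1 k c) la setT f measurableT mf (fun x _ => f0 x).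
rewrite preimage_setT /= => <-.
apply: eq_measure_integral; first exact: measurable_affine1.
move=> mphi A mA _.
exact: lebesgue_measure_affine.
Qed.

Definition affine (a b c d e f : R) (z : pl) : pl :=
  (a * z.1 + b * z.2 + e, c * z.1 + d * z.2 + f).

Lemma measurable_affine a b c d e f : measurable_fun setT (affine a b c d e f).
Proof.
by apply: measurable_fun_pair => /=; apply: measurable_funD => //;
  apply: measurable_funD => //; apply: measurable_funM => //.
Qed.

Lemma ge0_integral_affine_fst (a b e : R) (F : pl -> \bar R) : a != 0 ->
  measurable_fun setT F -> (forall x, 0 <= F x)%E ->
  (\int[leb2 R]_z F (affine a b 0 1 e 0 z) = (`|a|^-1)%:E * \int[leb2 R]_z F z)%E.
Proof.
move=> a0 mF F0.
have mFa : measurable_fun setT (F \o affine a b 0 1 e 0).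
  by apply: measurableT_comp => //; exact: measurable_affine.
rewrite (@fubini_tonelli2 _ _ _ _ _ la la (F \o affine a b 0 1 e 0))//= fubini_tonelli2//.
rewrite -ge0_integralZl//; last 2 first.
- exact: measurable_fun_fubini_tonelli_G.
- by move=> y _; apply: integral_ge0.
apply: eq_integral => y _.
rewrite /fubini_G /=.
have mFy : measurable_fun [set: mR] (fun x : mR => F (x, y)).
  exact: measurableT_comp.
rewrite -(@ge0_integral_affine1 a (b * y + e) (fun x => F (x, y)))//.
by apply: eq_integral => x _; rewrite /affine /= mul0r add0r mul1r addr0 addrA.
Qed.

Lemma ge0_integral_affine_snd (c d f : R) (F : pl -> \bar R) : d != 0 ->
  measurable_fun setT F -> (forall x, 0 <= F x)%E ->
  (\int[leb2 R]_z F (affine 1 0 c d 0 f z) = (`|d|^-1)%:E * \int[leb2 R]_z F z)%E.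
Proof.
move=> a0 mF F0.
have mFa : measurable_fun setT (F \o affine 1 0 c d 0 f).
  by apply: measurableT_comp => //; exact: measurable_affine.
rewrite (@fubini_tonelli1 _ _ _ _ _ la la (F \o affine 1 0 c d 0 f))//= fubini_tonelli1//.
rewrite -ge0_integralZl//; last 2 first.
- exact: measurable_fun_fubini_tonelli_F.
- by move=> y _; apply: integral_ge0.
apply: eq_integral => x _.
rewrite /fubini_F /=.
have mFx : measurable_fun [set: mR] (fun y : mR => F (x, y)).
  exact: measurableT_comp.
rewrite -(@ge0_integral_affine1 d (c * x + f) (fun y => F (x, y)))//.
apply: eq_integral => y _; rewrite /affine /= mul0r !addr0 mul1r; congr (F (_, _)); ring.
Qed.

(** When the upper left entry is nonzero, the matrix is the product of two
    matrices that each change a single coordinate; for these Fubini reduces the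
    claim to the line. *)
Lemma ge0_integral_affine (a b c d e f : R) (F : pl -> \bar R) :
  a * d - b * c != 0 -> measurable_fun setT F -> (forall x, 0 <= F x)%E ->
  (\int[leb2 R]_z F (affine a b c d e f z) =
   (`|a * d - b * c|^-1)%:E * \int[leb2 R]_z F z)%E.
Proof.
move=> det0 mF F0.
have main a' b' c' d' G : a' != 0 -> a' * d' - b' * c' != 0 ->
    measurable_fun setT G -> (forall x, 0 <= G x)%E ->
  (\int[leb2 R]_z G (affine a' b' c' d' e f z) =
   (`|a' * d' - b' * c'|^-1)%:E * \int[leb2 R]_z G z)%E.
  move=> a0 D0 mG G0.
  pose k := (a' * d' - b' * c') / a'.
  pose l := c' / a'.
  have k0 : k != 0 by rewrite mulf_neq0// invr_neq0.
  pose H := G \o affine 1 0 l k 0 (f - l * e).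
  have mH : measurable_fun setT H by apply: measurableT_comp => //; exact: measurable_affine.
  transitivity (\int[leb2 R]_z H (affine a' b' 0 1 e 0 z))%E.
    apply: eq_integral => z _; rewrite /H /affine /=; congr (G (_, _)).
      by ring.
    by rewrite /l /k; field.
  rewrite ge0_integral_affine_fst//; last by move=> x; exact: G0.
  rewrite (ge0_integral_affine_snd l (f - l * e) k0 mG G0) muleA -EFinM.
  by congr (_%:E * _)%E; rewrite -invfM -normrM /k mulrC divfK.
have [a0|a0] := eqVneq a 0; last exact: main.
have b0 : b != 0 by apply: contraNneq det0 => ->; rewrite a0 !mul0r subr0.
(* [a] vanishes: a shear makes the upper left entry [- b], which does not *)
pose H := F \o affine (a - b) b (c - d) d e f.
have mH : measurable_fun setT H by apply: measurableT_comp => //; exact: measurable_affine.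
transitivity (\int[leb2 R]_z H (affine 1 0 1 1 0 0 z))%E.
  by apply: eq_integral => z _; rewrite /H /affine /=; congr (F (_, _)); ring.
have o0 : (1 : R) != 0 by exact: oner_neq0.
rewrite ge0_integral_affine_snd//; last by move=> x; exact: F0.
rewrite [X in (_ * X)%E](main (a - b) b (c - d) d F)//.
- rewrite muleA -EFinM normr1 invr1 mul1r; congr ((`| _ |^-1)%:E * _)%E; ring.
- by rewrite a0 sub0r oppr_eq0.
- by move: det0; congr (_ != 0); ring.
Qed.

Lemma ge0_integral_affine_in (a b c d e f : R) (D : set pl) (F : pl -> \bar R) :
  a * d - b * c != 0 -> measurable D -> measurable_fun D F ->
  (forall x, 0 <= F x)%E ->
  (\int[leb2 R]_(z in D) F z =
   `|a * d - b * c|%:E * \int[leb2 R]_(z in affine a b c d e f @^-1` D)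
     F (affine a b c d e f z))%E.
Proof.
move=> det0 mD mF F0.
have mFD : measurable_fun setT (F \_ D) by exact/(measurable_restrictT F mD).
have FD0 x : (0 <= (F \_ D) x)%E by rewrite patchE; case: ifP.
have := ge0_integral_affine e f det0 mFD FD0.
have -> : (\int[leb2 R]_z (F \_ D) (affine a b c d e f z) =
   \int[leb2 R]_z ((fun z => F (affine a b c d e f z)) \_ (affine a b c d e f @^-1` D)) z)%E.
  apply: eq_integral => z _; rewrite !patchE; congr (if _ then _ else _).
rewrite -!integral_mkcond => ->; rewrite muleA -EFinM divff ?normr_eq0// mul1e.
by [].
Qed.

Lemma Rintegral_affine (a b c d e f : R) (D : set pl) (F : pl -> R) :
  a * d - b * c != 0 -> measurable D -> (leb2 R).-integrable D (EFin \o F) ->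
  \int[leb2 R]_(z in D) F z =
  `|a * d - b * c| * \int[leb2 R]_(z in affine a b c d e f @^-1` D)
     F (affine a b c d e f z).
Proof.
move=> det0 mD iF; have mF := measurable_int _ iF.
have [fp fn] : ((\int[leb2 R]_(z in D) ((EFin \o F)^\+ z) \is a fin_num) /\
   (\int[leb2 R]_(z in D) ((EFin \o F)^\- z) \is a fin_num))%E.
  split; apply: integrable_fin_num => //; [exact: integrable_funepos | exact: integrable_funeneg].
pose Fa z := F (affine a b c d e f z).
have -> : \int[leb2 R]_(z in D) F z = fine (\int[leb2 R]_(z in D) ((EFin \o F)^\+ z) -
   \int[leb2 R]_(z in D) ((EFin \o F)^\- z))%E by rewrite /Rintegral -integralE.
have -> : \int[leb2 R]_(z in affine a b c d e f @^-1` D) Fa z =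
   fine (\int[leb2 R]_(z in affine a b c d e f @^-1` D)
           ((EFin \o F)^\+ (affine a b c d e f z)) -
         \int[leb2 R]_(z in affine a b c d e f @^-1` D)
           ((EFin \o F)^\- (affine a b c d e f z)))%E.
  rewrite /Rintegral integralE; congr (fine (_ - _)%E); apply: eq_integral => z _.
    by rewrite !funeposE.
  by rewrite !funenegE.
move: fp fn.
rewrite (@ge0_integral_affine_in a b c d e f D _ det0 mD (measurable_funepos mF))//.
rewrite (@ge0_integral_affine_in a b c d e f D _ det0 mD (measurable_funeneg mF))//.
have k0 : 0 < `|a * d - b * c| by rewrite normr_gt0.
have fin_of (x : \bar R) : (`|a * d - b * c|%:E * x)%E \is a fin_num -> x \is a fin_num.
  by case: x => //; rewrite ?gt0_muley ?gt0_muleNy ?lte_fin.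
by move=> /fin_of/fineK <- /fin_of/fineK <-; rewrite -!EFinM -!EFinB /= mulrBr.
Qed.
End affine.

(** * Bounded complex functions and Bessel's inequality *)

Section complex_modulus.
Context {R : realType}.
Implicit Types z w : R[i].

Definition sqmod z : R := complex.Re z ^+ 2 + complex.Im z ^+ 2.

Lemma sqmod_ge0 z : 0 <= sqmod z.
Proof. by rewrite addr_ge0 ?sqr_ge0. Qed.

Lemma sqmod0 : sqmod 0 = 0.
Proof. by rewrite /sqmod /= expr0n/= addr0. Qed.

Lemma sqmodM z w : sqmod (z * w) = sqmod z * sqmod w.
Proof. by case: z w => [a b] [c d]; rewrite /sqmod /=; ring. Qed.

Lemma sqmodN z : sqmod (- z) = sqmod z.
Proof. by case: z => a b; rewrite /sqmod /=; ring. Qed.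

Lemma sqmodJ z : sqmod (conjc z) = sqmod z.
Proof. by case: z => a b; rewrite /sqmod /=; ring. Qed.

Lemma sqmodR (a : R) : sqmod a%:C = a ^+ 2.
Proof. by rewrite /sqmod /=; ring. Qed.

Lemma sqmodD_le z w : sqmod (z + w) <= 2 * sqmod z + 2 * sqmod w.
Proof.
case: z w => [a b] [c d]; rewrite /sqmod /= -subr_ge0.
rewrite [X in 0 <= X](_ : _ = (a - c) ^+ 2 + (b - d) ^+ 2); last by ring.
by rewrite addr_ge0 ?sqr_ge0.
Qed.

Lemma sqmod_eq0 z : (sqmod z == 0) = (z == 0).
Proof.
case: z => a b; rewrite /sqmod /= paddr_eq0 ?sqr_ge0// !sqrf_eq0.
by rewrite eq_complex.
Qed.

Lemma mulJ_sqmod z : z * conjc z = (sqmod z)%:C.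
Proof. by case: z => a b; rewrite /sqmod; apply/eqP; rewrite eq_complex /=; apply/andP; split; apply/eqP; ring. Qed.
End complex_modulus.

Section bounded_measurable.
Context d (T : measurableType d) (R : realType).
Implicit Types f g : T -> R.

Definition bounded_measurable f :=
  measurable_fun setT f /\ exists M, forall x, `|f x| <= M.

Lemma bounded_measurable_cst (c : R) : bounded_measurable (fun=> c).
Proof. by split => //; exists `|c|. Qed.

Lemma bounded_measurableD f g : bounded_measurable f -> bounded_measurable g ->
  bounded_measurable (fun x => f x + g x).
Proof.
move=> [mf [M Mf]] [mg [N Ng]]; split; first exact: measurable_funD.
by exists (M + N) => x; rewrite (le_trans (ler_normD _ _))// lerD.
Qed.

Lemma bounded_measurableM f g : bounded_measurable f -> bounded_measurable g ->
  bounded_measurable (fun x => f x * g x).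
Proof.
move=> [mf [M Mf]] [mg [N Ng]]; split; first exact: measurable_funM.
by exists (M * N) => x; rewrite normrM ler_pM.
Qed.

Lemma bounded_measurableN f : bounded_measurable f -> bounded_measurable (fun x => - f x).
Proof.
move=> [mf [M Mf]]; split; first exact: measurable_funN.
by exists M => x; rewrite normrN.
Qed.

Lemma bounded_measurableB f g : bounded_measurable f -> bounded_measurable g ->
  bounded_measurable (fun x => f x - g x).
Proof. by move=> bf bg; apply: bounded_measurableD => //; exact: bounded_measurableN. Qed.

Lemma bounded_measurable_indic (A : set T) : measurable A -> bounded_measurable (\1_A : T -> R).
Proof.
move=> mA; split; first exact: measurable_indic.
by exists 1 => x; rewrite indicE ger0_norm// lern1 leq_b1.
Qed.

Lemma integrable_bounded_measurable (mu : {measure set T -> \bar R}) (D : set T) f :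
  measurable D -> (mu D < +oo)%E -> bounded_measurable f ->
  mu.-integrable D (EFin \o f).
Proof.
move=> mD Doo [mf [M Mf]]; apply: measurable_bounded_integrable => //.
  exact: measurable_funTS.
exists M; split; first by rewrite num_real.
by move=> K MK x _ /=; rewrite (le_trans (Mf x))// ltW.
Qed.

End bounded_measurable.

Section complex_integral.
Context d (T : measurableType d) (R : realType).
Implicit Types f g : T -> R[i].

Definition cbounded_measurable f :=
  bounded_measurable (fun x => complex.Re (f x)) /\
  bounded_measurable (fun x => complex.Im (f x)).
Local Notation cbm := cbounded_measurable.

Lemma cbm_cst (c : R[i]) : cbm (fun=> c).
Proof. by split; exact: bounded_measurable_cst. Qed.

Lemma cbmD f g : cbm f -> cbm g -> cbm (fun x => f x + g x).
Proof.
move=> [f1 f2] [g1 g2]; split.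
- have := bounded_measurableD f1 g1; congr bounded_measurable.
  by apply/funext => x; case: (f x) (g x) => ? ? [].
- have := bounded_measurableD f2 g2; congr bounded_measurable.
  by apply/funext => x; case: (f x) (g x) => ? ? [].
Qed.

Lemma cbmM f g : cbm f -> cbm g -> cbm (fun x => f x * g x).
Proof.
move=> [f1 f2] [g1 g2]; split.
- have := bounded_measurableB (bounded_measurableM f1 g1) (bounded_measurableM f2 g2).
  congr bounded_measurable.
  by apply/funext => x; case: (f x) (g x) => ? ? [].
- have := bounded_measurableD (bounded_measurableM f1 g2) (bounded_measurableM f2 g1).
  congr bounded_measurable.
  by apply/funext => x; case: (f x) (g x) => ? ? [].
Qed.

Lemma cbmJ f : cbm f -> cbm (fun x => conjc (f x)).
Proof.
move=> [f1 f2]; split.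
- by move: f1; congr bounded_measurable; apply/funext => x; case: (f x).
- by have := bounded_measurableN f2; congr bounded_measurable; apply/funext => x; case: (f x).
Qed.

Lemma cbmN f : cbm f -> cbm (fun x => - f x).
Proof.
move=> bf; have := cbmM (cbm_cst (-1)) bf; congr cbounded_measurable.
by apply/funext => x; rewrite mulN1r.
Qed.

Lemma cbmB f g : cbm f -> cbm g -> cbm (fun x => f x - g x).
Proof. by move=> bf bg; apply: cbmD => //; exact: cbmN. Qed.

Lemma cbm_real (f : T -> R) : bounded_measurable f -> cbm (fun x => (f x)%:C).
Proof. by move=> bf; split => //=; exact: bounded_measurable_cst. Qed.

Lemma cbm_sum (I : Type) (s : seq I) (F : I -> T -> R[i]) :
  (forall i, cbm (F i)) -> cbm (fun x => \sum_(i <- s) F i x).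
Proof.
move=> bF; elim: s => [|i s ih].
  have := cbm_cst 0; congr cbounded_measurable.
  by apply/funext => x; rewrite big_nil.
have := cbmD (bF i) ih; congr cbounded_measurable.
by apply/funext => x; rewrite big_cons.
Qed.

Lemma sqmod_bounded_measurable f : cbm f -> bounded_measurable (fun x => sqmod (f x)).
Proof.
by move=> [f1 f2]; apply: bounded_measurableD; exact: bounded_measurableM.
Qed.

Variable mu : {measure set T -> \bar R}.

Definition cint (D : set T) f : R[i] :=
  (\int[mu]_(x in D) complex.Re (f x)) +i* (\int[mu]_(x in D) complex.Im (f x)).

Lemma eq_cint D f g : (forall x, D x -> f x = g x) -> cint D f = cint D g.
Proof.
by move=> fg; rewrite /cint; congr (_ +i* _); apply: eq_Rintegral => x; rewrite inE => Dx;
  rewrite fg.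
Qed.

Variables (D : set T) (mD : measurable D) (Doo : (mu D < +oo)%E).

Lemma cintD f g : cbm f -> cbm g ->
  cint D (fun x => f x + g x) = cint D f + cint D g.
Proof.
move=> [f1 f2] [g1 g2]; apply/eqP; rewrite eq_complex /= ; apply/andP; split; apply/eqP.
- rewrite -RintegralD//; try exact: integrable_bounded_measurable.
  by apply: eq_Rintegral => x _; case: (f x) (g x) => ? ? [].
- rewrite -RintegralD//; try exact: integrable_bounded_measurable.
  by apply: eq_Rintegral => x _; case: (f x) (g x) => ? ? [].
Qed.

Lemma cintZl (c : R[i]) f : cbm f -> cint D (fun x => c * f x) = c * cint D f.
Proof.
move=> [f1 f2]; have i1 := integrable_bounded_measurable mD Doo f1.
have i2 := integrable_bounded_measurable mD Doo f2.
have b1 k := bounded_measurableM (bounded_measurable_cst T k) f1.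
have b2 k := bounded_measurableM (bounded_measurable_cst T k) f2.
case: c => a b; apply/eqP; rewrite eq_complex /= ; apply/andP; split; apply/eqP.
- rewrite -!RintegralZl// -RintegralB//; try exact: integrable_bounded_measurable.
  by apply: eq_Rintegral => x _; case: (f x).
- rewrite -!RintegralZl// -RintegralD//; try exact: integrable_bounded_measurable.
  by apply: eq_Rintegral => x _; case: (f x).
Qed.

Lemma cintN f : cbm f -> cint D (fun x => - f x) = - cint D f.
Proof.
move=> bf; rewrite -mulN1r -cintZl//; apply: eq_cint => x _; by rewrite mulN1r.
Qed.

Lemma cintB f g : cbm f -> cbm g ->
  cint D (fun x => f x - g x) = cint D f - cint D g.
Proof. by move=> bf bg; rewrite cintD ?cintN//; exact: cbmN. Qed.

Lemma cintJ f : cbm f -> cint D (fun x => conjc (f x)) = conjc (cint D f).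
Proof.
move=> [f1 f2]; apply/eqP; rewrite eq_complex /= ; apply/andP; split; apply/eqP.
- by apply: eq_Rintegral => x _; case: (f x).
- have i2 := integrable_bounded_measurable mD Doo f2.
  rewrite -mulN1r -RintegralZl//.
  by apply: eq_Rintegral => x _; case: (f x) => ? ? /=; rewrite mulN1r.
Qed.

Lemma cint_real (f : T -> R) :
  cint D (fun x => (f x)%:C) = (\int[mu]_(x in D) f x)%:C.
Proof. by rewrite /cint /= Rintegral_cst// mul0r. Qed.

Lemma cint_setU (A B : set T) f : measurable A -> measurable B ->
  A `|` B `<=` D -> cbm f -> [disjoint A & B] ->
  cint (A `|` B) f = cint A f + cint B f.
Proof.
move=> mA mB ABD [f1 f2] AB.
have mAB : measurable (A `|` B) by exact: measurableU.
have ABoo : (mu (A `|` B) < +oo)%E by rewrite (le_lt_trans _ Doo)// le_measure ?inE.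
apply/eqP; rewrite eq_complex /= ; apply/andP; split; apply/eqP.
all: by rewrite Rintegral_setU//; exact: integrable_bounded_measurable.
Qed.

End complex_integral.

Notation cbm := cbounded_measurable.

Section bessel.
Context d (T : measurableType d) (R : realType).
Variables (mu : {measure set T -> \bar R}) (D : set T).
Hypotheses (mD : measurable D) (Doo : (mu D < +oo)%E).
Implicit Types f g : T -> R[i].

Definition inner f g := cint mu D (fun x => f x * conjc (g x)).
Definition sqnorm f := \int[mu]_(x in D) sqmod (f x).

Lemma inner_sqnorm f : cbm f -> inner f f = (sqnorm f)%:C.
Proof.
move=> bf; rewrite /inner /sqnorm -cint_real//.
by apply: eq_cint => x _; rewrite mulJ_sqmod.
Qed.

Lemma innerJ f g : cbm f -> cbm g -> inner g f = conjc (inner f g).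
Proof.
move=> bf bg; rewrite /inner -cintJ//; last by apply: cbmM => //; exact: cbmJ.
by apply: eq_cint => x _; rewrite rmorphM /= conjcK mulrC.
Qed.

Lemma innerBl f g h : cbm f -> cbm g -> cbm h ->
  inner (fun x => f x - g x) h = inner f h - inner g h.
Proof.
move=> bf bg bh; have bh' := cbmJ bh; rewrite /inner -cintB//; last 2 first.
- exact: cbmM.
- exact: cbmM.
by apply: eq_cint => x _; rewrite mulrBl.
Qed.

Lemma innerZl c f g : cbm f -> cbm g ->
  inner (fun x => c * f x) g = c * inner f g.
Proof.
move=> bf bg; have bg' := cbmJ bg; rewrite /inner -cintZl//; last exact: cbmM.
by apply: eq_cint => x _; rewrite mulrA.
Qed.

Lemma sqnorm_ge0 f : 0 <= sqnorm f.
Proof. by apply: Rintegral_ge0 => x _; exact: sqmod_ge0. Qed.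

(** Subtracting a multiple [c] of [g] is best done with the Fourier coefficient;
    completing the square measures the loss for any other [c]. *)
Lemma sqnormB1 c f g (V : R) : cbm f -> cbm g -> V != 0 -> sqnorm g = V ->
  sqnorm (fun x => f x - c * g x) =
  sqnorm f - sqmod (inner f g) / V + V * sqmod (c - inner f g / V%:C).
Proof.
move=> bf bg V0 gV.
have bcg : cbm (fun x => c * g x) by apply: cbmM => //; exact: cbm_cst.
have bfcg := cbmB bf bcg.
apply: (@complexI R).
rewrite -inner_sqnorm// innerBl// innerZl//.
rewrite [inner f _]innerJ// [inner g _]innerJ// !innerBl// !innerZl//.
rewrite !inner_sqnorm// gV (innerJ bf bg).
case: c {bcg bfcg} => c1 c2; case: (inner f g) => i1 i2.
have -> : (i1 +i* i2) / V%:C = (i1 / V) +i* (i2 / V).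
  rewrite -fmorphV /=; apply/eqP; rewrite eq_complex /=; apply/andP; split; apply/eqP; ring.
apply/eqP; rewrite eq_complex /sqmod /=; apply/andP; split; apply/eqP; by field.
Qed.

Variables (I : eqType) (e : I -> T -> R[i]) (L : set I) (V : R).
Hypotheses (be : forall i, cbm (e i)) (V0 : 0 < V)
  (eV : forall i, sqnorm (e i) = V)
  (orth : forall i j, L i -> L j -> i != j -> inner (e i) (e j) = 0).

(** The first conclusion is what lets the induction go through: after removing
    finitely many terms, the remaining coefficients are unchanged. *)
Lemma sqnorm_sub_orthogonal f (s : seq I) (c : I -> R[i]) : cbm f -> uniq s ->
  (forall i, i \in s -> L i) ->
  (forall j, L j -> j \notin s ->
    inner (fun x => f x - \sum_(i <- s) c i * e i x) (e j) = inner f (e j)) /\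
  sqnorm (fun x => f x - \sum_(i <- s) c i * e i x) =
  sqnorm f - (\sum_(i <- s) sqmod (inner f (e i))) / V +
  V * \sum_(i <- s) sqmod (c i - inner f (e i) / V%:C).
Proof.
move=> bf; elim: s => [|i s ih] /=.
  have E : (fun x => f x - \sum_(i <- [::]) c i * e i x) = f.
    by apply/funext => x; rewrite big_nil subr0.
  by move=> _ _; rewrite E !big_nil mul0r mulr0 subr0 addr0.
move=> /andP[si us] isL.
have {}ih := ih us (fun j js => isL j (mem_behead (s := i :: s) js)).
have E : (fun x => f x - \sum_(i <- i :: s) c i * e i x) =
    (fun x => (f x - \sum_(i <- s) c i * e i x) - c i * e i x).
  by apply/funext => x; rewrite big_cons; ring.
have bg : cbm (fun x => f x - \sum_(i <- s) c i * e i x).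
  apply: cbmB => //; apply: (@cbm_sum _ _ _ _ _ (fun i x => c i * e i x)) => j.
  by apply: cbmM => //; exact: cbm_cst.
have bci : cbm (fun x => c i * e i x) by apply: cbmM => //; exact: cbm_cst.
have Li : L i by apply: isL; rewrite mem_head.
split.
  move=> j Lj; rewrite inE negb_or => /andP[ji js].
  rewrite E innerBl// ih.1// innerZl// (orth Li Lj); last by rewrite eq_sym.
  by rewrite mulr0 subr0.
rewrite E (@sqnormB1 _ _ _ V)// ?gt_eqF// ih.2 ih.1// !big_cons; ring.
Qed.

Lemma bessel f (s : seq I) : cbm f -> uniq s -> (forall i, i \in s -> L i) ->
  \sum_(i <- s) sqmod (inner f (e i)) <= V * sqnorm f.
Proof.
move=> bf us sL.
have := (@sqnorm_sub_orthogonal f s (fun i => inner f (e i) / V%:C) bf us sL).2.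
rewrite [X in V * X]big1 => [|i _]; last by rewrite subrr sqmod0.
rewrite mulr0 addr0 => E; have := sqnorm_ge0 (fun x => f x - \sum_(i <- s) inner f (e i) / V%:C * e i x).
by rewrite E subr_ge0 ler_pdivrMr// mulrC.
Qed.

Lemma sqnorm_sub_orthogonal_ge f (s : seq I) (c : I -> R[i]) : cbm f -> uniq s ->
  (forall i, i \in s -> L i) ->
  sqnorm f - (\sum_(i <- s) sqmod (inner f (e i))) / V <=
  sqnorm (fun x => f x - \sum_(i <- s) c i * e i x).
Proof.
move=> bf us sL; rewrite (sqnorm_sub_orthogonal c bf us sL).2 lerDl.
by apply: mulr_ge0; [exact: ltW | apply: sumr_ge0 => i _; exact: sqmod_ge0].
Qed.

End bessel.

(** * Integrals against the characters of the line *)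

Section oscillating_integrals.
Context {R : realType}.
Notation mR := (measurableTypeR R).
Notation pl := (mR * mR)%type.
Notation la := (@lebesgue_measure R).

Lemma is_derive_cosM (k x : R) :
  is_derive x 1 (fun t : R => cos (t * k)) (- (k * sin (x * k))).
Proof.
have h : is_derive x 1 (fun t : R => t * k) k.
  by apply: is_derive_eq; rewrite /GRing.scale /= mulr0 add0r mulr1.
have := @is_derive1_comp _ (@cos R) (fun t => t * k) x _ _ (is_derive_cos (x * k)) h.
by move=> H; apply: (is_derive_eq H); rewrite mulNr mulrC.
Qed.

Lemma is_derive_sinM (k x : R) :
  is_derive x 1 (fun t : R => sin (t * k)) (k * cos (x * k)).
Proof.
have h : is_derive x 1 (fun t : R => t * k) k.
  by apply: is_derive_eq; rewrite /GRing.scale /= mulr0 add0r mulr1.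
have := @is_derive1_comp _ (@sin R) (fun t => t * k) x _ _ (is_derive_sin (x * k)) h.
by move=> H; apply: (is_derive_eq H); rewrite mulrC.
Qed.

Lemma Rintegral_derive (F f : R -> R) (a b : R) : a < b ->
  (forall x : R, is_derive x 1 F (f x)) -> continuous f ->
  \int[la]_(x in `[a, b]) f x = F b - F a.
Proof.
move=> ab dF cf.
have cF : continuous F.
  by move=> x; apply/differentiable_continuous/derivable1_diffP; have [] := dF x.
rewrite /Rintegral (@continuous_FTC2 _ f F)//.
- exact: continuous_subspaceT.
- split.
  + by move=> x _; have [] := dF x.
  + by apply: cvg_at_right_filter; exact: cF.
  + by apply: cvg_at_left_filter; exact: cF.
- by move=> x _; rewrite derive1E; have [_ ->] := dF x.
Qed.

Lemma continuous_cosM (k : R) : continuous (fun t : R => cos (t * k)).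
Proof.
move=> x; apply/differentiable_continuous/derivable1_diffP.
by have [] := is_derive_cosM k x.
Qed.

Lemma continuous_sinM (k : R) : continuous (fun t : R => sin (t * k)).
Proof.
move=> x; apply/differentiable_continuous/derivable1_diffP.
by have [] := is_derive_sinM k x.
Qed.

(** The character [exp (2 i pi u)] of the line. *)
Definition cis (u : R) : R[i] := cos (2 * pi * u) +i* sin (2 * pi * u).

Lemma cis0 : cis 0 = 1.
Proof. by rewrite /cis mulr0 cos0 sin0. Qed.

Lemma cisD u v : cis (u + v) = cis u * cis v.
Proof.
rewrite /cis mulrDr cosD sinD; apply/eqP; rewrite eq_complex /=.
by apply/andP; split; apply/eqP; ring.
Qed.

Lemma cisN u : cis (- u) = conjc (cis u).
Proof. by rewrite /cis mulrN cosN sinN. Qed.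

Lemma sqmod_cis u : sqmod (cis u) = 1.
Proof. exact: cos2Dsin2. Qed.

Lemma cis_neq0 u : cis u != 0.
Proof. by rewrite -sqmod_eq0 sqmod_cis oner_neq0. Qed.

Lemma cisB u v : cis (u - v) = cis u * conjc (cis v).
Proof. by rewrite cisD cisN. Qed.

Lemma cis_nat (n : nat) : cis n%:R = 1.
Proof.
elim: n => [|n ih]; first exact: cis0.
rewrite -addn1 natrD cisD ih mul1r /cis mulr1 mulr_natl cos2pi sin2pi.
by apply/eqP; rewrite eq_complex /= !eqxx.
Qed.

Lemma cis_int (m : int) : cis m%:~R = 1.
Proof.
case: m => n; first exact: cis_nat.
rewrite NegzE mulrNz cisN -pmulrn cis_nat.
by apply/eqP; rewrite eq_complex /= oppr0 !eqxx.
Qed.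

(** The fractional part [f] of [u] satisfies [1 = cos (2 pi f) = 1 - 2 sin (pi f) ^ 2],
    and [sin] does not vanish strictly between [0] and [pi]. *)
Lemma cis_eq1 u : cis u = 1 -> exists m : int, u = m%:~R.
Proof.
move=> u1; pose m := Num.floor u.
have m1 := cis_int m.
have : cis (u - m%:~R) = 1 by rewrite cisB u1 m1 mul1r rmorph1.
set f := u - _ => f1.
have f0 : 0 <= f by rewrite subr_ge0 floor_le.
have f_lt1 : f < 1 by rewrite ltrBlDr addrC -[1]/(1%:~R) -intrD floorD1_gt.
exists m; apply/eqP; rewrite -subr_eq0 -/f.
have [f0'|/negPf f0'] := eqVneq f 0; first by [].
exfalso; have fpos : 0 < f by rewrite lt_def f0' f0.
have sp : 0 < sin (pi * f).
  by apply: sin_gt0_pi; rewrite mulr_gt0 ?pi_gt0//= gtr_pMr ?pi_gt0.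
have [c1 _] : cos (2 * pi * f) = 1 /\ True by case: f1.
have : cos (2 * pi * f) = 1 - 2 * sin (pi * f) ^+ 2.
  have -> : 2 * pi * f = pi * f + pi * f by ring.
  by rewrite cosD -!expr2 cos2sin2; ring.
rewrite c1 => h.
have : 0 < sin (pi * f) ^+ 2 by rewrite exprn_gt0.
lra.
Qed.

Definition i2pi : R[i] := 0 +i* (2 * pi).

Lemma cbm_cisM (k : R) : cbm (fun t : mR => cis (t * k)).
Proof.
split; split.
- rewrite (_ : (fun _ => _) = (fun t : R => cos (t * (2 * pi * k)))); last first.
    by apply/funext => t; rewrite /cis /=; congr cos; ring.
  by apply: continuous_measurable_fun; exact: continuous_cosM.
- by exists 1 => x; exact: cos_max.
- rewrite (_ : (fun _ => _) = (fun t : R => sin (t * (2 * pi * k)))); last first.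
    by apply/funext => t; rewrite /cis /=; congr sin; ring.
  by apply: continuous_measurable_fun; exact: continuous_sinM.
- by exists 1 => x; exact: sin_max.
Qed.

(** Integration by parts against a character: the boundary terms are those
    of [phi * exp (2 i pi k)]. *)
Lemma cint_derive_cisM (k a b : R) (phi dphi : R -> R) : a < b ->
  (forall x : R, is_derive x 1 phi (dphi x)) -> continuous dphi ->
  bounded_measurable (phi : mR -> R) -> bounded_measurable (dphi : mR -> R) ->
  cint la `[a, b]%classic (fun t => (dphi t)%:C * cis (t * k)) +
  i2pi * k%:C * cint la `[a, b]%classic (fun t => (phi t)%:C * cis (t * k)) =
  (phi b)%:C * cis (b * k) - (phi a)%:C * cis (a * k).
Proof.
move=> ab dphiE cdphi bphi bdphi.
have cphi : continuous phi.
  by move=> x; apply/differentiable_continuous/derivable1_diffP; have [] := dphiE x.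
have mab : measurable (`[a, b]%classic : set mR) by exact: measurable_itv.
have aboo : (la `[a, b]%classic < +oo)%E by rewrite lebesgue_measure_itv; case: ifP => // _; rewrite -EFinB ltry.
have b1 := cbm_real bphi; have b2 := cbm_real bdphi; have b3 := cbm_cisM k.
have bp := cbmM b1 b3; have bd := cbmM b2 b3.
have bpc := cbmM (cbm_cst mR (i2pi * k%:C)) bp.
rewrite -cintZl// -cintD//.
pose K := 2 * pi * k.
have KE t : 2 * pi * (t * k) = t * K by rewrite /K; ring.
apply/eqP; rewrite eq_complex; apply/andP; split; apply/eqP.
- rewrite [LHS]/=.
  have dF (x : R) : is_derive x 1 (fun t : R => phi t * cos (t * K))
     (dphi x * cos (x * K) - K * (phi x * sin (x * K))).
    have := is_deriveM (dphiE x) (is_derive_cosM K x).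
    by move=> H; apply: (is_derive_eq H); rewrite /GRing.scale /=; ring.
  rewrite -[LHS](_ : \int[la]_(x in `[a, b])
      (dphi x * cos (x * K) - K * (phi x * sin (x * K))) = _); last first.
    by apply: eq_Rintegral => x _; rewrite /i2pi /= !KE /K; ring.
  rewrite (Rintegral_derive ab dF); last first.
    move=> x; apply: cvgB.
      by apply: cvgM; [exact: cdphi | exact: continuous_cosM].
    apply: cvgM; first exact: cvg_cst.
    by apply: cvgM; [exact: cphi | exact: continuous_sinM].
  by rewrite /= !KE; ring.
- rewrite [LHS]/=.
  have dF (x : R) : is_derive x 1 (fun t : R => phi t * sin (t * K))
     (dphi x * sin (x * K) + K * (phi x * cos (x * K))).
    have := is_deriveM (dphiE x) (is_derive_sinM K x).
    by move=> H; apply: (is_derive_eq H); rewrite /GRing.scale /=; ring.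
  rewrite -[LHS](_ : \int[la]_(x in `[a, b])
      (dphi x * sin (x * K) + K * (phi x * cos (x * K))) = _); last first.
    by apply: eq_Rintegral => x _; rewrite /i2pi /= !KE /K; ring.
  rewrite (Rintegral_derive ab dF); last first.
    move=> x; apply: cvgD.
      by apply: cvgM; [exact: cdphi | exact: continuous_sinM].
    apply: cvgM; first exact: cvg_cst.
    by apply: cvgM; [exact: cphi | exact: continuous_cosM].
  by rewrite /= !KE; ring.
Qed.

Lemma cint_cisM (k a b : R) : a < b ->
  i2pi * k%:C * cint la `[a, b]%classic (fun t => cis (t * k)) = cis (b * k) - cis (a * k).
Proof.
move=> ab.
have d1 (x : R) : is_derive x 1 (fun=> 1 : R) ((fun=> 0) x) by exact: is_derive_cst.
have := cint_derive_cisM k ab d1 (fun x => cvg_cst _) (bounded_measurable_cst mR 1)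
  (bounded_measurable_cst mR 0).
rewrite !mul1r => <-.
rewrite (_ : cint _ _ (fun t => 0%:C * _) = 0) ?add0r.
  by congr (_ * _); apply: eq_cint => x _; rewrite mul1r.
rewrite (@eq_cint _ _ _ _ _ _ (fun=> (0 : R)%:C)); last by move=> x _; rewrite mul0r.
by rewrite cint_real// Rintegral_cst// mul0r.
Qed.

End oscillating_integrals.

(** * Coordinates along two independent vectors *)

Section plane_integrals.
Context {R : realType}.
Notation mR := (measurableTypeR R).
Notation pl := (mR * mR)%type.
Notation la := (@lebesgue_measure R).

Lemma Rintegral_prod (A B : set mR) (g h : mR -> R) :
  measurable A -> measurable B -> (la A < +oo)%E -> (la B < +oo)%E ->
  bounded_measurable g -> bounded_measurable h ->
  \int[leb2 R]_(z in A `*` B) (g z.1 * h z.2) =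
  (\int[la]_(x in A) g x) * (\int[la]_(y in B) h y).
Proof.
move=> mA mB Aoo Boo bg bh.
have mAB : measurable (A `*` B) by exact: measurableX.
have ABoo : (leb2 R (A `*` B) < +oo)%E.
  by rewrite [X in (X < _)%E](product_measure1E _ _ mA mB) lte_mul_pinfty// ge0_fin_numE.
pose f (z : pl) := g z.1 * h z.2.
have bf : bounded_measurable f.
  case: bg bh => [mg [M Mg]] [mh [N Nh]]; apply: bounded_measurableM; split.
  - exact: measurableT_comp.
  - by exists M => z.
  - exact: measurableT_comp.
  - by exists N => z.
have fi := integrable_bounded_measurable mAB ABoo bf.
have gi := integrable_bounded_measurable mA Aoo bg.
have hi := integrable_bounded_measurable mB Boo bh.
pose IB := \int[la]_(y in B) h y.
have IBE : (\int[la]_(y in B) (h y)%:E = IB%:E)%E by rewrite fineK//; exact: integrable_fin_num.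
rewrite /Rintegral integral_mkcond -integral12_prod_meas1; last first.
  exact/(integrable_mkcond _ mAB).
rewrite [X in fine X](_ : _ = (\int[la]_(x in A) ((g x * IB)%:E))%E).
  exact: RintegralZr.
rewrite [RHS]integral_mkcond; apply: eq_integral => x _.
rewrite /fubini_F.
transitivity (\int[la]_y (((fun y => (g x * h y)%:E) \_ B) y * (\1_A x)%:E))%E.
  apply: eq_integral => y _; rewrite !patchE indicE /= in_setX /=.
  by case: (x \in A); case: (y \in B) => /=; rewrite ?mule1 ?mule0.
have ghi : la.-integrable B (fun y => (g x * h y)%:E).
  apply: integrable_bounded_measurable => //.
  exact: (bounded_measurableM (bounded_measurable_cst _ _)).
rewrite integralZr//; last exact/(integrable_mkcond _ mB).
rewrite -integral_mkcond patchE indicE.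
under eq_integral do rewrite EFinM.
rewrite integralZl// IBE.
by case: (x \in A); rewrite ?mule1 ?mule0 ?EFinM.
Qed.

Lemma cint_prod (A B : set mR) (g h : mR -> R[i]) :
  measurable A -> measurable B -> (la A < +oo)%E -> (la B < +oo)%E ->
  cbm g -> cbm h ->
  cint (leb2 R) (A `*` B) (fun z => g z.1 * h z.2) = cint la A g * cint la B h.
Proof.
move=> mA mB Aoo Boo [g1 g2] [h1 h2].
have mAB : measurable (A `*` B) by exact: measurableX.
have ABoo : (leb2 R (A `*` B) < +oo)%E.
  by rewrite [X in (X < _)%E](product_measure1E _ _ mA mB) lte_mul_pinfty// ge0_fin_numE.
have bgh (g' h' : mR -> R) : bounded_measurable g' -> bounded_measurable h' ->
    (leb2 R).-integrable (A `*` B) (EFin \o (fun z => g' z.1 * h' z.2)).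
  move=> [mg [M Mg]] [mh [N Nh]]; apply: integrable_bounded_measurable => //.
  apply: bounded_measurableM; split.
  - exact: measurableT_comp.
  - by exists M => z.
  - exact: measurableT_comp.
  - by exists N => z.
apply/eqP; rewrite eq_complex /=; apply/andP; split; apply/eqP.
- rewrite -!Rintegral_prod// -RintegralB//; [|exact: (bgh _ _ g1 h1)|exact: (bgh _ _ g2 h2)].
  by apply: eq_Rintegral => z _; case: (g z.1); case: (h z.2).
- rewrite -!Rintegral_prod// -RintegralD//; [|exact: (bgh _ _ g1 h2)|exact: (bgh _ _ g2 h1)].
  by apply: eq_Rintegral => z _; case: (g z.1); case: (h z.2).
Qed.

Lemma cint_affine (a b c d e f : R) (D : set pl) (F : pl -> R[i]) :
  a * d - b * c != 0 -> measurable D -> (leb2 R D < +oo)%E -> cbm F ->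
  cint (leb2 R) D F =
  `|a * d - b * c|%:C * cint (leb2 R) (affine a b c d e f @^-1` D)
    (fun z => F (affine a b c d e f z)).
Proof.
move=> det0 mD Doo [F1 F2].
apply/eqP; rewrite eq_complex /= !mul0r subr0 addr0.
apply/andP; split; apply/eqP.
all: by apply: Rintegral_affine => //; exact: integrable_bounded_measurable.
Qed.

Lemma cint_itv (b0 b1 : bool) (a b : R) (f : mR -> R[i]) : cbm f ->
  cint la [set` Interval (BSide b0 a) (BSide b1 b)] f = cint la `[a, b]%classic f.
Proof.
move=> [f1 f2].
have I (g : mR -> R) c0 c1 : bounded_measurable g ->
    la.-integrable [set` Interval (BSide c0 a) (BSide c1 b)] (EFin \o g).
  move=> bg; apply: integrable_bounded_measurable => //.
  by rewrite [X in (X < _)%E]lebesgue_measure_itv; case: ifP => // _; rewrite -EFinB ltry.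
have E (g : mR -> R) : bounded_measurable g ->
    \int[la]_(x in [set` Interval (BSide b0 a) (BSide b1 b)]) g x =
    \int[la]_(x in `[a, b]) g x.
  move=> bg; transitivity (\int[la]_(x in [set` Interval (BSide b0 a) (BRight b)]) g x).
    by case: b1 => //; rewrite Rintegral_itv_bndo_bndc//; exact: I.
  by case: b0 => //; rewrite Rintegral_itv_obnd_cbnd//; exact: I.
by apply/eqP; rewrite eq_complex /= !E ?eqxx.
Qed.

End plane_integrals.

Section frames.
Context {R : realType}.
Notation mR := (measurableTypeR R).
Notation pl := (mR * mR)%type.
Notation la := (@lebesgue_measure R).
Implicit Types (o u v a c z x : R * R).

Definition wedge u v : R := u.1 * v.2 - u.2 * v.1.

(** The map sending the coordinates [z] to the point [o + z.1 u + z.2 v];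
    its inverse [frame_coord] is given by Cramer's rule. *)
Definition frame o u v : R * R -> R * R := affine u.1 v.1 u.2 v.2 o.1 o.2.

Definition frame_coord o u v z : R * R :=
  (wedge (z - o) v / wedge u v, wedge u (z - o) / wedge u v).

Arguments frame : simpl never.
Arguments frame_coord : simpl never.

Lemma frameK o u v z : wedge u v != 0 -> frame_coord o u v (frame o u v z) = z.
Proof.
case: o u v z => [p1 p2] [u1 u2] [v1 v2] [z1 z2].
rewrite /wedge /frame_coord /frame /affine /wedge /= => w0.
by congr (_, _); field.
Qed.

Lemma coordK o u v z : wedge u v != 0 -> frame o u v (frame_coord o u v z) = z.
Proof.
case: o u v z => [p1 p2] [u1 u2] [v1 v2] [z1 z2].
rewrite /wedge /frame_coord /frame /affine /wedge /= => w0.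
by congr (_, _); field.
Qed.

Lemma measurable_frame o u v : measurable_fun [set: pl] (frame o u v : pl -> pl).
Proof. exact: measurable_affine. Qed.

Lemma measurable_coord o u v : measurable_fun [set: pl] (frame_coord o u v : pl -> pl).
Proof.
set w := wedge u v.
have := @measurable_affine R (v.2 / w) (- v.1 / w) (- u.2 / w) (u.1 / w)
  ((- o.1 * v.2 + o.2 * v.1) / w) ((- u.1 * o.2 + u.2 * o.1) / w).
congr measurable_fun; apply/funext => z; rewrite /affine /frame_coord -/w /wedge /=.
by congr (_, _); ring.
Qed.

Lemma measurable_coord_preimage o u v (A : set pl) :
  measurable A -> measurable (frame_coord o u v @^-1` A).
Proof. by move=> mA; rewrite -[X in measurable X]setTI; exact: measurable_coord. Qed.

Lemma frame_preimage o u v (A : set pl) : wedge u v != 0 ->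
  frame o u v @^-1` (frame_coord o u v @^-1` A) = A.
Proof. by move=> w0; apply/seteqP; split => z /=; rewrite frameK. Qed.

Lemma leb2_coord_preimage o u v (A : set pl) : wedge u v != 0 -> measurable A ->
  leb2 R (frame_coord o u v @^-1` A) = (`|wedge u v|%:E * leb2 R A)%E.
Proof.
move=> w0 mA; have mcA := measurable_coord_preimage o u v mA.
have w0' : u.1 * v.2 - v.1 * u.2 != 0 by move: w0; rewrite /wedge (mulrC v.1).
have := @ge0_integral_affine_in _ u.1 v.1 u.2 v.2 o.1 o.2 _ (cst 1%E) w0' mcA
  (measurable_cst _) (fun _ => lee01).
rewrite -/(frame o u v) frame_preimage// !integral_cst// !mul1e => ->.
by rewrite /wedge (mulrC v.1).
Qed.

Lemma leb2_box (a b c d : R) : (leb2 R (`[a, b] `*` `[c, d])%classic < +oo)%E.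
Proof.
have lt (x y : R) : (la `[x, y]%classic < +oo)%E.
  by rewrite lebesgue_measure_itv; case: ifP => // _; rewrite -EFinB ltry.
have m (x y : R) : measurable (`[x, y]%classic : set mR) by exact: measurable_itv.
rewrite [X in (X < _)%E](product_measure1E _ _ (m _ _) (m _ _)).
apply: lte_mul_pinfty; [by []| |exact: lt]; rewrite ge0_fin_numE; [exact: lt|exact: measure_ge0].
Qed.

Lemma cint_frame o u v (A : set pl) (F : pl -> R[i]) : wedge u v != 0 ->
  measurable A -> (leb2 R A < +oo)%E -> cbm F ->
  cint (leb2 R) (frame_coord o u v @^-1` A) F =
  `|wedge u v|%:C * cint (leb2 R) A (fun z => F (frame o u v z)).
Proof.
move=> w0 mA Aoo bF.
have w0' : u.1 * v.2 - v.1 * u.2 != 0 by move: w0; rewrite /wedge (mulrC v.1).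
rewrite (@cint_affine _ u.1 v.1 u.2 v.2 o.1 o.2)//; last 2 first.
- exact: measurable_coord_preimage.
- by rewrite leb2_coord_preimage// lte_mul_pinfty.
rewrite -/(frame o u v) frame_preimage//.
by rewrite /wedge (mulrC v.1).
Qed.

Lemma dot_frame x o u v z :
  dot x (frame o u v z) = dot x o + (z.1 * dot x u + z.2 * dot x v).
Proof. rewrite /dot /frame /affine /=; ring. Qed.

Lemma expcharE x z : expchar x z = cis (dot x z).
Proof. by []. Qed.

Lemma dotDl x y z : dot (x + y) z = dot x z + dot y z.
Proof. rewrite /dot /=; ring. Qed.

Lemma dotNl x z : dot (- x) z = - dot x z.
Proof. rewrite /dot /=; ring. Qed.

Lemma dotBl x y z : dot (x - y) z = dot x z - dot y z.
Proof. by rewrite dotDl dotNl. Qed.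

Lemma dotDr x y z : dot x (y + z) = dot x y + dot x z.
Proof. rewrite /dot /=; ring. Qed.

Lemma expcharM_conj x y z : expchar x z * conjc (expchar y z) = expchar (x - y) z.
Proof. by rewrite !expcharE dotBl cisB. Qed.

Lemma cbm_expchar x : cbm (expchar x : pl -> R[i]).
Proof.
have m : measurable_fun [set: pl] (fun z : pl => 2 * pi * dot x z : mR).
  apply: measurable_funM => //.
  by apply: measurable_funD; apply: measurable_funM.
split; split.
- by apply: (measurableT_comp _ m); apply: continuous_measurable_fun; exact: continuous_cos.
- by exists 1 => z; exact: cos_max.
- by apply: (measurableT_comp _ m); apply: continuous_measurable_fun; exact: continuous_sin.
- by exists 1 => z; exact: sin_max.
Qed.

(** The mean of [exp (2 i pi k t)] over [t] in the unit interval. *)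
Definition unit_mean (k : R) : R[i] := cint la `[0, 1]%classic (fun t => cis (t * k)).

Lemma unit_meanE (k : R) : i2pi * k%:C * unit_mean k = cis k - 1.
Proof. by rewrite cint_cisM// mul1r mul0r cis0. Qed.

(** Whether the sides belong to the parallelogram is left free, so that the
    formula applies to the pieces of a partition. *)
Lemma cint_parallelogram o u v (b0 b1 b2 b3 : bool) x : wedge u v != 0 ->
  cint (leb2 R) (frame_coord o u v @^-1` ([set` Interval (BSide b0 0) (BSide b1 1)] `*`
      [set` Interval (BSide b2 0) (BSide b3 1)])) (expchar x) =
  `|wedge u v|%:C * (cis (dot x o) * (unit_mean (dot x u) * unit_mean (dot x v))).
Proof.
move=> w0.
have lt b b' : (la [set` Interval (BSide b 0%R) (BSide b' 1%R)] < +oo)%E.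
  by rewrite [X in (X < _)%E]lebesgue_measure_itv; case: ifP => // _; rewrite -EFinB ltry.
set A := [set` _]; set B := [set` _].
have mA : measurable (A : set mR) by exact: measurable_itv.
have mB : measurable (B : set mR) by exact: measurable_itv.
have mAB : measurable ((A `*` B) : set pl) by exact: measurableX.
have ABoo : (leb2 R (A `*` B) < +oo)%E.
  rewrite [X in (X < _)%E](product_measure1E _ _ mA mB).
  apply: lte_mul_pinfty; [by []| |exact: lt]; rewrite ge0_fin_numE; [exact: lt|exact: measure_ge0].
rewrite cint_frame//; last exact: cbm_expchar.
congr (_ * _).
pose g t := cis (dot x o) * cis (t * dot x u).
have bg : cbm (g : mR -> R[i]) by apply: cbmM; [exact: cbm_cst|exact: cbm_cisM].
rewrite (@eq_cint _ _ _ _ _ _ (fun z : pl => g z.1 * cis (z.2 * dot x v))); last first.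
  by move=> z _; rewrite expcharE dot_frame cisD [X in _ * X]cisD /g mulrA.
rewrite (@cint_prod _ A B g (fun t => cis (t * dot x v)) mA mB (lt _ _) (lt _ _) bg (cbm_cisM _)).
rewrite !cint_itv//; last exact: cbm_cisM.
rewrite mulrA cintZl//; [exact: lt|exact: cbm_cisM].
Qed.

End frames.

(** * The hexagon and its Fourier transform *)

Section hexagon_transform.
Context {R : realType}.
Notation mR := (measurableTypeR R).
Notation pl := (mR * mR)%type.
Notation la := (@lebesgue_measure R).
Implicit Types (o u v a c z x : R * R) (P Q : R).

Definition third_edge a c P Q : R * R := (P * a.1 + Q * c.1, P * a.2 + Q * c.2).

(** The hexagon in the coordinates along [a] and [c]: its vertices are
    [(0, 0)], [(1, 0)], [(1 + P, Q)], [(1 + P, 1 + Q)], [(P, 1 + Q)] and [(0, 1)],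
    so that its edges are [(1, 0)], [(P, Q)] and [(0, 1)]. *)
Definition hexbox P Q : set (R * R) :=
  [set z | [/\ 0 <= z.1 <= 1 + P, 0 <= z.2 <= 1 + Q & - Q <= P * z.2 - Q * z.1 <= P]].

Definition hexagon o a c P Q : set (R * R) := frame_coord o a c @^-1` hexbox P Q.

Lemma measurable_linear_form P Q :
  measurable_fun [set: pl] (fun z : pl => P * z.2 - Q * z.1 : mR).
Proof. by apply: measurable_funB; apply: measurable_funM. Qed.

Lemma measurable_hexbox P Q : measurable (hexbox P Q : set pl).
Proof.
have -> : hexbox P Q = (`[0, 1 + P] `*` `[0, 1 + Q])%classic `&`
    ((fun z : pl => P * z.2 - Q * z.1 : mR) @^-1` `[- Q, P]%classic).
  apply/seteqP; split => z /=; rewrite !in_itv/=; first by case.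
  by case=> -[].
apply: measurableI.
- by apply: measurableX; exact: measurable_itv.
- rewrite -[X in measurable X]setTI; apply: measurable_linear_form => //.
Qed.

Lemma leb2_hexbox P Q : (leb2 R (hexbox P Q) < +oo)%E.
Proof.
apply: le_lt_trans (leb2_box 0 (1 + P) 0 (1 + Q)).
apply: le_measure; rewrite ?inE; first exact: measurable_hexbox.
- by apply: measurableX; exact: measurable_itv.
- move=> z [h1 h2 _] /=; rewrite !in_itv/=. by split.
Qed.

Lemma measurable_hexagon o a c P Q : measurable (hexagon o a c P Q : set pl).
Proof. by apply: measurable_coord_preimage; exact: measurable_hexbox. Qed.

Lemma leb2_hexagon o a c P Q : wedge a c != 0 ->
  (leb2 R (hexagon o a c P Q) < +oo)%E.
Proof.
move=> w0; rewrite leb2_coord_preimage//; last exact: measurable_hexbox.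
apply: lte_mul_pinfty => //; exact: leb2_hexbox.
Qed.

Lemma wedge_third_edgel a c P Q : wedge (third_edge a c P Q) c = P * wedge a c.
Proof. rewrite /wedge /third_edge /=; ring. Qed.

Lemma wedge_third_edger a c P Q : wedge a (third_edge a c P Q) = Q * wedge a c.
Proof. rewrite /wedge /third_edge /=; ring. Qed.

Lemma dot_third_edge x a c P Q : dot x (third_edge a c P Q) = P * dot x a + Q * dot x c.
Proof. rewrite /dot /third_edge /=; ring. Qed.

Lemma coord_eq o u v z w : wedge u v != 0 -> z = frame o u v w -> frame_coord o u v z = w.
Proof. by move=> w0 ->; rewrite frameK. Qed.

Lemma wedgeC_neq0 u v : wedge u v != 0 -> wedge v u != 0.
Proof. by rewrite (_ : wedge v u = - wedge u v) ?oppr_eq0// /wedge; ring. Qed.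

Lemma frame_coordC o u v z : wedge u v != 0 ->
  frame_coord o v u z = ((frame_coord o u v z).2, (frame_coord o u v z).1).
Proof.
move=> w0; apply: coord_eq; first exact: wedgeC_neq0.
rewrite -[z in LHS](coordK o z w0).
by rewrite /frame /affine /=; congr (_, _); ring.
Qed.

Lemma coord_bc o a c P Q z : wedge a c != 0 -> P != 0 ->
  frame_coord (o + a) (third_edge a c P Q) c (frame o a c z) =
  ((z.1 - 1) / P, z.2 - Q * ((z.1 - 1) / P)).
Proof.
move=> w0 P0; apply: coord_eq; first by rewrite wedge_third_edgel mulf_neq0.
by rewrite /frame /affine /third_edge /=; congr (_, _); field.
Qed.

Lemma coord_ab o a c P Q z : wedge a c != 0 -> Q != 0 ->
  frame_coord (o + c) a (third_edge a c P Q) (frame o a c z) =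
  (z.1 - P * ((z.2 - 1) / Q), (z.2 - 1) / Q).
Proof.
move=> w0 P0; apply: coord_eq; first by rewrite wedge_third_edger mulf_neq0.
by rewrite /frame /affine /third_edge /=; congr (_, _); field.
Qed.

Local Opaque frame frame_coord.
(** Half-open sides make the three parallelograms that tile the hexagon
    genuinely disjoint; which sides are removed is dictated by the common
    corner [o + a + c]. *)
Lemma hexagon_tiling o a c P Q : wedge a c != 0 -> 0 < P -> 0 < Q ->
  let b := third_edge a c P Q in
  let A1 := frame_coord o a c @^-1` (`[0, 1] `*` `[0, 1])%classic in
  let A2 := frame_coord (o + a) b c @^-1` (`]0, 1] `*` `[0, 1])%classic in
  let A3 := frame_coord (o + c) a b @^-1` (`[0, 1[ `*` `]0, 1])%classic in
  [/\ hexagon o a c P Q = A1 `|` A2 `|` A3,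
      [disjoint A1 & A2] & [disjoint (A1 `|` A2) & A3] ].
Proof.
move=> w0 P0 Q0 b A1 A2 A3.
have Pn := lt0r_neq0 P0; have Qn := lt0r_neq0 Q0.
have memA1 z : A1 (frame o a c z) <-> (0 <= z.1 <= 1) /\ (0 <= z.2 <= 1).
  by rewrite /A1 /= frameK//= !in_itv/=.
have memA2 z : A2 (frame o a c z) <-> [/\ 1 < z.1, z.1 <= 1 + P,
    - Q <= P * z.2 - Q * z.1 & P * (z.2 - 1) <= Q * (z.1 - 1)].
  rewrite /A2 /= coord_bc//= !in_itv/=.
  set x := (z.1 - 1) / P; have -> : z.1 = 1 + P * x by rewrite /x; field.
  have -> : (1 < 1 + P * x) = (0 < x) by rewrite ltrDl pmulr_rgt0.
  have -> : (1 + P * x <= 1 + P) = (x <= 1) by rewrite lerD2l -[X in _ <= X]mulr1 ler_pM2l.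
  have -> : (- Q <= P * z.2 - Q * (1 + P * x)) = (0 <= z.2 - Q * x).
    rewrite -subr_ge0 -(pmulr_rge0 (z.2 - Q * x) P0); congr (_ <= _); ring.
  have -> : (P * (z.2 - 1) <= Q * (1 + P * x - 1)) = (z.2 - Q * x <= 1).
    rewrite -subr_ge0 -[RHS]subr_ge0 -(pmulr_rge0 (1 - _) P0); congr (_ <= _); ring.
  by split=> [[/andP[-> ->] /andP[-> ->]]|[-> -> -> ->]].
have memA3 z : A3 (frame o a c z) <-> [/\ 1 < z.2, z.2 <= 1 + Q,
    P * z.2 - Q * z.1 <= P & Q * (z.1 - 1) < P * (z.2 - 1)].
  rewrite /A3 /= coord_ab//= !in_itv/=.
  set x := (z.2 - 1) / Q; have -> : z.2 = 1 + Q * x by rewrite /x; field.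
  have -> : (1 < 1 + Q * x) = (0 < x) by rewrite ltrDl pmulr_rgt0.
  have -> : (1 + Q * x <= 1 + Q) = (x <= 1) by rewrite lerD2l -[X in _ <= X]mulr1 ler_pM2l.
  have -> : (P * (1 + Q * x) - Q * z.1 <= P) = (0 <= z.1 - P * x).
    rewrite -subr_ge0 -(pmulr_rge0 (z.1 - P * x) Q0); congr (_ <= _); ring.
  have -> : (Q * (z.1 - 1) < P * (1 + Q * x - 1)) = (z.1 - P * x < 1).
    rewrite -subr_gt0 -[RHS]subr_gt0 -(pmulr_rgt0 (1 - _) Q0); congr (_ < _); ring.
  by split=> [[/andP[-> ->] /andP[-> ->]]|[-> -> -> ->]].
have memH z : hexagon o a c P Q (frame o a c z) <-> hexbox P Q z.
  by rewrite /hexagon /= frameK.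
have onframe (X Y : set (R * R)) : (forall z, X (frame o a c z) <-> Y (frame o a c z)) -> X = Y.
  by move=> XY; apply/seteqP; split => z; rewrite -(coordK o z w0) => /XY.
split.
- apply: onframe => -[s t]; rewrite memH; split.
  + move=> [/= /andP[s0 s1] /andP[t0 t1] /andP[h1 h2]].
    have [sle|slt] := leP s 1; have [tle|tlt] := leP t 1.
    * by left; left; apply/memA1; rewrite /= s0 t0 sle tle.
    * by right; apply/memA3 => /=; split => //; nra.
    * by left; right; apply/memA2 => /=; split => //; nra.
    * have [h|h] := leP (P * (t - 1)) (Q * (s - 1)).
      - by left; right; apply/memA2.
      - by right; apply/memA3.
  + move=> [[/memA1|/memA2]|/memA3] /=.
    * move=> [/andP[s0 s1] /andP[t0 t1]].
      have Pt0 : 0 <= P * t by rewrite mulr_ge0// ltW.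
      have Pt1 : P * t <= P by rewrite ler_piMr// ltW.
      have Qs0 : 0 <= Q * s by rewrite mulr_ge0// ltW.
      have Qs1 : Q * s <= Q by rewrite ler_piMr// ltW.
      by split; apply/andP; split => /=; lra.
    * move=> [s1 sP h1 h2].
      have hq : 0 < Q * (s - 1) by rewrite mulr_gt0// subr_gt0.
      have hq' : Q * (s - 1) <= Q * P by rewrite ler_pM2l//; lra.
      have t0 : 0 <= t by rewrite -(pmulr_rge0 _ P0); lra.
      have t1 : t <= 1 + Q by rewrite -(ler_pM2l P0); lra.
      by split; apply/andP; split => //=; lra.
    * move=> [t1 tQ h1 h2].
      have hq : 0 < P * (t - 1) by rewrite mulr_gt0// subr_gt0.
      have hq' : P * (t - 1) <= P * Q by rewrite ler_pM2l//; lra.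
      have s0 : 0 <= s by rewrite -(pmulr_rge0 _ Q0); lra.
      have s1 : s <= 1 + P by rewrite -(ler_pM2l Q0); lra.
      by split; apply/andP; split => //=; lra.
- rewrite disj_set2E; apply/eqP; apply: onframe => -[s t]; split=> // -[/memA1 h1 /memA2 h2].
  by case: h1 h2 => /= /andP[? ?] _ [? _ _ _]; lra.
- rewrite disj_set2E; apply/eqP; apply: onframe => -[s t]; split=> //.
  move=> [[/memA1|/memA2] + /memA3] /=.
  + by move=> [_ /= /andP[? ?]] [? _ _ _]; lra.
  + by move=> [_ _ _ /= ?] [_ _ _ ?]; lra.
Qed.

Local Transparent frame frame_coord.
Lemma hexagon_swap o a c P Q : wedge a c != 0 ->
  hexagon o c a Q P = hexagon o a c P Q.
Proof.
move=> w0; rewrite /hexagon; apply/seteqP; split => z;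
  rewrite /preimage /mkset (frame_coordC o z w0) /hexbox /=.
  move=> [h1 h2 /andP[h3 h4]]; split => //; apply/andP; split; lra.
move=> [h1 h2 /andP[h3 h4]]; split => //; apply/andP; split; lra.
Qed.

(** The Fourier transform at [- x] of the indicator function of the hexagon. *)
Definition hexagon_ft o a c P Q x : R[i] := cint (leb2 R) (hexagon o a c P Q) (expchar x).

Lemma hexagon_ftE o a c P Q x : wedge a c != 0 -> 0 < P -> 0 < Q ->
  let al := dot x a in let ga := dot x c in let be := P * al + Q * ga in
  hexagon_ft o a c P Q x = `|wedge a c|%:C * cis (dot x o) *
   (unit_mean al * unit_mean ga + P%:C * cis al * (unit_mean be * unit_mean ga)
    + Q%:C * cis ga * (unit_mean al * unit_mean be)).
Proof.
move=> w0 P0 Q0 al ga be; rewrite /hexagon_ft.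
have [HE d12 d123] := hexagon_tiling o w0 P0 Q0.
have wb : wedge (third_edge a c P Q) c != 0.
  by rewrite wedge_third_edgel mulf_neq0// gt_eqF.
have wb' : wedge a (third_edge a c P Q) != 0.
  by rewrite wedge_third_edger mulf_neq0// gt_eqF.
move: HE d12 d123 => /=.
set A1 := _ @^-1` _; set A2 := _ @^-1` _; set A3 := _ @^-1` _ => HE d12 d123.
have m b0 b1 b2 b3 : measurable ([set` Interval (BSide b0 (0:R)) (BSide b1 1)] `*`
    [set` Interval (BSide b2 (0:R)) (BSide b3 1)] : set pl).
  by apply: measurableX; exact: measurable_itv.
have mA1 : measurable (A1 : set pl) by apply: measurable_coord_preimage; exact: m.
have mA2 : measurable (A2 : set pl) by apply: measurable_coord_preimage; exact: m.
have mA3 : measurable (A3 : set pl) by apply: measurable_coord_preimage; exact: m.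
have mH := measurable_hexagon o a c P Q.
have Hoo := @leb2_hexagon o a c P Q w0.
have be_ := cbm_expchar x.
rewrite HE in mH Hoo *.
rewrite (@cint_setU _ _ _ _ _ mH Hoo)//; last exact: measurableU.
rewrite (@cint_setU _ _ _ _ _ mH Hoo)//.
rewrite !cint_parallelogram//.
rewrite wedge_third_edgel wedge_third_edger !normrM (gtr0_norm P0) (gtr0_norm Q0).
rewrite dot_third_edge -/al -/ga -/be.
rewrite !dotDr !cisD -/al -/ga !rmorphM /=; ring.
Qed.

(** Multiplying the transform by the frequency along one edge turns one factor
    [unit_mean] of each term into a difference of values of [cis]. This form, for
    the third edge, locates the zeros far out; the forms for [a] and [c] show that
    the dual lattice consists of zeros. *)
Lemma hexagon_ft_be o a c P Q x : wedge a c != 0 -> 0 < P -> 0 < Q ->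
  let al := dot x a in let ga := dot x c in let be := P * al + Q * ga in
  i2pi * be%:C * hexagon_ft o a c P Q x = `|wedge a c|%:C * cis (dot x o) *
   (P%:C * unit_mean ga * (cis (al + be) - 1) + Q%:C * unit_mean al * (cis (be + ga) - 1)).
Proof.
move=> w0 P0 Q0 al ga be; rewrite hexagon_ftE// -/al -/ga -/be.
have Ea := unit_meanE al; have Eg := unit_meanE ga; have Eb := unit_meanE be.
have bE : be%:C = P%:C * al%:C + Q%:C * ga%:C by rewrite -!rmorphM -rmorphD.
clearbody be; clearbody al ga; rewrite !cisD.
have -> : cis be = 1 + i2pi * be%:C * unit_mean be by rewrite Eb; ring.
have -> : cis al = 1 + i2pi * al%:C * unit_mean al by rewrite Ea; ring.
have -> : cis ga = 1 + i2pi * ga%:C * unit_mean ga by rewrite Eg; ring.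
rewrite bE; ring.
Qed.

Lemma hexagon_ft_al o a c P Q x : wedge a c != 0 -> 0 < P -> 0 < Q ->
  let al := dot x a in let ga := dot x c in let be := P * al + Q * ga in
  i2pi * al%:C * hexagon_ft o a c P Q x = `|wedge a c|%:C * cis (dot x o) *
   (unit_mean ga * (cis (al + be) - 1) + Q%:C * unit_mean be * (cis al - cis ga)).
Proof.
move=> w0 P0 Q0 al ga be; rewrite hexagon_ftE// -/al -/ga -/be.
have Ea := unit_meanE al; have Eg := unit_meanE ga; have Eb := unit_meanE be.
have bE : be%:C = P%:C * al%:C + Q%:C * ga%:C by rewrite -!rmorphM -rmorphD.
clearbody be; clearbody al ga; rewrite !cisD.
have -> : cis be = 1 + i2pi * be%:C * unit_mean be by rewrite Eb; ring.
have -> : cis al = 1 + i2pi * al%:C * unit_mean al by rewrite Ea; ring.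
have -> : cis ga = 1 + i2pi * ga%:C * unit_mean ga by rewrite Eg; ring.
rewrite bE; ring.
Qed.

Lemma hexagon_ft_ga o a c P Q x : wedge a c != 0 -> 0 < P -> 0 < Q ->
  let al := dot x a in let ga := dot x c in let be := P * al + Q * ga in
  i2pi * ga%:C * hexagon_ft o a c P Q x = `|wedge a c|%:C * cis (dot x o) *
   (unit_mean al * (cis (be + ga) - 1) + P%:C * unit_mean be * (cis ga - cis al)).
Proof.
move=> w0 P0 Q0 /=; have := hexagon_ft_al o x (wedgeC_neq0 w0) Q0 P0.
rewrite /= /hexagon_ft hexagon_swap// (addrC (Q * _)) (addrC (dot x c)).
by rewrite (_ : wedge c a = - wedge a c) ?normrN// /wedge; ring.
Qed.

(** The lattice dual to the one generated by the translations [a + b], [b + c]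
    by which copies of the hexagon tile the plane. *)
Definition dual_lattice a c P Q : set (R * R) :=
  [set x | (exists m : int, dot x a + dot x (third_edge a c P Q) = m%:~R) /\
           (exists m : int, dot x (third_edge a c P Q) + dot x c = m%:~R)].

Lemma dot_eq0 a c x : wedge a c != 0 -> dot x a = 0 -> dot x c = 0 -> x = 0.
Proof.
case: a c x => [a1 a2] [c1 c2] [x1 x2]; rewrite /dot /wedge /= => w0 h1 h2.
have e1 : x1 * (a1 * c2 - a2 * c1) = 0.
  rewrite (_ : _ * _ = c2 * (x1 * a1 + x2 * a2) - a2 * (x1 * c1 + x2 * c2)); last by ring.
  by rewrite h1 h2; ring.
have e2 : x2 * (a1 * c2 - a2 * c1) = 0.
  rewrite (_ : _ * _ = a1 * (x1 * c1 + x2 * c2) - c1 * (x1 * a1 + x2 * a2)); last by ring.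
  by rewrite h1 h2; ring.
move/eqP: e1; rewrite mulf_eq0 (negPf w0) orbF => /eqP ->.
by move/eqP: e2; rewrite mulf_eq0 (negPf w0) orbF => /eqP ->.
Qed.

(** On the dual lattice [al + be] and [be + ga] are integers, where [al], [be],
    [ga] are the frequencies along [a], [b], [c]; hence [cis al = cis ga], and [al]
    and [ga] times the transform are both zero. *)
Lemma hexagon_ft_dual_lattice o a c P Q x : wedge a c != 0 -> 0 < P -> 0 < Q ->
  dual_lattice a c P Q x -> x != 0 -> hexagon_ft o a c P Q x = 0.
Proof.
move=> w0 P0 Q0 [[m mE] [n nE]] x0.
rewrite dot_third_edge in mE nE.
set al := dot x a in mE nE; set ga := dot x c in mE nE.
set be := P * al + Q * ga in mE nE.
have ABE : cis (al + be) = 1 by rewrite mE cis_int.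
have BCE : cis (be + ga) = 1 by rewrite nE cis_int.
have AC : cis al = cis ga.
  apply: (mulIf (cis_neq0 be)); rewrite -cisD ABE -BCE cisD mulrC //.
have i2pi0 : i2pi != 0 :> R[i].
  by rewrite -sqmod_eq0 /sqmod /= expr0n /= add0r sqrf_eq0 mulf_neq0// ?pnatr_eq0// gt_eqF// pi_gt0.
have ha := hexagon_ft_al o x w0 P0 Q0; have hg := hexagon_ft_ga o x w0 P0 Q0.
move: ha hg; rewrite /= -/al -/ga -/be ABE BCE AC !subrr !(mulr0, addr0).
move=> /eqP; rewrite !mulf_eq0 (negPf i2pi0) /=.
case/orP => [|/eqP //]; rewrite fmorph_eq0 => /eqP al0.
move=> /eqP; rewrite !mulf_eq0 (negPf i2pi0) /=.
case/orP => [|/eqP //]; rewrite fmorph_eq0 => /eqP ga0.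
by move: x0; rewrite (dot_eq0 w0 al0 ga0) eqxx.
Qed.

End hexagon_transform.

(** * Test functions supported by a parallelogram *)

Section test_functions.
Context {R : realType}.
Notation mR := (measurableTypeR R).
Notation pl := (mR * mR)%type.
Notation la := (@lebesgue_measure R).
Implicit Types (o u v a c z x : R * R) (P Q : R).

Lemma lebesgue_measure_itv_lt (x y : R) : (la `[x, y]%classic < +oo)%E.
Proof. by rewrite [X in (X < _)%E]lebesgue_measure_itv; case: ifP => // _; rewrite -EFinB ltry. Qed.

Lemma lebesgue_measure_itvD (x d : R) : 0 < d -> la `[x, x + d]%classic = d%:E.
Proof.
move=> d0; rewrite [LHS]lebesgue_measure_itv /= lte_fin ltrDl d0 -EFinB.
by rewrite addrAC subrr add0r.
Qed.

(** The derivative of [sin t - t cos t] is [t sin t]. *)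
Lemma sin_ge_Mcos (x : R) : 0 <= x <= pi -> x * cos x <= sin x.
Proof.
move=> /andP[x0 xpi].
pose f (t : R) := sin t - t * cos t.
have df (t : R) : is_derive t 1 f (t * sin t).
  have H := is_deriveB (is_derive_sin t) (is_deriveM (is_derive_id t (1 : R)) (is_derive_cos t)).
  by apply: (is_derive_eq H); rewrite /GRing.scale /=; ring.
have cf : continuous f.
  by move=> t; apply/differentiable_continuous/derivable1_diffP; have [] := df t.
have d1 t : t \in `]0, x[ -> derivable f t 1 by move=> _; have [] := df t.
have d2 t : t \in `]0, x[ -> 0 <= f^`()%classic t.
  rewrite in_itv/= => /andP[t0 tx]; rewrite derive1E; have [_ ->] := df t.
  apply: mulr_ge0; first exact: ltW.
  by apply: sin_ge0_pi; rewrite (ltW t0)/= (le_trans (ltW tx)).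
have m0 : 0 \in `[0, x] by rewrite in_itv/= lexx x0.
have mx : x \in `[0, x] by rewrite in_itv/= lexx x0.
have := @ger0_derive1_le_cc R f 0 x d1 d2 (continuous_subspaceT cf) 0 x m0 mx x0.
by rewrite /f sin0 mul0r subr0 subr_ge0.
Qed.

Lemma sqr_sin_ge_Mcos (x : R) : `|x| <= pi / 2 -> (x * cos x) ^+ 2 <= sin x ^+ 2.
Proof.
wlog x0 : x / 0 <= x => [W|].
  have [/W//|/ltW x0 xpi] := leP 0 x.
  have := W (- x); rewrite normrN oppr_ge0 cosN sinN mulNr !sqrrN; exact.
rewrite ger0_norm// => xpi.
have p0 := pi_gt0 R.
have c0 : 0 <= cos x by apply: cos_ge0_pihalf; lra.
rewrite lerXn2r ?nnegrE ?mulr_ge0// ?sin_ge_Mcos//; last 1 first.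
  by apply/andP; split => //; lra.
by apply: sin_ge0_pi; apply/andP; split => //; lra.
Qed.

Lemma sqmod_cisB1 (k : R) : sqmod (cis k - 1) = 4 * sin (pi * k) ^+ 2.
Proof.
rewrite /cis /sqmod /=.
have -> : 2 * pi * k = pi * k + pi * k by ring.
rewrite cosD sinD; have h := cos2Dsin2 (pi * k).
set C := cos _ in h *; set S := sin _ in h *.
have hC : C ^+ 2 = 1 - S ^+ 2 by rewrite -h; ring.
rewrite (_ : _ + _ = (C ^+ 2 - S ^+ 2 - 1) ^+ 2 + 4 * S ^+ 2 * C ^+ 2); last by ring.
by rewrite hC; ring.
Qed.

Lemma sqmod_i2pi : sqmod (i2pi : R[i]) = 4 * pi ^+ 2.
Proof. rewrite /sqmod /=; ring. Qed.

Lemma sqmod_interval_transformE (h d k : R) : 0 < d ->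
  (pi * k) ^+ 2 * sqmod (cint la `[h, h + d]%classic (fun t => cis (t * k))) =
  sin (pi * (d * k)) ^+ 2.
Proof.
move=> d0; have hd : h < h + d by rewrite ltrDl.
have := cint_cisM k hd; set I := cint _ _ _ => E.
have : sqmod (i2pi * k%:C * I) = sqmod (cis (d * k) - 1).
  rewrite E mulrDl cisD (_ : _ - _ = cis (h * k) * (cis (d * k) - 1)); last by ring.
  by rewrite sqmodM sqmod_cis mul1r.
rewrite !sqmodM sqmodR sqmod_i2pi sqmod_cisB1 => E'.
have n4 : (4 : R) != 0 by rewrite pnatr_eq0.
by apply: (mulfI n4); rewrite -E'; ring.
Qed.

(** Doubling the angle, [sin (2 t) = 2 sin t cos t], turns the bound
    [t cos t <= sin t] into a lower bound valid up to the first zero of the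
    transform, at [d * k = 1]. *)
Lemma sqmod_interval_transform_ge (h d k : R) : 0 < d -> `|d * k| <= 1 ->
  d ^+ 2 * cos (pi * (d * k) / 2) ^+ 4 <=
  sqmod (cint la `[h, h + d]%classic (fun t => cis (t * k))).
Proof.
move=> d0 dk; set y := pi * (d * k) / 2.
have p0 := pi_gt0 R.
have [k0|k0] := eqVneq k 0.
  rewrite (@eq_cint _ _ _ _ _ _ (fun=> (1 : R)%:C)); last by move=> t _; rewrite k0 mulr0 cis0.
  have mI : measurable (`[h, h + d]%classic : set mR) by exact: measurable_itv.
  rewrite (cint_real _ mI) sqmodR Rintegral_cst// mul1r.
  rewrite [X in fine X](lebesgue_measure_itvD h d0) /=.
  rewrite ler_piMr ?sqr_ge0// exprn_ile1 ?cos_le1//.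
have E := sqmod_interval_transformE h k d0.
set I := sqmod _ in E *.
have pk : 0 < (pi * k) ^+ 2 by rewrite exprn_even_gt0// mulf_neq0// gt_eqF.
rewrite -(ler_pM2l pk) E.
have -> : pi * (d * k) = y + y by rewrite /y; field.
have yb : `|y| <= pi / 2.
  have h2 : `|2^-1 : R| = 2^-1 by rewrite gtr0_norm// invr_gt0.
  by rewrite /y !normrM h2 (gtr0_norm p0) -normrM ler_pM2r ?invr_gt0// ler_piMr// ltW.
rewrite sinD (_ : (sin y * cos y + _) ^+ 2 = 4 * cos y ^+ 2 * sin y ^+ 2); last by ring.
have -> : (pi * k) ^+ 2 * (d ^+ 2 * cos y ^+ 4) = 4 * cos y ^+ 2 * (y * cos y) ^+ 2.
  have : 2 * y = pi * (d * k) by rewrite /y; field.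
  by clearbody y => E2; rewrite (_ : _ * (_ * _) = (pi * (d * k)) ^+ 2 * cos y ^+ 4); [rewrite -E2; ring|ring].
by apply: ler_wpM2l; [rewrite mulr_ge0 ?sqr_ge0|exact: sqr_sin_ge_Mcos].
Qed.

Lemma sqmod_interval_transform_le (h d k : R) : 0 < d -> k != 0 ->
  sqmod (cint la `[h, h + d]%classic (fun t => cis (t * k))) <= (k ^+ 2)^-1.
Proof.
move=> d0 k0; have E := sqmod_interval_transformE h k d0.
set I := sqmod _ in E *; have I0 : 0 <= I := sqmod_ge0 _.
have k2 : 0 < k ^+ 2 by rewrite exprn_even_gt0.
rewrite -[X in _ <= X]mul1r ler_pdivlMr//.
have s1 : sin (pi * (d * k)) ^+ 2 <= 1 by rewrite sin2cos2 lerBlDr lerDl sqr_ge0.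
apply: le_trans s1; rewrite -E (_ : _ * I = pi ^+ 2 * (I * k ^+ 2)); last by ring.
apply: ler_peMl; first by rewrite mulr_ge0 ?sqr_ge0.
by apply: exprn_ege1; rewrite (le_trans _ (pi_ge2 R))// ler1n.
Qed.

Variables (o a c : R * R) (H D : set (R * R)) (L h0 d : R).
Hypotheses (w0 : wedge a c != 0) (L0 : 0 < L) (d0 : 0 < d).
Hypotheses (mH : measurable (H : set pl)) (Hoo : (leb2 R H < +oo)%E).
Hypothesis DE : D = frame_coord o a c @^-1` (`[0, L] `*` `[h0, h0 + d])%classic.
Hypothesis DH : D `<=` H.

Let mI (x y : R) : measurable (`[x, y]%classic : set mR).
Proof. exact: measurable_itv. Qed.

Let Ioo (x y : R) : (la `[x, y]%classic < +oo)%E.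
Proof. exact: lebesgue_measure_itv_lt. Qed.

Let mbox : measurable ((`[0, L] `*` `[h0, h0 + d])%classic : set pl).
Proof. by apply: measurableX; exact: mI. Qed.

Let mD : measurable (D : set pl).
Proof. by rewrite DE; exact: measurable_coord_preimage. Qed.

Let bindic : cbm (fun z : pl => (\1_D z : R)%:C).
Proof. by apply: cbm_real; exact: bounded_measurable_indic. Qed.

Lemma cint_indicl (f : pl -> R[i]) :
  cint (leb2 R) H (fun z => (\1_D z)%:C * f z) = cint (leb2 R) D f.
Proof.
have E (g : pl -> R) : \int[leb2 R]_(z in H) (\1_D z * g z) = \int[leb2 R]_(z in D) g z.
  rewrite [RHS](_ : _ = \int[leb2 R]_(z in H `&` D) g z); last by rewrite (setIidr DH).
  rewrite Rintegral_mkcondr; apply: eq_Rintegral => z _.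
  by rewrite patchE indicE; case: ifP => _; rewrite ?mul1r ?mul0r.
apply/eqP; rewrite eq_complex /= -!E; apply/andP; split; apply/eqP;
  by apply: eq_Rintegral => z _; case: (f z) => x y /=; rewrite mul0r ?subr0 ?addr0.
Qed.

Lemma cbm_coord1 (g : mR -> R) : bounded_measurable g ->
  cbm (fun z : pl => (g (frame_coord o a c z).1)%:C).
Proof.
move=> [mg [M Mg]]; apply: cbm_real; split; last by exists M => z.
apply: measurableT_comp => //.
by apply: measurableT_comp => //; exact: measurable_coord.
Qed.

(** In the coordinates along [a] and [c] this is a tensor product, so that its
    inner products with characters are products of integrals on the line. *)
Definition modulated (g : R -> R) x z : R[i] :=
  (\1_D z)%:C * ((g (frame_coord o a c z).1)%:C * expchar x z).

Lemma cbm_modulated (g : mR -> R) x : bounded_measurable g -> cbm (modulated g x : pl -> R[i]).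
Proof.
move=> bg; apply: cbmM => //; apply: cbmM; last exact: cbm_expchar.
exact: cbm_coord1.
Qed.

Lemma inner_modulated (g : mR -> R) x y : bounded_measurable g ->
  inner (leb2 R) H (modulated g x) (expchar y) =
  `|wedge a c|%:C * (cis (dot (x - y) o) *
    (cint la `[0, L]%classic (fun t => (g t)%:C * cis (t * dot (x - y) a)) *
     cint la `[h0, h0 + d]%classic (fun t => cis (t * dot (x - y) c)))).
Proof.
move=> bg; rewrite /inner.
have bgc := cbm_real bg.
have b1 := cbmM bgc (cbm_cisM (dot (x - y) a)).
have b2 := cbmM (cbm_cst mR (cis (dot (x - y) o))) b1.
rewrite (@eq_cint _ _ _ _ _ _ (fun z : pl => (\1_D z)%:C *
    ((g (frame_coord o a c z).1)%:C * expchar (x - y) z))); last first.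
  by move=> z _; rewrite /modulated -expcharM_conj; ring.
rewrite cint_indicl DE cint_frame//; last 2 first.
- exact: leb2_box.
- by apply: cbmM; [exact: cbm_coord1|exact: cbm_expchar].
congr (_ * _).
pose G t := cis (dot (x - y) o) * ((g t)%:C * cis (t * dot (x - y) a)).
rewrite (@eq_cint _ _ _ _ _ _ (fun z : pl => G z.1 * cis (z.2 * dot (x - y) c))); last first.
  move=> z _; rewrite frameK// expcharE dot_frame cisD [X in _ * (_ * X)]cisD /G; ring.
rewrite (@cint_prod _ _ _ G (fun t => cis (t * dot (x - y) c)) (mI _ _) (mI _ _) (Ioo _ _) (Ioo _ _) b2 (cbm_cisM _)).
by rewrite [X in X * _](cintZl (mI _ _) (Ioo _ _) _ b1) mulrA.
Qed.

Lemma sqnorm_modulated (g : mR -> R) x : bounded_measurable g ->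
  sqnorm (leb2 R) H (modulated g x) =
  `|wedge a c| * (\int[la]_(t in `[0, L]) (g t ^+ 2) * d).
Proof.
move=> bg; apply: (@complexI R); rewrite /sqnorm -cint_real//.
have bg2 : bounded_measurable (fun t : mR => g t ^+ 2) by exact: bounded_measurableM.
rewrite (@eq_cint _ _ _ _ _ _ (fun z : pl => (\1_D z)%:C * (g (frame_coord o a c z).1 ^+ 2)%:C)); last first.
  move=> z _; rewrite /modulated !sqmodM !sqmodR expcharE sqmod_cis mulr1 rmorphM.
  by congr (_%:C * _); rewrite indicE; case: (z \in D); rewrite ?expr1n ?expr0n.
rewrite cint_indicl DE cint_frame//; last 2 first.
- exact: leb2_box.
- exact: (cbm_coord1 bg2).
rewrite [RHS]rmorphM; congr (_ * _).
rewrite (@eq_cint _ _ _ _ _ _ (fun z : pl => (g z.1 ^+ 2)%:C * 1)); last first.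
  by move=> z _; rewrite frameK// mulr1.
rewrite (@cint_prod _ _ _ (fun t => (g t ^+ 2)%:C) (fun=> 1) (mI _ _) (mI _ _) (Ioo _ _) (Ioo _ _) (cbm_real bg2) (cbm_cst _ _)).
rewrite (cint_real _ (mI _ _)) rmorphM; congr (_ * _).
rewrite (@eq_cint _ _ _ _ _ _ (fun=> (1 : R)%:C))// (cint_real _ (mI _ _)).
rewrite Rintegral_cst; last exact: mI.
by rewrite mul1r [X in fine X](lebesgue_measure_itvD h0 d0).
Qed.

End test_functions.

(** * Bessel and Parseval for a spectrum *)

Section spectra_bessel.
Context {R : realType}.
Notation mR := (measurableTypeR R).
Notation pl := (mR * mR)%type.
Notation la := (@lebesgue_measure R).
Variables (Omega : set (R * R)).
Hypotheses (mO : measurable (Omega : set pl)) (Ooo : (leb2 R Omega < +oo)%E).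
Hypothesis O0 : (0 < leb2 R Omega)%E.
Let V := fine (leb2 R Omega).

Lemma fine_measure_gt0 : 0 < V.
Proof. by rewrite /V fine_gt0// O0 Ooo. Qed.

Lemma sqnorm_expchar l : sqnorm (leb2 R) Omega (expchar l) = V.
Proof.
rewrite /sqnorm (@eq_Rintegral _ _ _ _ _ (fun=> 1)); last by move=> x _; exact: sqmod_cis.
by rewrite Rintegral_cst// mul1r.
Qed.

Lemma sqnormL2E f : cbm (f : pl -> R[i]) ->
  sqnormL2 Omega f = (sqnorm (leb2 R) Omega f)%:E.
Proof.
move=> bf; rewrite /sqnorm /sqnormL2 /Rintegral fineK//.
have := integrable_bounded_measurable mO Ooo (sqmod_bounded_measurable bf).
exact: integrable_fin_num.
Qed.

Lemma memL2_cbm f : cbm (f : pl -> R[i]) -> memL2 Omega f.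
Proof.
move=> bf; split; [| |by rewrite sqnormL2E// ltry].
- by case: bf => -[m _] _; apply: measurable_funTS.
- by case: bf => _ [m _]; apply: measurable_funTS.
Qed.

(** The sequences in the definition of completeness may repeat a frequency;
    Bessel's inequality needs them without repetition. *)
Lemma sum_expchar_undup (s : seq (R * R)) (c : R * R -> R[i]) (x : R * R) :
  \sum_(l <- s) c l * expchar l x =
  \sum_(l <- undup s) (c l *+ count_mem l s) * expchar l x.
Proof.
rewrite -big_undup_iterop_count; apply: eq_bigr => l _; rewrite mulrnAl.
by [].
Qed.

Lemma cbm_expchar_sum (s : seq (R * R)) (c : R * R -> R[i]) :
  cbm (fun x : pl => \sum_(l <- s) c l * expchar l x).
Proof.
apply: (@cbm_sum _ _ _ _ _ (fun l (x : pl) => c l * expchar l x)) => l.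
by apply: cbmM; [exact: cbm_cst|exact: cbm_expchar].
Qed.

Variable Lambda : set (R * R).
Hypothesis spec : is_spectrum Omega Lambda.

Lemma spectrum_orthogonal l m : Lambda l -> Lambda m -> l != m ->
  inner (leb2 R) Omega (expchar l) (expchar m) = 0.
Proof. by case: spec => _ + _; apply. Qed.

Lemma spectrum_bessel f (s : seq (R * R)) : cbm (f : pl -> R[i]) -> uniq s ->
  (forall l, l \in s -> Lambda l) ->
  \sum_(l <- s) sqmod (inner (leb2 R) Omega f (expchar l)) <= V * sqnorm (leb2 R) Omega f.
Proof.
move=> bf us sL.
exact: (@bessel _ _ _ _ _ mO Ooo _ (fun l : R * R => expchar l : pl -> R[i]) Lambda V
  (fun l => cbm_expchar l) fine_measure_gt0 sqnorm_expchar spectrum_orthogonal).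
Qed.

(** The distance from [f] to the span of finitely many characters is smallest for
    the Fourier coefficients, so density forces almost equality in Bessel. *)
Lemma spectrum_parseval f (eps : R) : cbm (f : pl -> R[i]) -> 0 < eps ->
  exists s : seq (R * R), [/\ uniq s, (forall l, l \in s -> Lambda l) &
    sqnorm (leb2 R) Omega f -
    (\sum_(l <- s) sqmod (inner (leb2 R) Omega f (expchar l))) / V < eps].
Proof.
move=> bf eps0; have [_ _ /(_ f (memL2_cbm bf) (Num.sqrt eps))] := spec.
rewrite sqrtr_gt0 => /(_ eps0) [s [c [sL]]].
rewrite sqr_sqrtr ?ltW// => lt_eps.
exists (undup s); split; first exact: undup_uniq.
  by move=> l; rewrite mem_undup => /sL.
have sL' l : l \in undup s -> Lambda l by rewrite mem_undup => /sL.
have bsum c' := @cbm_expchar_sum (undup s) c'.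
apply: le_lt_trans (@sqnorm_sub_orthogonal_ge _ _ _ _ _ mO Ooo _ (fun l : R * R => expchar l : pl -> R[i]) Lambda V
  (fun l => cbm_expchar l) fine_measure_gt0 sqnorm_expchar spectrum_orthogonal
  f (undup s) (fun l => c l *+ count_mem l s) bf (undup_uniq _) sL') _.
rewrite -lte_fin -sqnormL2E; last exact: cbmB.
apply: le_lt_trans lt_eps.
by rewrite (_ : (fun x => _) = (fun x => f x - \sum_(l <- s) c l * expchar l x))//;
  apply/funext => x; rewrite sum_expchar_undup.
Qed.

End spectra_bessel.

(** * A spectrum meets every strip far out *)

Section strip.
Context {R : realType}.
Notation mR := (measurableTypeR R).
Notation pl := (mR * mR)%type.
Notation la := (@lebesgue_measure R).
Implicit Types (o u v a c z x : R * R) (P Q : R).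

Lemma hexagon_measure_gt0 o a c P Q : wedge a c != 0 -> 0 < P -> 0 < Q ->
  (0 < leb2 R (hexagon o a c P Q))%E.
Proof.
move=> w0 P0 Q0; rewrite leb2_coord_preimage//; last exact: measurable_hexbox.
apply: mule_gt0; first by rewrite lte_fin normr_gt0.
pose B : set (R * R) := (`[0, 0 + 1] `*` `[0, 0 + 1])%classic.
apply: (@lt_le_trans _ _ (leb2 R B)).
  have m (x y : R) : measurable (`[x, y]%classic : set mR) by exact: measurable_itv.
  rewrite [X in (_ < X)%E](product_measure1E _ _ (m _ _) (m _ _)).
  by rewrite [X in (_ < X * _)%E](lebesgue_measure_itvD 0 ltr01)
    [X in (_ < _ * X)%E](lebesgue_measure_itvD 0 ltr01) mule1 lte_fin.
apply: le_measure; rewrite ?inE; last 1 first.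
- move=> [s t] [] /=; rewrite !in_itv/= add0r => /andP[s0 s1] /andP[t0 t1].
  have Pt0 : 0 <= P * t by rewrite mulr_ge0// ltW.
  have Pt1 : P * t <= P by rewrite ler_piMr// ltW.
  have Qs0 : 0 <= Q * s by rewrite mulr_ge0// ltW.
  have Qs1 : Q * s <= Q by rewrite ler_piMr// ltW.
  by split; apply/andP; split => /=; lra.
- by apply: measurableX; exact: measurable_itv.
- exact: measurable_hexbox.
Qed.

Lemma Rintegral_sin2 (L : R) : 0 < L ->
  \int[la]_(t in `[0, L]) (sin (t * (pi / L)) ^+ 2) = L / 2.
Proof.
move=> L0; set k := pi / L.
have k0 : k != 0 by rewrite mulf_neq0// ?invr_neq0// gt_eqF// pi_gt0.
pose F (t : R) : R := t / 2 - (2 * k)^-1 * (sin (t * k) * cos (t * k)).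
have dF (t : R) : is_derive t 1 F (sin (t * k) ^+ 2).
  have H := is_deriveB (is_deriveM (is_derive_id t (1 : R)) (is_derive_cst (2^-1 : R) t 1))
    (is_deriveZ (2 * k)^-1 (is_deriveM (is_derive_sinM k t) (is_derive_cosM k t))).
  apply: (is_derive_eq H); rewrite /GRing.scale /=.
  rewrite [RHS](_ : _ = (cos (t * k) ^+ 2 + sin (t * k) ^+ 2) / 2 - (cos (t * k) ^+ 2 - sin (t * k) ^+ 2) / 2); last by field.
  by rewrite cos2Dsin2; field.
rewrite (Rintegral_derive L0 dF).
  have kL : L * k = pi by rewrite /k; field; exact: lt0r_neq0.
  by rewrite /F kL sinpi !mul0r sin0 !mul0r mulr0 !subr0.
by move=> t; apply: cvgM; exact: continuous_sinM.
Qed.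

Lemma Rintegral_cos2 (L : R) : 0 < L ->
  \int[la]_(t in `[0, L]) (cos (t * (pi / L)) ^+ 2) = L / 2.
Proof.
move=> L0; set k := pi / L.
have k0 : k != 0 by rewrite mulf_neq0// ?invr_neq0// gt_eqF// pi_gt0.
pose F (t : R) : R := t / 2 + (2 * k)^-1 * (sin (t * k) * cos (t * k)).
have dF (t : R) : is_derive t 1 F (cos (t * k) ^+ 2).
  have H := is_deriveD (is_deriveM (is_derive_id t (1 : R)) (is_derive_cst (2^-1 : R) t 1))
    (is_deriveZ (2 * k)^-1 (is_deriveM (is_derive_sinM k t) (is_derive_cosM k t))).
  apply: (is_derive_eq H); rewrite /GRing.scale /=.
  rewrite [RHS](_ : _ = (cos (t * k) ^+ 2 + sin (t * k) ^+ 2) / 2 + (cos (t * k) ^+ 2 - sin (t * k) ^+ 2) / 2); last by field.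
  by rewrite cos2Dsin2; field.
rewrite (Rintegral_derive L0 dF).
  have kL : L * k = pi by rewrite /k; field; exact: lt0r_neq0.
  by rewrite /F kL sinpi !mul0r sin0 !mul0r mulr0 !addr0 subr0.
by move=> t; apply: cvgM; exact: continuous_cosM.
Qed.

Lemma le_cos_norm (x b : R) : `|x| <= b -> b <= pi -> cos b <= cos x.
Proof.
move=> xb bpi; rewrite -[cos x]cos_norm leNgt ltr_cos ?in_itv/=; first by rewrite -leNgt.
all: by rewrite ?normr_ge0 ?bpi ?andbT ?(le_trans xb) ?(le_trans _ xb).
Qed.

Lemma bounded_measurable_sinM (k : R) : bounded_measurable (fun t : mR => sin (t * k)).
Proof.
split; first by apply: continuous_measurable_fun; exact: continuous_sinM.
by exists 1 => x; exact: sin_max.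
Qed.

Lemma bounded_measurable_cosM (k : R) : bounded_measurable (fun t : mR => cos (t * k)).
Proof.
split; first by apply: continuous_measurable_fun; exact: continuous_cosM.
by exists 1 => x; exact: cos_max.
Qed.

Lemma exists_dots a c (p q : R) : wedge a c != 0 ->
  exists x, dot x a = p /\ dot x c = q.
Proof.
move=> w0; exists ((p * c.2 - q * a.2) / wedge a c, (q * a.1 - p * c.1) / wedge a c).
by move: w0; rewrite /dot /wedge /= => w0; split; field.
Qed.

Definition sine_transform (L r : R) : R :=
  sqmod (cint la `[0, L]%classic (fun t => (sin (t * (pi / L)))%:C * cis (t * r))).

Definition interval_transform (h d r : R) : R :=
  sqmod (cint la `[h, h + d]%classic (fun t => cis (t * r))).

Section parallelogram_tests.
Variables (o a c : R * R) (H D : set (R * R)) (L h0 d : R).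
Hypotheses (w0 : wedge a c != 0) (L0 : 0 < L) (d0 : 0 < d).
Hypotheses (mH : measurable (H : set pl)) (Hoo : (leb2 R H < +oo)%E).
Hypothesis DE : D = frame_coord o a c @^-1` (`[0, L] `*` `[h0, h0 + d])%classic.
Hypothesis DH : D `<=` H.

Let k := pi / L.

Definition sine_test x := modulated o a c D (fun t => sin (t * k)) x.
Definition cosine_test x := modulated o a c D (fun t => k * cos (t * k)) x.

Let bcos : bounded_measurable (fun t : mR => k * cos (t * k)).
Proof.
apply: (bounded_measurableM (bounded_measurable_cst mR k)).
exact: bounded_measurable_cosM.
Qed.

Let mD : measurable (D : set pl).
Proof.
by rewrite DE; apply: measurable_coord_preimage; apply: measurableX; exact: measurable_itv.
Qed.

Lemma cbm_sine_test x : cbm (sine_test x : pl -> R[i]).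
Proof. by apply: (cbm_modulated DE); exact: bounded_measurable_sinM. Qed.

Lemma cbm_cosine_test x : cbm (cosine_test x : pl -> R[i]).
Proof. by apply: (cbm_modulated DE); exact: bcos. Qed.

Lemma sqnorm_sine_test x :
  sqnorm (leb2 R) H (sine_test x) = `|wedge a c| * (L / 2 * d).
Proof.
rewrite (sqnorm_modulated w0 d0 mH DE DH _ (bounded_measurable_sinM _)).
by rewrite Rintegral_sin2.
Qed.

Lemma sqnorm_cosine_test x :
  sqnorm (leb2 R) H (cosine_test x) = k ^+ 2 * (`|wedge a c| * (L / 2 * d)).
Proof.
rewrite (sqnorm_modulated w0 d0 mH DE DH _ bcos).
rewrite (_ : \int[la]_(t in `[0, L]) (k * cos (t * k)) ^+ 2 = k ^+ 2 * (L / 2)); first by ring.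
rewrite -Rintegral_cos2// -RintegralZl.
- by apply: eq_Rintegral => t _; rewrite exprMn.
- exact: measurable_itv.
- apply: integrable_bounded_measurable; first exact: measurable_itv.
    exact: lebesgue_measure_itv_lt.
  by apply: bounded_measurableM; exact: bounded_measurable_cosM.
Qed.

Lemma inner_sine_test x y :
  sqmod (inner (leb2 R) H (sine_test x) (expchar y)) =
  wedge a c ^+ 2 * (sine_transform L (dot (x - y) a) * interval_transform h0 d (dot (x - y) c)).
Proof.
rewrite (inner_modulated w0 DE DH _ _ (bounded_measurable_sinM _)).
by rewrite !sqmodM sqmodR sqmod_cis mul1r real_normK// num_real.
Qed.

(** The test function vanishes at both ends of its support along [a], so that
    passing to its derivative multiplies its transform by the frequency. *)
Lemma inner_cosine_test x y :
  sqmod (inner (leb2 R) H (cosine_test x) (expchar y)) =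
  4 * (pi * dot (x - y) a) ^+ 2 * sqmod (inner (leb2 R) H (sine_test x) (expchar y)).
Proof.
rewrite (inner_modulated w0 DE DH _ _ bcos).
rewrite (inner_modulated w0 DE DH _ _ (bounded_measurable_sinM _)).
rewrite !sqmodM.
set r := dot (x - y) a.
have dphi (t : R) : is_derive t 1 (fun t : R => sin (t * k)) (k * cos (t * k)).
  exact: is_derive_sinM.
have cphi : continuous (fun t : R => k * cos (t * k)).
  by move=> t; apply: cvgM; [exact: cvg_cst|exact: continuous_cosM].
have := cint_derive_cisM r L0 dphi cphi (bounded_measurable_sinM k) bcos.
rewrite mul0r sin0 (_ : L * k = pi); last by rewrite /k; field; exact: lt0r_neq0.
rewrite sinpi !mul0r subrr => /eqP; rewrite addr_eq0 => /eqP ->.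
rewrite sqmodN !sqmodM sqmodR sqmod_i2pi; ring.
Qed.

End parallelogram_tests.

Lemma sine_transform_ge0 L r : 0 <= sine_transform L r.
Proof. exact: sqmod_ge0. Qed.

(** Some chords of the hexagon parallel to [a] are longer than [a], by a factor
    [L > 1]. The function [sin (pi s / L)] along such a chord vanishes at its
    ends, and the energy of its derivative is [(pi / L) ^ 2] times its own. By
    Bessel for the derivative, at most the proportion [1 / (2 L w) ^ 2] of its
    energy comes from frequencies [nu] with [|al - dot nu a| >= w], and this is
    less than [1] for some [w < 1 / 2] since [L > 1]. By Parseval, a fixed
    proportion of the energy comes from the strip [|al - dot nu a| < w].

    If [dot nu c] were bounded on the strip, this would fail for the modulation
    by a high frequency [Mp + X] in the direction of [c]: there the transform of
    an interval is of size [1 / X], while the total weight [A] carried by the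
    strip in the direction of [a] is bounded, by Bessel for a test function so
    thin in the direction of [c] that its transform is bounded below there. *)
Lemma spectrum_meets_strip o a c P Q (Lambda : set (R * R)) :
  wedge a c != 0 -> 0 < P -> 0 < Q ->
  is_spectrum (hexagon o a c P Q) Lambda ->
  exists w : R, [/\ 0 < w, w < 1 / 2 & forall al M : R,
    exists nu, [/\ Lambda nu, `|al - dot nu a| < w & M <= `|dot nu c| ] ].
Proof.
move=> w0 P0 Q0 spec; set H := hexagon _ _ _ _ _ in spec.
have mH : measurable (H : set pl) := measurable_hexagon o a c P Q.
have Hoo : (leb2 R H < +oo)%E := leb2_hexagon o P Q w0.
have H0 : (0 < leb2 R H)%E := hexagon_measure_gt0 o w0 P0 Q0.
pose V := fine (leb2 R H); have V0 : 0 < V := fine_measure_gt0 Hoo H0.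
have [h [h0 hle1 hleQ]] : exists h : R, [/\ 0 < h, h + h <= 1 & h + h <= Q].
  exists (Num.min 1 Q / 2); split; first by rewrite divr_gt0// lt_min ltr01.
  - by rewrite -splitr ge_min lexx.
  - by rewrite -splitr ge_min lexx orbT.
(* the length, in units of [a], of the chord at height [h] above the edge [a] *)
pose L := 1 + P * h / Q.
have L1 : 1 < L by rewrite ltrDl divr_gt0// mulr_gt0.
have L0 : 0 < L by apply: lt_trans L1.
have QL : Q * L = Q + P * h by rewrite /L; field; exact: lt0r_neq0.
pose D d := frame_coord o a c @^-1` (`[0, L] `*` `[h, h + d])%classic.
have DH d : d <= h -> D d `<=` H.
  move=> dh z Dz; suff: hexbox P Q (frame_coord o a c z) by [].
  move: Dz; rewrite /D /preimage /mkset; case: (frame_coord o a c z) => s t [] /=.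
  rewrite !in_itv/= => /andP[s0 sL] /andP[t0 t1].
  have Pt1 : P * t <= P by apply: ler_piMr; [exact: ltW|lra].
  have Pth : P * h <= P * t by rewrite ler_pM2l.
  have Qs0 : 0 <= Q * s by apply: mulr_ge0 => //; exact: ltW.
  have Qs1 : Q * s <= Q * L by rewrite ler_pM2l.
  have PhQ : P * h <= P * Q by rewrite ler_pM2l//; lra.
  have L1P : L <= 1 + P by rewrite -(ler_pM2l Q0) QL; lra.
  by split; apply/andP; split => /=; lra.
(* the midpoint of [1 / (2 L)] and [1 / 2] *)
pose w := (1 + L^-1) / 4.
have Li0 : 0 < L^-1 by rewrite invr_gt0.
have Li1 : L^-1 < 1 by rewrite invf_lt1.
have w_gt0 : 0 < w by rewrite /w; lra.
have Lw : 1 < 2 * L * w.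
  rewrite (_ : 2 * L * w = (L + 1) / 2); first by lra.
  by rewrite /w; field; exact: lt0r_neq0.
exists w; split => //; first by rewrite /w; lra.
move=> al M; apply: contrapT => no.
pose Mp := Num.max M 1.
have Mp0 : 0 < Mp by rewrite lt_max ltr01 orbT.
have small nu : Lambda nu -> `|al - dot nu a| < w -> `|dot nu c| < Mp.
  move=> Lnu nuw; rewrite lt_max; apply/orP; left.
  by rewrite ltNge; apply/negP => Mnu; apply: no; exists nu.
pose N := `|wedge a c| * (L / 2).
have N0 : 0 < N by rewrite mulr_gt0 ?normr_gt0// divr_gt0.
(* the strip carries at least this proportion of the energy of the test function *)
pose kap := 1 - ((2 * L * w) ^+ 2)^-1.
have kap0 : 0 < kap by rewrite subr_gt0 invf_lt1 ?exprn_gt0 ?exprn_egt1//; apply: lt_trans Lw.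
(* thin enough for the transform of [[h, h + del]] to be bounded below on [[-Mp, Mp]] *)
pose del := Num.min h (2 * Mp)^-1.
have del0 : 0 < del by rewrite lt_min h0 invr_gt0 mulr_gt0.
have delh : del <= h by rewrite ge_min lexx.
have delM : del * Mp <= 2^-1.
  have : del <= (2 * Mp)^-1 by rewrite ge_min lexx orbT.
  move=> /(ler_wpM2r (ltW Mp0))/le_trans; apply.
  by rewrite [X in X <= _](_ : _ = 2^-1)//; field; exact: lt0r_neq0.
pose tau := del ^+ 2 * cos (pi / 4) ^+ 4.
have c4 : 0 < cos (pi / 4 : R).
  by apply: cos_gt0_pihalf; have := pi_gt0 R; lra.
have tau0 : 0 < tau by rewrite mulr_gt0// exprn_gt0.
have cos_rM r : `|del * r| <= 2^-1 -> cos (pi / 4) <= cos (pi * (del * r) / 2).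
  move=> dr; apply: le_cos_norm; last by have := pi_gt0 R; lra.
  have h2 : `|2^-1 : R| = 2^-1 by rewrite gtr0_norm// invr_gt0.
  rewrite !normrM h2 (gtr0_norm (pi_gt0 R)) -normrM (_ : pi / 4 = pi * 2^-1 / 2); last by field.
  by rewrite ler_pM2r ?invr_gt0// ler_pM2l ?pi_gt0.
have lowT r : `|r| < Mp -> tau <= interval_transform h del r.
  move=> rM; have dr : `|del * r| <= 2^-1.
    rewrite normrM (gtr0_norm del0); apply: le_trans delM.
    by rewrite ler_pM2l// ltW.
  apply: le_trans (sqmod_interval_transform_ge h del0 (le_trans dr _)); last by rewrite invf_le1// ler1n.
  rewrite ler_pM2l ?exprn_gt0//; apply: lerXn2r; rewrite ?nnegrE; [exact: ltW| |].
    exact: le_trans (ltW c4) (cos_rM _ dr).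
  exact: cos_rM.
(* chosen so that [del / (tau * X ^ 2) <= h * kap / 2], against the estimate below *)
pose X := 1 + 2 * del / (tau * h * kap).
have X1 : 1 < X by rewrite ltrDl divr_gt0 ?mulr_gt0.
have X0 : 0 < X by apply: lt_trans X1.
have [x1 [x1a x1c]] := exists_dots al (Mp + X) w0.
have [x2 [x2a x2c]] := exists_dots al 0 w0.
have DE d : D d = frame_coord o a c @^-1` (`[0, L] `*` `[h, h + d])%classic by [].
pose F1 := sine_test o a c (D h) L x1; pose F2 := sine_test o a c (D del) L x2.
pose G1 := cosine_test o a c (D h) L x1.
have bF1 : cbm (F1 : pl -> R[i]) := cbm_sine_test (DE h) x1.
have bF2 : cbm (F2 : pl -> R[i]) := cbm_sine_test (DE del) x2.
have bG1 : cbm (G1 : pl -> R[i]) := cbm_cosine_test (DE h) x1.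
have nF1 : sqnorm (leb2 R) H F1 = N * h.
  by rewrite (sqnorm_sine_test w0 L0 h0 mH (DE h) (DH _ (lexx h))) mulrA.
have nG1 : sqnorm (leb2 R) H G1 = (pi / L) ^+ 2 * (N * h).
  by rewrite (sqnorm_cosine_test w0 L0 h0 mH (DE h) (DH _ (lexx h))) [in RHS]/N -[in RHS]mulrA.
have nF2 : sqnorm (leb2 R) H F2 = N * del.
  by rewrite (sqnorm_sine_test w0 L0 del0 mH (DE del) (DH _ delh)) mulrA.
pose S nu := sine_transform L (al - dot nu a).
have iF1 nu : sqmod (inner (leb2 R) H F1 (expchar nu)) =
    wedge a c ^+ 2 * (S nu * interval_transform h h (Mp + X - dot nu c)).
  by rewrite (inner_sine_test w0 (DE h) (DH _ (lexx h))) !dotBl x1a x1c.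
have iG1 nu : sqmod (inner (leb2 R) H G1 (expchar nu)) =
    4 * (pi * (al - dot nu a)) ^+ 2 * sqmod (inner (leb2 R) H F1 (expchar nu)).
  by rewrite (inner_cosine_test w0 L0 (DE h) (DH _ (lexx h))) !dotBl x1a.
have iF2 nu : sqmod (inner (leb2 R) H F2 (expchar nu)) =
    wedge a c ^+ 2 * (S nu * interval_transform h del (- dot nu c)).
  by rewrite (inner_sine_test w0 (DE del) (DH _ delh)) !dotBl x2a x2c sub0r.
pose eps := N * h * kap / 2.
have eps0 : 0 < eps by exact: (divr_gt0 (mulr_gt0 (mulr_gt0 N0 h0) kap0)).
have [s [us sL pars]] := spectrum_parseval mH Hoo H0 spec bF1 eps0.
pose near_strip (nu : R * R) := `|al - dot nu a| < w.
pose A := \sum_(nu <- s | near_strip nu) S nu.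
(* the frequencies outside the strip are controlled by the derivative *)
have out : (2 * pi * w) ^+ 2 * \sum_(nu <- s | ~~ near_strip nu)
    sqmod (inner (leb2 R) H F1 (expchar nu)) <= V * ((pi / L) ^+ 2 * (N * h)).
  rewrite -nG1; apply: le_trans (spectrum_bessel mH Hoo H0 spec bG1 us sL).
  rewrite mulr_sumr [leRHS](bigID near_strip) /= -[X in X <= _]add0r lerD//.
    by apply: sumr_ge0 => nu _; exact: sqmod_ge0.
  apply: ler_sum => nu; rewrite /near_strip -leNgt => wnu.
  rewrite iG1; apply: ler_wpM2r; first exact: sqmod_ge0.
  have hw : w ^+ 2 <= (al - dot nu a) ^+ 2.
    rewrite -[leRHS]real_normK ?num_real//; apply: lerXn2r => //; rewrite nnegrE//.
    exact: ltW.
  rewrite (_ : (2 * pi * w) ^+ 2 = 4 * pi ^+ 2 * w ^+ 2); last by ring.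
  rewrite [leRHS](_ : _ = 4 * pi ^+ 2 * (al - dot nu a) ^+ 2); last by ring.
  by apply: ler_wpM2l => //; rewrite mulr_ge0 ?sqr_ge0.
have low : wedge a c ^+ 2 * (A * tau) <= V * (N * del).
  rewrite -nF2; apply: le_trans (spectrum_bessel mH Hoo H0 spec bF2 us sL).
  rewrite /A mulr_suml mulr_sumr [leRHS](bigID near_strip) /= -[X in X <= _]addr0 lerD//; last first.
    by apply: sumr_ge0 => nu _; exact: sqmod_ge0.
  rewrite big_seq_cond [leRHS]big_seq_cond; apply: ler_sum => nu /andP[nus nuw].
  rewrite iF2 ler_wpM2l ?sqr_ge0// ler_wpM2l ?sine_transform_ge0//.
  by apply: lowT; rewrite normrN; apply: small => //; exact: sL.
have up : \sum_(nu <- s | near_strip nu) sqmod (inner (leb2 R) H F1 (expchar nu)) <=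
    wedge a c ^+ 2 * (A * (X ^+ 2)^-1).
  rewrite /A mulr_suml mulr_sumr.
  rewrite big_seq_cond [leRHS]big_seq_cond; apply: ler_sum => nu /andP[nus nuw].
  rewrite iF1 ler_wpM2l ?sqr_ge0// ler_wpM2l ?sine_transform_ge0//.
  have := small nu (sL _ nus) nuw; rewrite ltr_norml => /andP[_ cM].
  have Xc : X <= Mp + X - dot nu c by lra.
  have Y0 : 0 < Mp + X - dot nu c by apply: lt_le_trans Xc.
  apply: le_trans (sqmod_interval_transform_le h h0 (lt0r_neq0 Y0)) _.
  by rewrite lef_pV2 ?posrE ?exprn_gt0// lerXn2r ?nnegrE// ltW.
rewrite nF1 (bigID near_strip) /= in pars.
set I := \sum_(nu <- s | near_strip nu) _ in pars up.
set O := \sum_(nu <- s | ~~ near_strip nu) _ in pars out.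
have Lw0 : 2 * L * w != 0 by rewrite gt_eqF// (lt_trans ltr01).
have p0 : (pi : R) != 0 by rewrite gt_eqF// pi_gt0.
have {}out : O <= V * (N * h) * (1 - kap).
  have pw0 : 0 < (2 * pi * w) ^+ 2 by apply: exprn_gt0; apply: mulr_gt0 => //;
    apply: mulr_gt0 => //; exact: pi_gt0.
  rewrite -(ler_pM2l pw0); apply: le_trans out _.
  rewrite le_eqVlt; apply/orP; left; apply/eqP; rewrite /kap; field.
  by rewrite (lt0r_neq0 L0) (lt0r_neq0 w_gt0).
have {}pars : V * (N * h) * (kap / 2) < I.
  have : (N * h - (I + O) / V) * V < eps * V by rewrite ltr_pM2r.
  rewrite mulrBl mulfVK ?lt0r_neq0// /eps => h1.
  rewrite (_ : V * (N * h) * (kap / 2) = N * h * V - V * (N * h) * (1 - kap) - N * h * kap / 2 * V); last by field.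
  by clear -h1 out; lra.
have {}low : wedge a c ^+ 2 * A * (X ^+ 2)^-1 <= V * (N * del) / tau * (X ^+ 2)^-1.
  by rewrite ler_wpM2r ?invr_ge0 ?sqr_ge0// ler_pdivlMr// -mulrA.
have : V * (N * h) * (kap / 2) < V * (N * del) / tau * (X ^+ 2)^-1.
  by apply: lt_le_trans pars (le_trans up _); rewrite mulrA.
rewrite (_ : V * (N * h) * (kap / 2) = V * N * (h * kap / 2)); last by field.
rewrite (_ : V * (N * del) / tau * (X ^+ 2)^-1 = V * N * (del / tau / X ^+ 2)); last first.
  by field; rewrite (lt0r_neq0 tau0) (lt0r_neq0 X0).
have VN0 : 0 < V * N by exact: mulr_gt0.
have X20 : 0 < X ^+ 2 by exact: exprn_gt0.
rewrite (ltr_pM2l VN0) (ltr_pdivlMr _ _ X20); apply/negP; rewrite -leNgt.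
have hk0 : 0 < h * kap / 2 by rewrite divr_gt0// mulr_gt0.
have X2 : X <= X ^+ 2 by rewrite expr2 ler_peMl// ltW.
apply: le_trans (_ : h * kap / 2 * X <= _); last by rewrite ler_pM2l.
rewrite /X mulrDr mulr1 (_ : h * kap / 2 * _ = del / tau); first by rewrite lerDr ltW.
by field; rewrite (lt0r_neq0 tau0) (lt0r_neq0 h0) (lt0r_neq0 kap0).
Qed.

End strip.

(** * Every spectrum is a translate of the dual lattice *)

Section uniqueness.
Context {R : realType}.
Notation mR := (measurableTypeR R).
Notation pl := (mR * mR)%type.
Notation la := (@lebesgue_measure R).
Implicit Types (o u v a c z x : R * R) (P Q : R).

Lemma sqmod_unit_mean_ge (k rho : R) : `|k| <= rho -> rho <= 1 ->
  cos (pi * rho / 2) ^+ 4 <= sqmod (unit_mean k).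
Proof.
move=> krho rho1; have p0 := pi_gt0 R.
have := @sqmod_interval_transform_ge R 0 1 k ltr01.
rewrite mul1r add0r expr1n mul1r => /(_ (le_trans krho rho1)).
apply: le_trans; apply: lerXn2r; rewrite ?nnegrE.
- have rho0 : 0 <= rho by apply: le_trans krho.
  have : pi * rho <= pi by rewrite ler_piMr// ltW.
  have : 0 <= pi * rho by rewrite mulr_ge0// ltW.
  by move=> ? ?; apply: cos_ge0_pihalf; apply/andP; split; lra.
- have pk : `|pi * k| <= pi.
    by rewrite normrM (gtr0_norm p0) ler_piMr ?(ltW p0)// (le_trans krho).
  by move: pk; rewrite ler_norml => /andP[? ?]; apply: cos_ge0_pihalf; apply/andP; split; lra.
- apply: le_cos_norm.
    have h2 : `|2^-1 : R| = 2^-1 by rewrite gtr0_norm// invr_gt0.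
    by rewrite !normrM h2 (gtr0_norm p0) ler_pM2r ?invr_gt0// ler_pM2l.
  have : pi * rho <= pi by rewrite ler_piMr// ltW.
  by lra.
Qed.

Lemma sqmod_unit_mean_le (k : R) : k != 0 -> sqmod (unit_mean k) <= (k ^+ 2)^-1.
Proof. by move=> k0; have := @sqmod_interval_transform_le R 0 1 k ltr01 k0; rewrite add0r. Qed.

Lemma sqmod_cisB1_le (k : R) : sqmod (cis k - 1) <= 4.
Proof.
rewrite sqmod_cisB1 -[X in _ <= X]mulr1 ler_pM2l// sin2cos2 lerBlDr lerDl sqr_ge0 //.
Qed.

Lemma sqmod_cisBB1 (u v : R) :
  sqmod (cis (u - v) - 1) <= 2 * sqmod (cis u - 1) + 2 * sqmod (cis v - 1).
Proof.
have -> : sqmod (cis (u - v) - 1) = sqmod (cis u - cis v).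
  rewrite -[RHS]mulr1 -(sqmod_cis v) -(sqmodJ (cis v)) -sqmodM mulrBl -cisB.
  by rewrite mulJ_sqmod sqmod_cis.
rewrite (_ : cis u - cis v = (cis u - 1) + (- (cis v - 1))); last by ring.
by rewrite (le_trans (sqmodD_le _ _))// sqmodN.
Qed.

Section hexagon.
Variables (o a c : R * R) (P Q : R).
Hypotheses (w0 : wedge a c != 0) (P0 : 0 < P) (Q0 : 0 < Q).
Let H := hexagon o a c P Q.
Let b := third_edge a c P Q.

Let mH : measurable (H : set pl).
Proof. exact: measurable_hexagon. Qed.
Let Hoo : (leb2 R H < +oo)%E.
Proof. exact: leb2_hexagon. Qed.
Let H0 : (0 < leb2 R H)%E.
Proof. exact: hexagon_measure_gt0. Qed.

Lemma inner_hexagon_ft l m :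
  inner (leb2 R) H (expchar l) (expchar m) = hexagon_ft o a c P Q (l - m).
Proof. by apply: eq_cint => z _; rewrite expcharM_conj. Qed.

(** At a zero [x], the identity [hexagon_ft_be] balances a term with the factor
    [unit_mean (dot x a)], bounded below as [|dot x a| <= rho < 1], against a term
    with the factor [unit_mean (dot x c)], which decays like [1 / |dot x c|]. *)
Lemma hexagon_ft_zero_asymptotic x rho : hexagon_ft o a c P Q x = 0 ->
  `|dot x a| <= rho -> rho < 1 -> dot x c != 0 ->
  sqmod (cis (dot x b + dot x c) - 1) <=
  4 * P ^+ 2 / (Q ^+ 2 * cos (pi * rho / 2) ^+ 4) / dot x c ^+ 2.
Proof.
move=> ft0 arho rho1 g0; have p0 := pi_gt0 R.
have rho0 : 0 <= rho by apply: le_trans arho.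
have crho : 0 < cos (pi * rho / 2).
  have : pi * rho < pi by rewrite gtr_pMr.
  have : 0 <= pi * rho by rewrite mulr_ge0// ltW.
  by move=> ? ?; apply: cos_gt0_pihalf; apply/andP; split; lra.
have := hexagon_ft_be o x w0 P0 Q0; rewrite /= ft0 mulr0 -dot_third_edge -/b.
set al := dot x a in arho *; set ga := dot x c in g0 *; set be := dot x b.
have W0 : `|wedge a c|%:C * cis (dot x o) != 0.
  by rewrite mulf_neq0 ?cis_neq0// fmorph_eq0 normr_eq0.
move/esym/eqP; rewrite mulf_eq0 (negPf W0) /= addrC addr_eq0 => /eqP.
move/(congr1 (@sqmod R)); rewrite sqmodN !sqmodM !sqmodR => E.
have E1 := sqmod_unit_mean_ge arho (ltW rho1).
have E2 := sqmod_unit_mean_le g0.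
have E3 := sqmod_cisB1_le (al + be).
have K0 : 0 < Q ^+ 2 * cos (pi * rho / 2) ^+ 4 by rewrite mulr_gt0 ?exprn_gt0.
have g2 : 0 < ga ^+ 2 by rewrite exprn_even_gt0.
rewrite ler_pdivlMr// ler_pdivlMr//.
set Y := sqmod (cis (be + ga) - 1) in E *; have Y0 : 0 <= Y by exact: sqmod_ge0.
have : Q ^+ 2 * cos (pi * rho / 2) ^+ 4 * Y <= P ^+ 2 * (ga ^+ 2)^-1 * 4.
  apply: le_trans (_ : Q ^+ 2 * sqmod (unit_mean al) * Y <= _).
    by apply: ler_wpM2r => //; apply: ler_wpM2l => //; exact: sqr_ge0.
  rewrite E; apply: ler_pM => //; [|exact: sqmod_ge0|].
    by apply: mulr_ge0; [exact: sqr_ge0|exact: sqmod_ge0].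
  by apply: ler_wpM2l => //; exact: sqr_ge0.
move/(ler_wpM2r (ltW g2)).
rewrite [X in _ <= X -> _](_ : _ = 4 * P ^+ 2); last by field.
by apply: le_trans; rewrite le_eqVlt; apply/orP; left; apply/eqP; ring.
Qed.

Section spectrum.
Variable Lambda : set (R * R).
Hypothesis spec : is_spectrum H Lambda.

Lemma spectrum_ft_eq0 l m : Lambda l -> Lambda m -> l != m ->
  hexagon_ft o a c P Q (l - m) = 0.
Proof.
by move=> Ll Lm lm; rewrite -inner_hexagon_ft; exact: (spectrum_orthogonal spec).
Qed.

Let in_class l m := exists n : int, dot (l - m) b + dot (l - m) c = n%:~R.

Lemma in_class_sym l m : in_class l m -> in_class m l.
Proof.
by move=> [n nE]; exists (- n); rewrite mulrNz -nE !dotBl; ring.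
Qed.

Lemma in_class_trans l m p : in_class l m -> in_class m p -> in_class l p.
Proof.
by move=> [n nE] [k kE]; exists (n + k); rewrite intrD -nE -kE !dotBl; ring.
Qed.

(** A far point [nu] of the spectrum whose coordinate along [a] is within
    [rho = 1 / 2 + w < 1] of both [dot l a] and [dot m a] makes the differences
    [l - nu] and [m - nu] almost satisfy the congruence; so does [l - m], with an
    error that tends to [0] as [nu] goes to infinity. *)
Lemma in_class_close l m : Lambda l -> Lambda m -> `|dot l a - dot m a| <= 1 -> in_class l m.
Proof.
move=> Ll Lm lm1.
have [w [w_gt0 w_lt strip]] := spectrum_meets_strip w0 P0 Q0 spec.
pose al := (dot l a + dot m a) / 2.
pose rho := 1 / 2 + w.
have rho1 : rho < 1 by rewrite /rho; lra.
pose C := 4 * P ^+ 2 / (Q ^+ 2 * cos (pi * rho / 2) ^+ 4).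
have C0 : 0 <= C.
  by apply: divr_ge0; apply: mulr_ge0; rewrite ?exprn_even_ge0.
have bound (X : R) : 1 <= X ->
    sqmod (cis ((dot (l - m) b + dot (l - m) c)) - 1) <= 4 * (C / X ^+ 2).
  move=> X1; have X0 : 0 < X by apply: lt_le_trans X1.
  have [nu [Lnu nual nuc]] := strip al (X + `|dot l c| + `|dot m c|).
  have tie p : Lambda p -> `|dot p a - al| <= 1 / 2 -> `|dot p c| <= `|dot l c| + `|dot m c| ->
      sqmod (cis (dot (p - nu) b + dot (p - nu) c) - 1) <= C / X ^+ 2.
    move=> Lp pal pc.
    have Xg : X <= `|dot (p - nu) c|.
      rewrite dotBl; have := ler_normB (dot p c - dot nu c) (dot p c).
      by rewrite addrAC subrr add0r normrN; lra.
    have g0 : dot (p - nu) c != 0 by rewrite -normr_gt0 (lt_le_trans X0).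
    have pnu : p != nu.
      by apply: contraNneq g0 => ->; rewrite subrr /dot /= !mul0r addr0.
    have arho : `|dot (p - nu) a| <= rho.
      rewrite dotBl (_ : _ - _ = (dot p a - al) + (al - dot nu a)); last by ring.
      by rewrite (le_trans (ler_normD _ _))// /rho; lra.
    apply: le_trans (hexagon_ft_zero_asymptotic (spectrum_ft_eq0 Lp Lnu pnu) arho rho1 g0) _.
    have g2 : 0 < dot (p - nu) c ^+ 2 by rewrite exprn_even_gt0.
    have X2 : 0 < X ^+ 2 by rewrite exprn_gt0.
    rewrite -/C ler_wpM2l// lef_pV2 ?posrE//.
    by rewrite -[leRHS]real_normK ?num_real//; apply: lerXn2r; rewrite ?nnegrE// ltW.
  have nl : sqmod (cis (dot (l - nu) b + dot (l - nu) c) - 1) <= C / X ^+ 2.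
    apply: (tie _ Ll); last by rewrite lerDl.
    rewrite /al (_ : _ - _ = (dot l a - dot m a) / 2); last by field.
    by rewrite normrM [`|2^-1|]gtr0_norm ?invr_gt0// ler_pM2r ?invr_gt0.
  have nm : sqmod (cis (dot (m - nu) b + dot (m - nu) c) - 1) <= C / X ^+ 2.
    apply: (tie _ Lm); last by rewrite lerDr.
    rewrite /al (_ : _ - _ = - ((dot l a - dot m a) / 2)); last by field.
    by rewrite normrN normrM [`|2^-1|]gtr0_norm ?invr_gt0// ler_pM2r ?invr_gt0.
  rewrite (_ : dot (l - m) b + _ = (dot (l - nu) b + dot (l - nu) c) -
     (dot (m - nu) b + dot (m - nu) c)); last by rewrite !dotBl; ring.
  by apply: le_trans (sqmod_cisBB1 _ _) _; lra.
suff : sqmod (cis (dot (l - m) b + dot (l - m) c) - 1) == 0.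
  by rewrite sqmod_eq0 subr_eq0 => /eqP /cis_eq1.
rewrite eq_le sqmod_ge0 andbT leNgt; apply/negP => e0.
set e := sqmod _ in bound e0.
have CX0 : 0 <= 4 * C / e by apply: divr_ge0; [exact: mulr_ge0|exact: ltW].
have X1 : 1 <= 1 + 4 * C / e by rewrite lerDl.
have := bound _ X1; set X := 1 + _ in X1 *.
have X0 : 0 < X by apply: lt_le_trans X1.
rewrite mulrA ler_pdivlMr ?exprn_gt0// leNgt => /negP; apply.
apply: lt_le_trans (_ : e * X <= _).
  by rewrite /X mulrDr mulr1 [e * (_ / e)]mulrC mulfVK ?gt_eqF// ltrDr.
by rewrite ler_pM2l// expr2 ler_peMl// ltW.
Qed.

(** If [dot l a] and [dot m a] differ by more than [1], the strip around
    [dot l a + 1 / 2] contains an intermediate point of the spectrum, which is at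
    least [eta = 1 / 2 - w] closer to [m]. *)
Lemma in_class_all l m : Lambda l -> Lambda m -> in_class l m.
Proof.
have [w [w_gt0 w_lt strip]] := spectrum_meets_strip w0 P0 Q0 spec.
pose eta := 1 / 2 - w; have eta0 : 0 < eta by rewrite /eta; lra.
have chain (n : nat) : forall l m, Lambda l -> Lambda m ->
    `|dot l a - dot m a| <= 1 + n%:R * eta -> in_class l m.
  elim: n => [|n ih] p q Lp Lq; first by rewrite mul0r addr0; exact: in_class_close.
  wlog pq : p q Lp Lq / dot p a <= dot q a => [W d|].
    have [pq|/ltW qp] := leP (dot p a) (dot q a); first exact: W.
    by apply: in_class_sym; apply: W => //; rewrite distrC.
  have [le1 _|gt1 d] := leP `|dot p a - dot q a| 1; first exact: in_class_close.
  rewrite distrC ger0_norm ?subr_ge0// in gt1 d.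
  have [nu [Lnu close _]] := strip (dot p a + 1 / 2) 0.
  move: close; rewrite ltr_norml => /andP[n1 n2].
  have etaE : eta = 1 / 2 - w by [].
  rewrite -natr1 mulrDl mul1r in d.
  apply: (@in_class_trans _ nu).
    by apply: in_class_close => //; rewrite ler_norml; apply/andP; split; lra.
  apply: ih => //; rewrite distrC ger0_norm; lra.
move=> Ll Lm; pose x := `|dot l a - dot m a| / eta.
have x0 : 0 <= x by rewrite divr_ge0// ltW.
apply: (chain (Num.truncn x).+1) => //.
have /ltW := truncnS_gt x.
rewrite /x ler_pdivrMr// => h; apply: le_trans h _; by rewrite lerDr.
Qed.

End spectrum.
End hexagon.

Lemma third_edge_swap a c P Q : third_edge c a Q P = third_edge a c P Q.
Proof. by rewrite /third_edge addrC [X in (_, X)]addrC. Qed.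

(** The differences lie in the dual lattice, so the spectrum is contained in a
    translate of it. A character of this translate outside the spectrum would be
    orthogonal to the whole spectrum, against completeness. *)
Theorem spectrum_hexagonE o a c P Q (Lambda : set (R * R)) :
  wedge a c != 0 -> 0 < P -> 0 < Q ->
  is_spectrum (hexagon o a c P Q) Lambda ->
  exists t, Lambda = translate (dual_lattice a c P Q) t.
Proof.
move=> w0 P0 Q0 spec; set H := hexagon o a c P Q in spec.
have mH : measurable (H : set pl) := measurable_hexagon o a c P Q.
have Hoo : (leb2 R H < +oo)%E := leb2_hexagon o P Q w0.
have H0 : (0 < leb2 R H)%E := hexagon_measure_gt0 o w0 P0 Q0.
have V0 := fine_measure_gt0 Hoo H0.
have w0' := wedgeC_neq0 w0.
have spec' : is_spectrum (hexagon o c a Q P) Lambda by rewrite hexagon_swap.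
have diffs l m : Lambda l -> Lambda m -> dual_lattice a c P Q (l - m).
  move=> Ll Lm; split; last exact: (in_class_all w0 P0 Q0 spec).
  have [n] := in_class_all w0' Q0 P0 spec' Ll Lm.
  by rewrite third_edge_swap addrC => nE; exists n.
(* a character orthogonal to the spectrum would contradict completeness *)
have complete x : (forall l, Lambda l -> inner (leb2 R) H (expchar x) (expchar l) = 0) -> False.
  move=> orth.
  have [s [us sL]] := spectrum_parseval mH Hoo H0 spec (cbm_expchar x) V0.
  rewrite sqnorm_expchar// big_seq big1 ?mul0r ?subr0 ?ltxx// => l ls.
  by rewrite orth ?sqmod0//; exact: sL.
have [t Lt] : exists t, Lambda t.
  apply: contrapT => no; apply: (complete 0) => l Ll.
  by exfalso; apply: no; exists l.
exists t; apply/seteqP; split => x.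
  by move=> Lx; exists (x - t); [exact: diffs|rewrite subrK].
move=> [y Ty <-]; apply: contrapT => no; apply: (complete (y + t)) => l Ll.
rewrite inner_hexagon_ft; apply: hexagon_ft_dual_lattice => //; last first.
  by rewrite subr_eq0; apply: contra_notN no => /eqP ->.
rewrite -addrA; have [[m mE] [n nE]] := diffs _ _ Lt Ll.
case: Ty => [[m' mE'] [n' nE']].
split; rewrite !(dotDl y).
- by exists (m' + m); rewrite intrD -mE -mE'; ring.
- by exists (n' + n); rewrite intrD -nE -nE'; ring.
Qed.

End uniqueness.

(** * Functions approximable by trigonometric polynomials *)

Section approximation.
Context {R : realType}.
Notation mR := (measurableTypeR R).
Notation pl := (mR * mR)%type.
Notation la := (@lebesgue_measure R).
Variables (Omega : set (R * R)).
Hypotheses (mO : measurable (Omega : set pl)) (Ooo : (leb2 R Omega < +oo)%E).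
Implicit Types f g p : pl -> R[i].

Definition cmeasurable f :=
  measurable_fun setT (fun x : pl => complex.Re (f x)) /\
  measurable_fun setT (fun x : pl => complex.Im (f x)).

Lemma cmeasurableD f g : cmeasurable f -> cmeasurable g ->
  cmeasurable (fun x => f x + g x).
Proof.
move=> [f1 f2] [g1 g2]; split.
- have := measurable_funD f1 g1; congr measurable_fun.
  by apply/funext => x /=; case: (f x) (g x) => ? ? [].
- have := measurable_funD f2 g2; congr measurable_fun.
  by apply/funext => x /=; case: (f x) (g x) => ? ? [].
Qed.

Lemma cmeasurableM f g : cmeasurable f -> cmeasurable g ->
  cmeasurable (fun x => f x * g x).
Proof.
move=> [f1 f2] [g1 g2]; split.
- have := measurable_funB (measurable_funM f1 g1) (measurable_funM f2 g2).
  congr measurable_fun.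
  by apply/funext => x /=; case: (f x) (g x) => ? ? [].
- have := measurable_funD (measurable_funM f1 g2) (measurable_funM f2 g1).
  congr measurable_fun.
  by apply/funext => x /=; case: (f x) (g x) => ? ? [].
Qed.

Lemma cmeasurable_cst (c : R[i]) : cmeasurable (fun=> c).
Proof. by split. Qed.

Lemma cmeasurableN f : cmeasurable f -> cmeasurable (fun x => - f x).
Proof.
move=> mf; have := cmeasurableM (cmeasurable_cst (-1)) mf.
by congr cmeasurable; apply/funext => x; rewrite mulN1r.
Qed.

Lemma cmeasurableB f g : cmeasurable f -> cmeasurable g ->
  cmeasurable (fun x => f x - g x).
Proof. by move=> mf mg; apply: cmeasurableD => //; exact: cmeasurableN. Qed.

Lemma cmeasurable_real (f : pl -> R) : measurable_fun setT f ->
  cmeasurable (fun x => (f x)%:C).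
Proof. by move=> mf; split. Qed.

Lemma cmeasurable_expchar l : cmeasurable (expchar l).
Proof. by have [[m1 _] [m2 _]] := cbm_expchar l. Qed.

Lemma measurable_sqmod f : cmeasurable f -> measurable_fun setT (fun x : pl => sqmod (f x)).
Proof.
by move=> [f1 f2]; apply: measurable_funD; exact: measurable_funX.
Qed.

Notation N2 := (sqnormL2 Omega).

Let mEsqmod f : cmeasurable f -> measurable_fun Omega (fun x : pl => (sqmod (f x))%:E).
Proof.
by move=> /measurable_sqmod mf; apply/measurable_EFinP; exact: measurable_funTS.
Qed.

Lemma sqnormL2D f g : cmeasurable f -> cmeasurable g ->
  (N2 (fun x => (f x + g x)%R) <= 2%:E * N2 f + 2%:E * N2 g)%E.
Proof.
move=> mf mg; have msf := mEsqmod mf; have msg := mEsqmod mg.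
have sq0 (h : pl -> R[i]) (x : pl) : Omega x -> (0 <= (sqmod (h x))%:E)%E by rewrite lee_fin sqmod_ge0.
have msZ h : cmeasurable h -> measurable_fun Omega (fun x : pl => 2%:E * (sqmod (h x))%:E)%E.
  by move=> mh; apply: measurable_funeM; exact: mEsqmod.
have sqZ0 (h : pl -> R[i]) (x : pl) : Omega x -> (0 <= 2%:E * (sqmod (h x))%:E)%E.
  by move=> Ox; rewrite mule_ge0// sq0.
rewrite /sqnormL2 -(ge0_integralZl _ mO msf (sq0 f))// -(ge0_integralZl _ mO msg (sq0 g))//.
rewrite -(ge0_integralD _ mO (sqZ0 f) (msZ f mf) (sqZ0 g) (msZ g mg)).
apply: (ge0_le_integral _ mO (sq0 _) (mEsqmod (cmeasurableD mf mg)) (emeasurable_funD (msZ f mf) (msZ g mg))).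
by move=> x _; rewrite -!EFinM -EFinD lee_fin; exact: sqmodD_le.
Qed.

Lemma sqnormL2M f q (M : R) : cmeasurable f -> cmeasurable q ->
  (forall x, sqmod (q x) <= M) ->
  (N2 (fun x => (q x * f x)%R) <= M%:E * N2 f)%E.
Proof.
move=> mf mq qM.
have M0 : 0 <= M by apply: le_trans (qM (0, 0)); exact: sqmod_ge0.
have sq0 (h : pl -> R[i]) (x : pl) : Omega x -> (0 <= (sqmod (h x))%:E)%E by rewrite lee_fin sqmod_ge0.
have msf := mEsqmod mf.
rewrite /sqnormL2 -(ge0_integralZl _ mO msf (sq0 f))//.
apply: (ge0_le_integral _ mO (sq0 _) (mEsqmod (cmeasurableM mq mf)) (measurable_funeM _ msf)).
move=> x _; rewrite -EFinM lee_fin [leLHS](_ : _ = sqmod (q x) * sqmod (f x)).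
  by apply: ler_wpM2r => //; exact: sqmod_ge0.
by rewrite -sqmodM.
Qed.

Lemma eq_sqnormL2 f g : (forall x, Omega x -> f x = g x) -> N2 f = N2 g.
Proof. by move=> fg; apply: eq_integral => x; rewrite inE => /fg ->. Qed.

Variable Lambda : set (R * R).
Hypotheses (L0 : Lambda 0) (LD : forall l m, Lambda l -> Lambda m -> Lambda (l + m)).

(** An inductive description is closed under sums and products without any
    bookkeeping of coefficients; [trigpoly_sum] recovers the explicit form. *)
Inductive trigpoly : (pl -> R[i]) -> Prop :=
| trigpoly0 : trigpoly (fun=> 0)
| trigpolyS c l p : Lambda l -> trigpoly p -> trigpoly (fun x => c * expchar l x + p x).

Lemma cmeasurable_trigpoly p : trigpoly p -> cmeasurable p.
Proof.
elim=> [|c l {}p _ _ mp]; first exact: cmeasurable_cst.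
apply: cmeasurableD => //; apply: cmeasurableM; first exact: cmeasurable_cst.
exact: cmeasurable_expchar.
Qed.

Lemma trigpoly_bounded p : trigpoly p -> exists M, forall x, sqmod (p x) <= M.
Proof.
elim=> [|c l {}p _ _ [M pM]]; first by exists 0 => x; rewrite sqmod0.
exists (2 * sqmod c + 2 * M) => x; apply: le_trans (sqmodD_le _ _) _.
by rewrite sqmodM sqmod_cis mulr1 lerD2l ler_pM2l.
Qed.

Lemma trigpoly_char c l : Lambda l -> trigpoly (fun x => c * expchar l x).
Proof.
move=> Ll; rewrite (_ : (fun x => _) = fun x => c * expchar l x + 0).
  by apply: trigpolyS => //; exact: trigpoly0.
by apply/funext => x; rewrite addr0.
Qed.

Lemma trigpoly_cst c : trigpoly (fun=> c).
Proof.
rewrite (_ : (fun x => _) = fun x => c * expchar 0 x); first exact: trigpoly_char.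
by apply/funext => x; rewrite expcharE /dot /= !mul0r addr0 cis0 mulr1.
Qed.

Lemma trigpolyD p q : trigpoly p -> trigpoly q -> trigpoly (fun x => p x + q x).
Proof.
move=> tp tq; elim: tp => [|c l {}p Ll _ ih].
  by move: tq; congr trigpoly; apply/funext => x; rewrite add0r.
have := trigpolyS c Ll ih; congr trigpoly.
by apply/funext => x; rewrite addrA.
Qed.

Lemma trigpoly_charM c l q : Lambda l -> trigpoly q ->
  trigpoly (fun x => c * expchar l x * q x).
Proof.
move=> Ll; elim=> [|c' l' {}q Ll' _ ih].
  by have := trigpoly0; congr trigpoly; apply/funext => x; rewrite mulr0.
have := trigpolyS (c * c') (LD Ll Ll') ih; congr trigpoly.
by apply/funext => x; rewrite !expcharE dotDl cisD; ring.
Qed.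

Lemma trigpolyM p q : trigpoly p -> trigpoly q -> trigpoly (fun x => p x * q x).
Proof.
move=> tp tq; elim: tp => [|c l {}p Ll _ ih].
  by have := trigpoly0; congr trigpoly; apply/funext => x; rewrite mul0r.
have := trigpolyD (trigpoly_charM c Ll tq) ih; congr trigpoly.
by apply/funext => x; rewrite mulrDl.
Qed.

Lemma trigpolyX p n : trigpoly p -> trigpoly (fun x => p x ^+ n).
Proof.
move=> tp; elim: n => [|n ih]; first exact: trigpoly_cst.
have := trigpolyM tp ih; congr trigpoly.
by apply/funext => x; rewrite exprS.
Qed.

Lemma trigpoly_sum p : trigpoly p -> exists (s : seq (R * R)) (c : R * R -> R[i]),
  (forall l, l \in s -> Lambda l) /\ forall x, p x = \sum_(l <- s) c l * expchar l x.
Proof.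
elim=> [|c l {}p Ll _ [s [d [sL dE]]]].
  by exists [::], (fun=> 0); split => // x; rewrite big_nil.
have [ls|ls] := boolP (l \in s).
  exists (undup s), (fun m => (if m == l then c else 0) + d m *+ count_mem m s).
  split=> [m|x]; first by rewrite mem_undup => /sL.
  rewrite dE sum_expchar_undup; under [in RHS]eq_bigr do rewrite mulrDl.
  rewrite big_split /=; congr (_ + _).
  rewrite (bigD1_seq l) ?mem_undup ?undup_uniq//= eqxx big1 ?addr0// => m /negPf ->.
  by rewrite mul0r.
exists (l :: s), (fun m => if m == l then c else d m); split=> [m|x].
  by rewrite inE => /predU1P[->//|/sL].
rewrite big_cons eqxx dE; congr (_ + _); apply: eq_big_seq => m ms.
by case: eqP => // ml; rewrite ml (negPf ls) in ms.
Qed.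

(** The tolerance bounds the square of the norm. *)
Definition approximable f := forall e : R, 0 < e ->
  exists p, trigpoly p /\ (N2 (fun x => (f x - p x)%R) < e%:E)%E.

Lemma approximable_trigpoly p : trigpoly p -> approximable p.
Proof.
move=> tp e e0; exists p; split => //.
rewrite (@eq_sqnormL2 _ (fun=> 0)); last by move=> x _; rewrite subrr.
rewrite (_ : N2 _ = 0%E) ?lte_fin//; rewrite /sqnormL2.
by apply: integral0_eq => x _; rewrite /= expr0n/= addr0.
Qed.

Lemma approximable_lim f : cmeasurable f ->
  (forall e : R, 0 < e -> exists g, [/\ cmeasurable g, approximable g &
     (N2 (fun x => (f x - g x)%R) < e%:E)%E]) ->
  approximable f.
Proof.
move=> mf lim e e0; have e4 : 0 < e / 4 by rewrite divr_gt0.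
have [g [mg ag fg]] := lim _ e4; have [p [tp gp]] := ag _ e4.
exists p; split => //; have mp := cmeasurable_trigpoly tp.
rewrite (_ : (fun x => f x - p x) = (fun x => (f x - g x) + (g x - p x))); last first.
  by apply/funext => x; ring.
apply: le_lt_trans (sqnormL2D (cmeasurableB mf mg) (cmeasurableB mg mp)) _.
rewrite (_ : e%:E = (2%:E * (e / 4)%:E + 2%:E * (e / 4)%:E)%E).
  by apply: lteD; rewrite lte_pmul2l// ?lte_fin.
by rewrite -!EFinM -EFinD; congr EFin; field.
Qed.

Lemma approximableD f g : cmeasurable f -> cmeasurable g ->
  approximable f -> approximable g -> approximable (fun x => f x + g x).
Proof.
move=> mf mg af ag e e0; have e4 : 0 < e / 4 by rewrite divr_gt0.
have [p [tp fp]] := af _ e4; have [q [tq gq]] := ag _ e4.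
exists (fun x => p x + q x); split; first exact: trigpolyD.
have mp := cmeasurable_trigpoly tp; have mq := cmeasurable_trigpoly tq.
rewrite (_ : (fun x => _) = (fun x => (f x - p x) + (g x - q x))); last first.
  by apply/funext => x; ring.
apply: le_lt_trans (sqnormL2D (cmeasurableB mf mp) (cmeasurableB mg mq)) _.
rewrite (_ : e%:E = (2%:E * (e / 4)%:E + 2%:E * (e / 4)%:E)%E).
  by apply: lteD; rewrite lte_pmul2l// ?lte_fin.
by rewrite -!EFinM -EFinD; congr EFin; field.
Qed.

Lemma approximable_trigpolyM f q : cmeasurable f -> trigpoly q ->
  approximable f -> approximable (fun x => q x * f x).
Proof.
move=> mf tq af e e0; have [M qM] := trigpoly_bounded tq.
have mq := cmeasurable_trigpoly tq.
have M0 : 0 <= M by apply: le_trans (qM (0, 0)); exact: sqmod_ge0.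
have M1 : 0 < M + 1 by rewrite ltr_wpDl.
have [p [tp fp]] := af _ (divr_gt0 e0 M1).
exists (fun x => q x * p x); split; first exact: trigpolyM.
have mp := cmeasurable_trigpoly tp.
rewrite (_ : (fun x => _) = (fun x => q x * (f x - p x))); last first.
  by apply/funext => x; ring.
have qM' x : sqmod (q x) <= M + 1 by rewrite (le_trans (qM x))// lerDl.
apply: le_lt_trans (sqnormL2M (cmeasurableB mf mp) mq qM') _.
rewrite (_ : e%:E = ((M + 1)%:E * (e / (M + 1))%:E)%E).
  by rewrite lte_pmul2l// ?lte_fin.
by rewrite -EFinM; congr EFin; field; exact: lt0r_neq0.
Qed.

Lemma approximableZ f c : cmeasurable f -> approximable f ->
  approximable (fun x => c * f x).
Proof. by move=> mf af; apply: approximable_trigpolyM => //; exact: trigpoly_cst. Qed.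

Lemma approximable_null f g (N : set pl) : measurable N -> leb2 R N = 0%E ->
  cmeasurable f -> cmeasurable g ->
  (forall x, Omega x -> ~ N x -> f x = g x) -> approximable g -> approximable f.
Proof.
move=> mN N0 mf mg fg ag; apply: approximable_lim => // e e0.
exists g; split => //.
rewrite (_ : N2 _ = 0%E) ?lte_fin//; rewrite /sqnormL2.
transitivity (\int[leb2 R]_(x in Omega) (cst 0 x))%E; last by rewrite integral0.
apply: ae_eq_integral => //.
- exact: (mEsqmod (cmeasurableB mf mg)).
- exists N; split => // x /= h; apply: contrapT => Nx; apply: h => Ox.
  by rewrite (fg x Ox Nx) subrr /= expr0n /= addr0.
Qed.

Lemma approximable_cvg (F : nat -> pl -> R[i]) f (G : pl -> R) :
  (forall n, cmeasurable (F n)) -> cmeasurable f ->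
  (forall n, approximable (F n)) ->
  (forall x, Omega x -> sqmod (f x - F n x) @[n --> \oo] --> 0) ->
  (leb2 R).-integrable Omega (EFin \o G) ->
  (forall n x, Omega x -> sqmod (f x - F n x) <= G x) ->
  approximable f.
Proof.
move=> mF mf aF cvF iG FG; apply: approximable_lim => // e e0.
have mFn n := cmeasurableB mf (mF n).
have := @dominated_convergence _ _ _ (leb2 R) Omega mO
  (fun n x => (sqmod (f x - F n x))%:E) (cst 0%E) (EFin \o G) (fun n => mEsqmod (mFn n))
  (measurable_cst _).
case.
- apply: aeW => x Ox; apply: cvg_EFin; first by near=> n.
  exact: cvF.
- exact: iG.
- apply: aeW => x n Ox /=; rewrite lee_fin ger0_norm ?sqmod_ge0//; exact: FG.
move=> _ _; rewrite integral0 => /fine_cvgP[] [n1 _ fin] /cvgrPdist_lt /(_ e e0) [n2 _ small].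
pose n := maxn n1 n2; exists (F n); split => //.
have := small n (leq_maxr _ _); rewrite /= sub0r normrN => /(le_lt_trans (ler_norm _)).
by rewrite -lte_fin fineK//; exact: (fin n (leq_maxl _ _)).
Unshelve. all: by end_near.
Qed.

End approximation.

(** * Polynomials approximating a step *)

Section threshold.
Context {R : realType}.

(** On the unit interval these polynomials tend to the indicator function of
    [t >= 1 / 2]: with [N = n 2 ^ n], the number [N t ^ n = n (2 t) ^ n] tends to
    [0] or to infinity according to the side of [1 / 2], and the power
    [(1 - t ^ n) ^ N] then tends to [1] or to [0] by Bernoulli's inequality.
    The factor [n] settles the case [t = 1 / 2]. *)
Definition threshold (n : nat) (t : R) : R := 1 - (1 - t ^+ n) ^+ (n * 2 ^ n).

Lemma bernoulli_ineq (x : R) (n : nat) : -1 <= x -> 1 + n%:R * x <= (1 + x) ^+ n.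
Proof.
move=> x1; elim: n => [|n ih]; first by rewrite mul0r addr0.
have x1' : 0 <= 1 + x by lra.
rewrite exprS; apply: le_trans (ler_wpM2l x1' ih).
rewrite -natr1 -subr_ge0 [leRHS](_ : _ = n%:R * x ^+ 2); last by ring.
by rewrite mulr_ge0 ?sqr_ge0.
Qed.

Lemma nat_mul_expr_le (s : R) (n : nat) : 0 <= s < 1 ->
  n%:R * s ^+ n * (1 - s) <= 1 - s ^+ n.
Proof.
move=> /andP[s0 s1]; elim: n => [|n ih]; first by rewrite !mul0r subrr.
have sn : 0 <= (1 - s) * (1 - s ^+ n.+1).
  by rewrite mulr_ge0 ?subr_ge0 ?exprn_ile1// ltW.
have := ler_wpM2l s0 ih; rewrite -natr1 => h.
rewrite -subr_ge0 (_ : _ - _ = (s * (1 - s ^+ n) - s * (n%:R * s ^+ n * (1 - s)))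
  + (1 - s) * (1 - s ^+ n.+1)); last by rewrite !exprS; ring.
by rewrite addr_ge0// subr_ge0.
Qed.

Lemma threshold_itv (n : nat) (t : R) : 0 <= t <= 1 -> 0 <= threshold n t <= 1.
Proof.
move=> /andP[t0 t1]; have tn0 : 0 <= t ^+ n by rewrite exprn_ge0.
have tn1 : t ^+ n <= 1 by rewrite exprn_ile1.
rewrite /threshold subr_ge0 exprn_ile1 ?gerBl ?exprn_ge0 ?subr_ge0//.
Qed.

(** Multiply [(1 - t ^ n) ^ N] by [(1 + t ^ n) ^ N >= 1 + N t ^ n >= 1 + n]; the
    product is at most [1]. *)
Lemma threshold_ge (n : nat) (t : R) : 2^-1 <= t <= 1 -> 1 - threshold n t <= n.+1%:R^-1.
Proof.
move=> /andP[t2 t1]; have t0 : 0 <= t by apply: le_trans t2; rewrite invr_ge0.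
have tn0 : 0 <= t ^+ n by rewrite exprn_ge0.
have tn1 : t ^+ n <= 1 by rewrite exprn_ile1.
rewrite /threshold opprB addrCA subrr addr0.
set N := (n * 2 ^ n)%N.
have p1 : 0 < (1 + t ^+ n) ^+ N by rewrite exprn_gt0// ltr_pwDl.
rewrite -[leRHS]mul1r ler_pdivlMr ?ltr0n//.
apply: le_trans (_ : (1 - t ^+ n) ^+ N * (1 + t ^+ n) ^+ N <= _).
  apply: ler_wpM2l; first by rewrite exprn_ge0// subr_ge0.
  apply: le_trans (bernoulli_ineq N (_ : -1 <= t ^+ n)); last by lra.
  rewrite -natr1 addrC lerD2l /N natrM -mulrA natrX -exprMn.
  have h : 1 <= (2 * t) ^+ n by rewrite exprn_ege1//; lra.
  by rewrite -[leLHS]mulr1 ler_wpM2l.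
rewrite -exprMn exprn_ile1//.
  by rewrite mulr_ge0 ?subr_ge0// addr_ge0.
by rewrite -subr_ge0 (_ : _ - _ = (t ^+ n) ^+ 2) ?sqr_ge0//; ring.
Qed.

(** Bernoulli gives the bound [n s ^ (2 n)] with [s ^ 2 = 2 t]; one factor [s ^ n]
    absorbs [n] and the other one is kept as a geometric decay. *)
Lemma threshold_lt (n : nat) (t : R) : 0 <= t < 2^-1 ->
  threshold n t <= (1 - Num.sqrt (2 * t))^-1 * Num.sqrt (2 * t) ^+ n.
Proof.
move=> /andP[t0 t2]; set s := Num.sqrt _.
have s0 : 0 <= s by rewrite sqrtr_ge0.
have ss : s ^+ 2 = 2 * t by rewrite sqr_sqrtr//; lra.
have s1 : s < 1.
  rewrite ltNge; apply/negP => s1; have : 1 <= s ^+ 2 by rewrite exprn_ege1.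
  by rewrite ss; lra.
have tn1 : t ^+ n <= 1 by rewrite exprn_ile1//; lra.
have tn0 : 0 <= t ^+ n by rewrite exprn_ge0.
have := bernoulli_ineq (n * 2 ^ n) (_ : -1 <= - t ^+ n).
rewrite lerN2 => /(_ tn1) h.
rewrite /threshold; apply: le_trans (_ : n%:R * s ^+ n * s ^+ n <= _).
  have e : (n * 2 ^ n)%:R * t ^+ n = n%:R * s ^+ n * s ^+ n :> R.
    by rewrite -mulrA -exprMn -expr2 ss exprMn natrM natrX mulrA.
  by move: h; rewrite mulrN e; lra.
rewrite ler_wpM2r ?exprn_ge0// -[leRHS]mul1r ler_pdivlMr ?subr_gt0//.
apply: le_trans (nat_mul_expr_le n _) _; first by rewrite s0.
by rewrite gerBl exprn_ge0.
Qed.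

Lemma cvg_threshold (t : R) : 0 <= t <= 1 ->
  threshold n t @[n --> \oo] --> ((2^-1 <= t)%R%:R : R).
Proof.
move=> t01; have [t2|t2] := leP 2^-1 t.
  rewrite (_ : (fun n => _) = (fun n => 1 - (1 - threshold n t))); last first.
    by apply/funext => n; ring.
  rewrite -[X in _ --> X]subr0; apply: cvgB; first exact: cvg_cst.
  apply: (@squeeze_cvgr _ _ _ _ (fun=> 0) (@harmonic R)).
  - apply: nearW => n; have /andP[_ h] := threshold_itv n t01.
    by rewrite subr_ge0 h /= threshold_ge// t2; case/andP: t01.
  - exact: cvg_cst.
  - exact: cvg_harmonic.
apply: (@squeeze_cvgr _ _ _ _ (fun=> 0) (fun n => (1 - Num.sqrt (2 * t))^-1 * Num.sqrt (2 * t) ^+ n)).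
- apply: nearW => n; have /andP[h _] := threshold_itv n t01.
  by rewrite h threshold_lt//; case/andP: t01 => -> _.
- exact: cvg_cst.
- apply: cvg_geometric; rewrite ger0_norm ?sqrtr_ge0//.
  have t0 : 0 <= t by case/andP: t01.
  rewrite ltNge; apply/negP => s1.
  have : 1 <= Num.sqrt (2 * t) ^+ 2 by rewrite exprn_ege1.
  by rewrite sqr_sqrtr; lra.
Qed.

End threshold.

(** * The sigma-algebra of approximable sets *)

Section approximable_sets.
Context {R : realType}.
Notation mR := (measurableTypeR R).
Notation pl := (mR * mR)%type.
Variables (Omega : set (R * R)).
Hypotheses (mO : measurable (Omega : set pl)) (Ooo : (leb2 R Omega < +oo)%E).
Variable Lambda : set (R * R).
Hypotheses (L0 : Lambda 0) (LD : forall l m, Lambda l -> Lambda m -> Lambda (l + m)).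
Hypothesis LN : forall l, Lambda l -> Lambda (- l).

Local Notation approximable := (approximable Omega Lambda).
Local Notation trigpoly := (trigpoly Lambda).

Definition cindic (A : set pl) (x : pl) : R[i] := (\1_A x)%:C.

Definition approximable_set (A : set pl) := measurable A /\ approximable (cindic A).

Lemma cmeasurable_cindic (A : set pl) : measurable A -> cmeasurable (cindic A).
Proof. by move=> mA; apply: cmeasurable_real; exact: measurable_indic. Qed.

Lemma sqmod_cindic_le (A : set pl) x : sqmod (cindic A x) <= 1.
Proof. by rewrite /cindic sqmodR indicE; case: (_ \in _); rewrite ?expr1n ?expr0n//= ler01. Qed.

Let integrable_cst1 : (leb2 R).-integrable Omega (EFin \o (fun=> 1 : R)).
Proof. exact: (integrable_bounded_measurable mO Ooo (bounded_measurable_cst _ 1)). Qed.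

Lemma approximable_setC A : approximable_set A -> approximable_set (~` A).
Proof.
move=> [mA aA]; split; first exact: measurableC.
have m1 := cmeasurable_cindic mA.
have := approximableD mO (cmeasurable_cst 1) (cmeasurableM (cmeasurable_cst (-1)) m1)
  (approximable_trigpoly Omega (trigpoly_cst L0 1)) (approximableZ mO L0 LD (-1) m1 aA).
congr approximable; apply/funext => x; rewrite /cindic !indicE in_setC.
by case: (x \in A) => /=; rewrite ?mulr1 ?subrr// mulr0 addr0.
Qed.

(** The indicator of the intersection is a product; approximating one factor by a
    bounded trigonometric polynomial [q] leaves [q] times the other indicator,
    and [q] can be absorbed. *)
Lemma approximable_setI A B : approximable_set A -> approximable_set B ->
  approximable_set (A `&` B).
Proof.
move=> [mA aA] [mB aB]; have mAB : measurable (A `&` B) by exact: measurableI.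
split => //; have m1 := cmeasurable_cindic mA; have m2 := cmeasurable_cindic mB.
apply: (approximable_lim mO (cmeasurable_cindic mAB)) => e e0.
have [q [tq Bq]] := aB _ e0; have mq := cmeasurable_trigpoly tq.
exists (fun x => q x * cindic A x); split.
- exact: cmeasurableM.
- exact: approximable_trigpolyM.
rewrite (_ : (fun x => _) = (fun x => cindic A x * (cindic B x - q x))); last first.
  apply/funext => x; rewrite /cindic !indicE in_setI.
  by case: (x \in A) => /=; rewrite ?mul1r ?mulr1 ?mul0r ?mulr0 ?subrr.
apply: le_lt_trans (sqnormL2M mO (cmeasurableB m2 mq) m1 (sqmod_cindic_le A)) _.
by rewrite mul1e.
Qed.

Lemma approximable_set0 : approximable_set set0.
Proof.
split => //; have := approximable_trigpoly Omega (trigpoly0 Lambda); congr approximable.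
by apply/funext => x; rewrite /cindic indic0.
Qed.

Lemma approximable_setU A B : approximable_set A -> approximable_set B ->
  approximable_set (A `|` B).
Proof.
move=> aA aB; rewrite -(setCK (A `|` B)) setCU; apply: approximable_setC.
by apply: approximable_setI; exact: approximable_setC.
Qed.

Lemma approximable_bigcup (A : (set pl)^nat) : (forall n, approximable_set (A n)) ->
  approximable_set (\bigcup_n A n).
Proof.
move=> aA; pose B n := \big[setU/set0]_(k < n) A k.
have aB n : approximable_set (B n).
  elim: n => [|n ih]; first by rewrite /B big_ord0; exact: approximable_set0.
  by rewrite /B big_ord_recr /=; exact: approximable_setU.
have mA : measurable (\bigcup_n A n) by apply: bigcupT_measurable => n; have [] := aA n.
split => //; apply: (@approximable_cvg _ _ mO Lambda (fun n => cindic (B n)) _ (fun=> 1)).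
- by move=> n; apply: cmeasurable_cindic; have [] := aB n.
- exact: cmeasurable_cindic.
- by move=> n; have [] := aB n.
- move=> x _; have [[k _ Akx]|nAx] := pselect ((\bigcup_n A n) x).
    apply: cvg_near_cst; exists k.+1 => // n /= kn.
    rewrite /cindic !indicE !mem_set ?subrr ?sqmod0//; last by exists k.
    by rewrite /B -bigcup_mkord; exists k.
  apply: cvg_near_cst; apply: nearW => n /=.
  rewrite /cindic !indicE !memNset ?subrr ?sqmod0//.
  by rewrite /B -bigcup_mkord => -[k _ Akx]; apply: nAx; exists k.
- exact: integrable_cst1.
- move=> n x _; rewrite /cindic !indicE; do 2 case: (_ \in _) => /=;
    rewrite ?subrr ?subr0 ?sub0r ?sqmodN sqmodR ?expr1n ?expr0n//= ler01.
Qed.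

(** To approximate all preimages of Borel sets under [phi] it is thus enough to
    treat the preimages of a generating family. *)
Lemma sigma_algebra_approximable T (phi : pl -> T) :
  sigma_algebra setT [set A | approximable_set (phi @^-1` A)].
Proof.
split.
- by rewrite /= preimage_set0; exact: approximable_set0.
- by move=> A /= aA; rewrite setTD preimage_setC; exact: approximable_setC.
- by move=> A aA /=; rewrite preimage_bigcup; exact: approximable_bigcup.
Qed.

(** The polynomials [threshold n] of [q] are trigonometric polynomials that converge
    boundedly to the indicator of the superlevel set. *)
Lemma approximable_superlevel (q : pl -> R) : trigpoly (fun x => (q x)%:C) ->
  (forall x, 0 <= q x <= 1) -> approximable_set [set x | 2^-1 <= q x].
Proof.
move=> tq q01; set A := [set x | _].
have mq : measurable_fun setT q by have [] := cmeasurable_trigpoly tq.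
have mA : measurable A.
  rewrite (_ : A = q @^-1` `[2^-1, +oo[%classic); last first.
    by apply/seteqP; split => x /=; rewrite in_itv/= andbT.
  by rewrite -[X in measurable X]setTI; apply: mq => //; exact: measurable_itv.
have tp n : trigpoly (fun x => (threshold n (q x))%:C).
  rewrite (_ : (fun x => _) = (fun x => 1 + (-1) * (1 + (-1) * (q x)%:C ^+ n) ^+ (n * 2 ^ n))); last first.
    by apply/funext => x; rewrite /threshold !mulN1r rmorphB rmorphXn rmorphB rmorphXn.
  have t1 := trigpoly_cst L0 1; have tm := trigpoly_cst L0 (-1).
  apply: (trigpolyD t1); apply: (trigpolyM LD tm); apply: (trigpolyX L0 LD).
  by apply: (trigpolyD t1); apply: (trigpolyM LD tm); exact: (trigpolyX L0 LD).
have qE x : (2^-1 <= q x)%R%:R = \1_A x :> R.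
  rewrite indicE; congr (nat_of_bool _)%:R.
  by apply/idP/idP; rewrite inE.
split => //; apply: (@approximable_cvg _ _ mO Lambda (fun n x => (threshold n (q x))%:C) _ (fun=> 1)).
- by move=> n; exact: cmeasurable_trigpoly (tp n).
- exact: cmeasurable_cindic.
- by move=> n; exact: approximable_trigpoly.
- move=> x _; rewrite (_ : (fun n => _) = (fun n => (\1_A x - threshold n (q x)) ^+ 2)); last first.
    by apply/funext => n; rewrite /cindic -rmorphB sqmodR.
  have -> : (0 : R) = (\1_A x - \1_A x) * (\1_A x - \1_A x) by rewrite subrr mul0r.
  have h : (\1_A x - threshold n (q x) : R) @[n --> \oo] --> (\1_A x - \1_A x : R).
    by apply: cvgB; [exact: cvg_cst|rewrite -qE; exact: cvg_threshold].
  by apply: cvgM; exact: h.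
- exact: integrable_cst1.
- move=> n x _; rewrite /cindic -rmorphB sqmodR.
  have /andP[h1 h2] := threshold_itv n (q01 x).
  rewrite indicE; case: (_ \in _) => /=; nra.
Qed.

End approximable_sets.

(** * Completeness of the dual of a packing lattice *)

Section fractional_part.
Context {R : realType}.
Implicit Types y t : R.

Definition frac y : R := y - (Num.floor y)%:~R.

Lemma frac_ge0 y : 0 <= frac y.
Proof. by rewrite subr_ge0 floor_le. Qed.

Lemma frac_lt1 y : frac y < 1.
Proof. by rewrite ltrBlDr addrC -[1]/(1%:~R) -intrD floorD1_gt. Qed.

Lemma cos_2pi_ge (x r : R) : `|x| <= 1 / 2 -> 0 <= r <= 1 / 2 ->
  (cos (2 * pi * r) <= cos (2 * pi * x)) = (`|x| <= r).
Proof.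
move=> x2 /andP[r0 r2]; have p0 := pi_gt0 R.
have -> : cos (2 * pi * x) = cos (2 * pi * `|x|).
  rewrite -cos_norm !normrM (gtr0_norm p0) gtr0_norm//.
rewrite leNgt ltr_cos ?in_itv/=; last 2 first.
- by apply/andP; split; nra.
- have := normr_ge0 x; by move=> ?; apply/andP; split; nra.
by rewrite -leNgt ler_pM2l// mulr_gt0.
Qed.

(** On the circle, the arc is the set of points at distance at most half its
    length from its midpoint, and the cosine decreases with the distance. *)
Lemma frac_arc y t1 t2 : 0 < t1 -> t1 <= t2 -> t2 < 1 ->
  (t1 <= frac y <= t2) =
  (cos (pi * (t2 - t1)) <= complex.Re (cis (y - (t1 + t2) / 2))).
Proof.
move=> t10 t12 t21; set m := (t1 + t2) / 2; set r := (t2 - t1) / 2.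
have -> : complex.Re (cis (y - m)) = complex.Re (cis (frac y - m)).
  rewrite (_ : frac y - m = y - m - (Num.floor y)%:~R); last by rewrite /frac; ring.
  by rewrite [in RHS]cisB cis_int rmorph1 mulr1.
have f0 := frac_ge0 y; have f1 := frac_lt1 y; set f := frac y in f0 f1 *.
have -> : pi * (t2 - t1) = 2 * pi * r by rewrite /r; field.
have r02 : 0 <= r <= 1 / 2 by rewrite /r; apply/andP; split; lra.
have goal1 : (t1 <= f <= t2) = (`|f - m| <= r).
  by rewrite ler_norml /m /r; apply/idP/idP => /andP[? ?]; apply/andP; split; lra.
have [h|h] := leP `|f - m| (1 / 2); first by rewrite goal1 /= cos_2pi_ge.
have goal2 : (t1 <= f <= t2) = false.
  by rewrite goal1; apply/negP; case/andP: r02 => _ ? ?; lra.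
rewrite goal2; apply/esym/negbTE.
have cosE s : cos (2 * pi * (s + 1)) = cos (2 * pi * s) :> R.
  by have := cisD s 1; rewrite -[1]/(1%:~R) cis_int mulr1 => -[].
case: (lerP 0 (f - m)) => s0.
  rewrite ger0_norm// in h.
  rewrite /= -(subrK 1 (f - m)) cosE cos_2pi_ge//; last first.
    by rewrite ler_norml; apply/andP; split; rewrite /m in h *; lra.
  by rewrite -ltNge ltr_normr; apply/orP; right; rewrite /m /r; lra.
rewrite ltr0_norm// in h.
rewrite /= -(cosE (f - m)) cos_2pi_ge//; last first.
  by rewrite ler_norml; apply/andP; split; rewrite /m in h *; lra.
by rewrite -ltNge ltr_normr; apply/orP; left; rewrite /m /r; lra.
Qed.

End fractional_part.

Section lattice_completeness.
Context {R : realType}.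
Notation mR := (measurableTypeR R).
Notation pl := (mR * mR)%type.
Variables (Omega : set (R * R)).
Hypotheses (mO : measurable (Omega : set pl)) (Ooo : (leb2 R Omega < +oo)%E).
Variable Lambda : set (R * R).
Hypotheses (L0 : Lambda 0) (LD : forall l m, Lambda l -> Lambda m -> Lambda (l + m)).
Hypothesis LN : forall l, Lambda l -> Lambda (- l).

Local Notation aset := (approximable_set Omega Lambda).
Local Notation approx := (approximable Omega Lambda).
Local Notation trig := (trigpoly Lambda).

Lemma trigpoly_cos d th : Lambda d ->
  trig (fun x : pl => (complex.Re (cis (dot d x - th)))%:C).
Proof.
move=> Ld.
have := trigpolyD (trigpoly_char ((2^-1)%:C * cis (- th)) Ld)
  (trigpoly_char ((2^-1)%:C * cis th) (LN Ld)).
congr trigpoly; apply/funext => x; rewrite !expcharE dotNl.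
rewrite cisN (cisN (dot d x)) cisB.
case: (cis th) (cis (dot d x)) => a b [u v].
by apply/eqP; rewrite eq_complex /=; apply/andP; split; apply/eqP; field.
Qed.

Lemma approximable_arc d t1 t2 : Lambda d -> 0 < t1 -> t1 <= t2 -> t2 < 1 ->
  aset [set x | t1 <= frac (dot d x) <= t2].
Proof.
move=> Ld t10 t12 t21.
pose g (x : pl) := complex.Re (cis (dot d x - (t1 + t2) / 2)).
pose k : R := cos (pi * (t2 - t1)).
have g1 x : -1 <= g x <= 1 by rewrite /g /= cos_geN1 cos_le1.
have k1 : -1 <= k <= 1 by rewrite cos_geN1 cos_le1.
rewrite (_ : [set x | _] = [set x | 2^-1 <= (g x - k + 2) / 4]); last first.
  apply/seteqP; split => x /=; rewrite frac_arc// -/(g x) -/k; lra.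
apply: (approximable_superlevel mO Ooo L0 LD).
  have := trigpolyM LD (trigpoly_cst L0 (4^-1)%:C)
    (trigpolyD (trigpoly_cos ((t1 + t2) / 2) Ld) (trigpoly_cst L0 (2 - k)%:C)).
  congr trigpoly; apply/funext => x; rewrite -/(g x) -rmorphD -rmorphM; congr (_%:C).
  by ring.
move=> x; move: (g1 x) k1 => /andP[? ?] /andP[? ?]; apply/andP; split; lra.
Qed.

(** A half-open arc ending at the point [0] of the circle is a countable union of
    arcs that avoid [0]. *)
Lemma approximable_frac_ge d t : Lambda d -> aset [set x | t <= frac (dot d x)].
Proof.
move=> Ld; have [t0|t0] := leP t 0.
  rewrite (_ : [set x | _] = ~` set0).
    exact/(approximable_setC mO L0 LD)/approximable_set0.
  by rewrite setC0; apply/seteqP; split => x //= _; apply: le_trans t0 (frac_ge0 _).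
have [t1|t1] := ltP t 1; last first.
  rewrite (_ : [set x | _] = set0); first exact: approximable_set0.
  apply/seteqP; split => x //= h; have := frac_lt1 (dot d x).
  by rewrite ltNge (le_trans t1 h).
pose u n : R := Num.max t (1 - n.+1%:R^-1).
rewrite (_ : [set x | _] = \bigcup_n [set x : pl | t <= frac (dot d x) <= u n]).
  apply: (approximable_bigcup mO Ooo L0 LD) => n; apply: approximable_arc => //.
  - by rewrite le_max lexx.
  - by rewrite gt_max t1/= ltrBlDr ltrDl invr_gt0.
apply/seteqP; split => x /=; last by move=> [n _ /= /andP[]].
move=> tx; have f1 := frac_lt1 (dot d x).
have f0 : 0 < 1 - frac (dot d x) by rewrite subr_gt0.
exists (Num.truncn (1 - frac (dot d x))^-1) => //=; rewrite tx /= le_max; apply/orP; right.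
have := truncnS_gt (1 - frac (dot d x))^-1; set N := (Num.truncn _).+1 => h.
have N0 : 0 < N%:R :> R by rewrite ltr0n.
have : N%:R^-1 < 1 - frac (dot d x) by rewrite -[ltRHS]invrK ltf_pV2 ?posrE ?invr_gt0.
by lra.
Qed.

Lemma approximable_frac_preimage d (A : set mR) : Lambda d -> measurable A ->
  aset [set x | A (frac (dot d x))].
Proof.
move=> Ld; suff : (@measurable _ mR) `<=`
    [set B | aset ((fun x : pl => frac (dot d x)) @^-1` B)] by apply.
rewrite (RGenCInfty.measurableE R); apply: smallest_sub.
  exact: (sigma_algebra_approximable mO Ooo L0 LD).
move=> _ [t ->] /=; rewrite (_ : _ @^-1` _ = [set x | t <= frac (dot d x)]).
  exact: approximable_frac_ge.
by apply/seteqP; split => x /=; rewrite in_itv/= andbT.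
Qed.

Lemma approximable_frac2_preimage d1 d2 (A : set pl) : Lambda d1 -> Lambda d2 ->
  measurable A -> aset [set x | A (frac (dot d1 x), frac (dot d2 x))].
Proof.
move=> Ld1 Ld2; suff : (@measurable _ pl) `<=`
    [set B | aset ((fun x : pl => (frac (dot d1 x), frac (dot d2 x))) @^-1` B)] by apply.
rewrite measurable_prod_measurableType; apply: smallest_sub.
  exact: (sigma_algebra_approximable mO Ooo L0 LD).
move=> _ [A1 mA1 [A2 mA2 <-]] /=.
have := approximable_setI mO LD (approximable_frac_preimage Ld1 mA1)
  (approximable_frac_preimage Ld2 mA2).
by [].
Qed.

Variables (u v d1 d2 : R * R).
Hypotheses (Ld1 : Lambda d1) (Ld2 : Lambda d2) (uv0 : wedge u v != 0).
(* [d1], [d2] is the basis dual to [u], [v] *)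
Hypotheses (d1u : dot d1 u = 1) (d1v : dot d1 v = 0).
Hypotheses (d2u : dot d2 u = 0) (d2v : dot d2 v = 1).

Definition lattice_shift (k : int * int) (x : R * R) : R * R :=
  frame x u v (k.1%:~R, k.2%:~R).

Variable core : set (R * R).
Hypothesis mcore : measurable (core : set pl).
Hypothesis core_null : leb2 R (Omega `\` core) = 0%E.
Hypothesis packing : forall k x, core x -> core (lattice_shift k x) -> lattice_shift k x = x.

(** The translates of [B] along the lattice spanned by [u] and [v] form a periodic
    Borel set [B'], which by packing meets [core] in [B] only. A periodic set is a
    preimage under the fractional parts of [dot d1] and [dot d2]. *)
Lemma approximable_measurable (B : set pl) : measurable B -> approx (cindic B).
Proof.
move=> mB; pose B0 := B `&` core.
pose B' := \bigcup_(k in [set: int * int]) (lattice_shift k @^-1` B0).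
have mB0 : measurable (B0 : set pl) by exact: measurableI.
have mshift k : measurable_fun setT (lattice_shift k : pl -> pl).
  have := @measurable_affine R 1 0 0 1 (k.1%:~R * u.1 + k.2%:~R * v.1) (k.1%:~R * u.2 + k.2%:~R * v.2).
  congr measurable_fun; apply/funext => x; rewrite /affine /lattice_shift /frame /affine /=.
  by congr (_, _); ring.
have mB' : measurable (B' : set pl).
  apply: countable_bigcupT_measurable => [|k]; first exact: countableP.
  by rewrite -[X in measurable X]setTI; exact: mshift.
(* [B'] is the preimage of a Borel set of the fundamental parallelogram *)
pose C := frame 0 u v @^-1` B'.
have mC : measurable (C : set pl).
  by rewrite -[X in measurable X]setTI; apply: (@measurable_frame R 0 u v) => //.
have B'E : B' = [set x | C (frac (dot d1 x), frac (dot d2 x))].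
  have shift_frac x : lattice_shift (Num.floor (dot d1 x), Num.floor (dot d2 x))
      (frame 0 u v (frac (dot d1 x), frac (dot d2 x))) = x.
    rewrite [RHS](_ : x = frame 0 u v (dot d1 x, dot d2 x)).
      by rewrite /lattice_shift /frac /frame /affine /=; congr (_, _); ring.
    rewrite -[x in LHS](coordK 0 x uv0); congr (frame _ _ _ _).
    set w := frame_coord 0 u v x; rewrite -(coordK 0 x uv0) -/w !dot_frame d1u d1v d2u d2v.
    have dot0 d : dot d (0 : R * R) = 0 by rewrite /dot /= !mulr0 addr0.
    by rewrite !dot0 !mulr1 !mulr0 !add0r addr0; case: w.
  have shift_shift k l x : lattice_shift k (lattice_shift l x) = lattice_shift (k.1 + l.1, k.2 + l.2) x.
    by rewrite /lattice_shift /frame /affine /= !intrD; congr (_, _); ring.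
  apply/seteqP; split => x.
  - move=> [k _ Bk]; rewrite /C /=.
    exists (k.1 + Num.floor (dot d1 x), k.2 + Num.floor (dot d2 x)) => //.
    by rewrite /preimage /mkset -(shift_shift k (_, _)) shift_frac.
  - rewrite /C /= => -[k _ Bk].
    exists (k.1 - Num.floor (dot d1 x), k.2 - Num.floor (dot d2 x)) => //.
    rewrite /preimage /mkset -[x in lattice_shift _ x]shift_frac shift_shift /= !subrK.
    by case: k Bk.
have [_ aB'] := approximable_frac2_preimage Ld1 Ld2 mC.
rewrite -B'E in aB'.
apply: (@approximable_null _ _ mO Lambda _ _ (Omega `\` core) _ core_null
  (cmeasurable_cindic mB) (cmeasurable_cindic mB') _ aB'); first exact: measurableD.
move=> x Ox nN; have cx : core x by apply: contrapT => ncx; apply: nN.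
rewrite /cindic !indicE; congr (nat_of_bool _)%:R%:C.
have shift0 : lattice_shift (0, 0) x = x.
  by case: (x) => ? ?; rewrite /lattice_shift /frame /affine /= !mulr0z !mulr0 !add0r.
apply/idP/idP; rewrite !inE; last by move=> [k _ [Bk ck]]; rewrite -(packing cx ck).
by move=> Bx; exists (0, 0) => //; rewrite /preimage /mkset shift0; split.
Qed.

Lemma cmeasurable_sum (I : Type) (r : seq I) (F : I -> pl -> R[i]) :
  (forall i, cmeasurable (F i)) -> cmeasurable (fun x => \sum_(i <- r) F i x).
Proof.
move=> mF; elim: r => [|i r ih].
  by have := cmeasurable_cst (0 : R[i]); congr cmeasurable; apply/funext => x; rewrite big_nil.
by have := cmeasurableD (mF i) ih; congr cmeasurable; apply/funext => x; rewrite big_cons.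
Qed.

Lemma approximable_sum (I : Type) (r : seq I) (F : I -> pl -> R[i]) :
  (forall i, cmeasurable (F i)) -> (forall i, approx (F i)) ->
  approx (fun x => \sum_(i <- r) F i x).
Proof.
move=> mF aF; elim: r => [|i r ih].
  have := approximable_trigpoly Omega (trigpoly0 Lambda); congr approximable.
  by apply/funext => x; rewrite big_nil.
have := approximableD mO (mF i) (cmeasurable_sum r mF) (aF i) ih.
by congr approximable; apply/funext => x; rewrite big_cons.
Qed.

Import HBNNSimple.

Lemma approximable_nnsfun (h : {nnsfun pl >-> R}) : approx (fun x => (h x)%:C).
Proof.
have mh y : measurable (h @^-1` [set y] : set pl).
  by rewrite -[X in measurable X]setTI; apply: measurable_funP => //.
pose F (y : R) (x : pl) := y%:C * cindic (h @^-1` [set y]) x.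
have mF y : cmeasurable (F y).
  by apply: cmeasurableM; [exact: cmeasurable_cst|exact: cmeasurable_cindic].
have aF y : approx (F y).
  apply: (approximableZ mO L0 LD); first exact: cmeasurable_cindic.
  exact: approximable_measurable.
have := approximable_sum (finmap.enum_fset (fset_set (range h))) mF aF; congr approximable; apply/funext => x.
rewrite fimfunE fsbig_finite//= rmorph_sum; apply: eq_bigr => y _.
by rewrite rmorphM.
Qed.

(** Simple functions increase to [g], so [g ^ 2] dominates the squared errors. *)
Lemma approximable_ge0 (g : pl -> R) : measurable_fun setT g -> (forall x, 0 <= g x) ->
  (leb2 R).-integrable Omega (EFin \o (fun x => g x ^+ 2)) -> approx (fun x => (g x)%:C).
Proof.
move=> mg g0 ig.
have mEg : measurable_fun setT (EFin \o g) by exact/measurable_EFinP.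
pose h n := nnsfun_approx measurableT mEg n.
have hg n x : h n x <= g x.
  by rewrite /h nnsfun_approxE -lee_fin; apply: le_approx => // y _; rewrite lee_fin.
have hcv x : h n x @[n --> \oo] --> g x.
  have := @cvg_nnsfun_approx _ _ _ _ measurableT _ mEg (fun y _ => _) x I.
  move=> H; have /fine_cvgP[_] : (h n x)%:E @[n --> \oo] --> (g x)%:E.
    by apply: H => y; rewrite lee_fin.
  by [].
have mh n : measurable_fun setT (h n : pl -> R) by exact: measurable_funP.
apply: (@approximable_cvg _ _ mO Lambda (fun n x => (h n x)%:C) _ (fun x => g x ^+ 2)).
- by move=> n; exact: cmeasurable_real.
- exact: cmeasurable_real.
- by move=> n; exact: approximable_nnsfun.
- move=> x _; rewrite (_ : (fun n => _) = (fun n => (g x - h n x) * (g x - h n x))); last first.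
    by apply/funext => n; rewrite -rmorphB sqmodR.
  have -> : (0 : R) = (g x - g x) * (g x - g x) by rewrite subrr mul0r.
  have H : (g x - h n x : R) @[n --> \oo] --> (g x - g x : R).
    by apply: cvgB; [exact: cvg_cst|exact: hcv].
  by apply: cvgM; exact: H.
- exact: ig.
- move=> n x _; rewrite -rmorphB sqmodR; apply: lerXn2r; rewrite ?nnegrE ?subr_ge0//.
  by rewrite lerBlDr lerDl.
Qed.

Lemma approximable_square_integrable (g : pl -> R) : measurable_fun setT g ->
  (leb2 R).-integrable Omega (EFin \o (fun x => g x ^+ 2)) -> approx (fun x => (g x)%:C).
Proof.
move=> mg ig.
have split_part (f : pl -> R) : measurable_fun setT f ->
    (leb2 R).-integrable Omega (EFin \o (fun x => f x ^+ 2)) ->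
    measurable_fun setT (fun x : pl => Num.max (f x) 0) /\
    approx (fun x => (Num.max (f x) 0)%:C).
  move=> mf jf; have mmax : measurable_fun setT (fun x : pl => Num.max (f x) 0).
    by apply: measurable_maxr.
  split => //; apply: approximable_ge0 => //.
    by move=> x; rewrite le_max lexx orbT.
  apply: le_integrable jf => //.
    apply/measurable_EFinP; apply: measurable_funTS; exact: measurable_funX.
  move=> x _; rewrite lee_fin !ger0_norm ?sqr_ge0//.
  by case: (leP (f x) 0) => // _; rewrite expr0n sqr_ge0.
have [m1 a1] := split_part g mg ig.
have mNg : measurable_fun setT (fun x : pl => - g x) by exact: measurable_funN.
have [] := split_part _ mNg.
  by move: ig; congr integrable; apply/funext => x /=; rewrite sqrrN.
move=> m2 a2.
have := approximableD mO (cmeasurable_real m1)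
  (cmeasurableM (cmeasurable_cst (-1)) (cmeasurable_real m2)) a1
  (approximableZ mO L0 LD (-1) (cmeasurable_real m2) a2).
congr approximable; apply/funext => x; rewrite mulN1r -rmorphB; congr (_%:C).
by case: (leP (g x) 0) => gx; case: (leP (- g x) 0) => gx'; lra.
Qed.

(** Passing to real and imaginary parts, then to positive and negative parts,
    reduces the claim to nonnegative functions. *)
Theorem complete_exp_of_packing : complete_exp Omega Lambda.
Proof.
move=> f [mRe mIm foo] e e0.
pose fr := (fun x : pl => complex.Re (f x)) \_ Omega.
pose fi := (fun x : pl => complex.Im (f x)) \_ Omega.
have mfr : measurable_fun setT fr by exact/(measurable_restrictT _ mO).
have mfi : measurable_fun setT fi by exact/(measurable_restrictT _ mO).
have int2 (k : pl -> R) : measurable_fun setT k ->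
    (forall x, Omega x -> k x ^+ 2 <= complex.Re (f x) ^+ 2 + complex.Im (f x) ^+ 2) ->
    (leb2 R).-integrable Omega (EFin \o (fun x => k x ^+ 2)).
  move=> mk kf; apply/integrableP; split.
    by apply/measurable_EFinP; apply: measurable_funTS; exact: measurable_funX.
  apply: le_lt_trans foo; apply: (ge0_le_integral _ mO).
  - by [].
  - apply: measurableT_comp => //.
    by apply/measurable_EFinP; apply: measurable_funTS; exact: measurable_funX.
  - apply/measurable_EFinP; apply: measurable_funD; apply: measurable_funX; [exact: mRe|exact: mIm].
  - by move=> x Ox; rewrite /= lee_fin ger0_norm ?sqr_ge0// kf.
have ir : (leb2 R).-integrable Omega (EFin \o (fun x => fr x ^+ 2)).
  by apply: int2 => // x Ox; rewrite /fr patchE mem_set// lerDl sqr_ge0.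
have ii : (leb2 R).-integrable Omega (EFin \o (fun x => fi x ^+ 2)).
  by apply: int2 => // x Ox; rewrite /fi patchE mem_set// lerDr sqr_ge0.
have m1 := cmeasurable_real mfr; have m2 := cmeasurable_real mfi.
have := approximableD mO m1 (cmeasurableM (cmeasurable_cst (0 +i* 1)) m2)
  (approximable_square_integrable mfr ir)
  (approximableZ mO L0 LD (0 +i* 1) m2 (approximable_square_integrable mfi ii)).
move=> /(_ (e ^+ 2)); rewrite exprn_gt0// => /(_ isT) [p [/trigpoly_sum [s [c [sL pE]]] lt_e]].
exists s, c; split => //; apply: le_lt_trans lt_e.
rewrite le_eqVlt; apply/orP; left; apply/eqP; apply: eq_sqnormL2 => x Ox.
rewrite -pE; congr (_ - _); rewrite /fr /fi !patchE !mem_set//.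
by case: (f x) => a b; apply/eqP; rewrite eq_complex /=; apply/andP; split; apply/eqP; ring.
Qed.

End lattice_completeness.

(** * The dual lattice is a spectrum *)

Section hexagon_dual_lattice.
Context {R : realType}.
Notation mR := (measurableTypeR R).
Notation pl := (mR * mR)%type.
Notation la := (@lebesgue_measure R).
Implicit Types (o u v a c z x : R * R) (P Q : R).

Lemma measurable_line o u v (s : R) :
  measurable (frame_coord o u v @^-1` ([set s] `*` setT) : set pl).
Proof. by apply: measurable_coord_preimage; apply: measurableX. Qed.

Lemma leb2_line o u v (s : R) : wedge u v != 0 ->
  leb2 R (frame_coord o u v @^-1` ([set s] `*` setT)) = 0%E.
Proof.
move=> w0; have ms : measurable ([set s] : set mR) by exact: measurable_set1.
have mT : measurable ([set: mR]) by [].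
rewrite leb2_coord_preimage//; last exact: measurableX.
rewrite [X in (_ * X)%E](_ : _ = 0%E) ?mule0//.
by rewrite [LHS](product_measure1E _ _ ms mT) [X in (X * _)%E]lebesgue_measure_set1 mul0e.
Qed.

(** The interior of the hexagon. Removing the edges makes the packing strict. *)
Definition hexagon_core o a c P Q : set (R * R) := frame_coord o a c @^-1`
  [set z | [/\ 0 < z.1 < 1 + P, 0 < z.2 < 1 + Q & - Q < P * z.2 - Q * z.1 < P]].

Lemma measurable_hexagon_core o a c P Q : measurable (hexagon_core o a c P Q : set pl).
Proof.
apply: measurable_coord_preimage.
rewrite (_ : [set z | _] = (`]0, 1 + P[ `*` `]0, 1 + Q[)%classic `&`
    ((fun z : pl => P * z.2 - Q * z.1 : mR) @^-1` `]- Q, P[%classic)).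
  apply: measurableI.
  - by apply: measurableX; exact: measurable_itv.
  - by rewrite -[X in measurable X]setTI; apply: measurable_linear_form.
apply/seteqP; split => z /=; rewrite !in_itv/=; first by case.
by case=> -[].
Qed.

Lemma leb2_hexagon_boundary o a c P Q : wedge a c != 0 -> 0 < P -> 0 < Q ->
  leb2 R (hexagon o a c P Q `\` hexagon_core o a c P Q) = 0%E.
Proof.
move=> w0 P0 Q0; have Pn := lt0r_neq0 P0; have Qn := lt0r_neq0 Q0.
have w0' := wedgeC_neq0 w0.
have wb : wedge a (third_edge a c P Q) != 0 by rewrite wedge_third_edger mulf_neq0.
pose line u v s : set pl := frame_coord o u v @^-1` ([set s] `*` setT).
pose b := third_edge a c P Q.
pose L := line a c 0 `|` line a c (1 + P) `|` line c a 0 `|` line c a (1 + Q)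
  `|` line a b 1 `|` line a b (- (P / Q)).
have nline u v s : wedge u v != 0 -> (leb2 R).-negligible (line u v s).
  by move=> uv0; apply/negligibleP; [exact: measurable_line|exact: leb2_line].
have NL : (leb2 R).-negligible L.
  by do 5 (apply: negligibleU; last exact: nline); exact: nline.
apply/negligibleP.
  by apply: measurableD; [exact: measurable_hexagon|exact: measurable_hexagon_core].
apply: negligibleS NL => z.
have lineE u v s : line u v s z = ((frame_coord o u v z).1 = s /\ True) by [].
have sw := frame_coordC o z w0.
have bE : frame_coord o a b z =
    ((frame_coord o a c z).1 - P / Q * (frame_coord o a c z).2, (frame_coord o a c z).2 / Q).
  apply: coord_eq => //; rewrite -[z in LHS](coordK o z w0).
  case: (frame_coord o a c z) => s t; rewrite /frame /affine /b /third_edge /=.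
  by congr (_, _); field.
rewrite /hexagon /hexagon_core /L /setD /setU /preimage /mkset !lineE sw bE.
case: (frame_coord o a c z) => s t /= [[/andP[s0 s1] /andP[t0 t1] /andP[h0 h1]] ncore].
have [->|s0'] := eqVneq s 0; first by left; left; left; left; left.
have [->|s1'] := eqVneq s (1 + P); first by left; left; left; left; right.
have [->|t0'] := eqVneq t 0; first by left; left; left; right.
have [->|t1'] := eqVneq t (1 + Q); first by left; left; right.
have [h|h0'] := eqVneq (P * t - Q * s) (- Q).
  left; right; split => //=; transitivity (- (P * t - Q * s) / Q); first by field.
  by rewrite h; field.
have [h|h1'] := eqVneq (P * t - Q * s) P.
  right; split => //=; transitivity (- (P * t - Q * s) / Q); first by field.
  by rewrite h; field.
exfalso; apply: ncore; rewrite !lt_neqAle s0 s1 t0 t1 h0 h1 !andbT.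
by rewrite ![0 == _]eq_sym [- Q == _]eq_sym s0' s1' t0' t1' h0' h1'.
Qed.

Lemma lattice_shift_coord o a c P Q k z : wedge a c != 0 ->
  let b := third_edge a c P Q in
  frame_coord o a c (lattice_shift (a + b) (b + c) k z) =
  ((frame_coord o a c z).1 + (k.1%:~R * (1 + P) + k.2%:~R * P),
   (frame_coord o a c z).2 + (k.1%:~R * Q + k.2%:~R * (1 + Q))).
Proof.
move=> w0 b; apply: coord_eq => //; rewrite -[z in LHS](coordK o z w0).
case: (frame_coord o a c z) => s t.
rewrite /lattice_shift /b /third_edge /frame /affine /=; congr (_, _); ring.
Qed.

(** In the coordinates along [a] and [c], and in the third linear form that bounds
    the hexagon, the shift by [k (a + b) + l (b + c)] must be smaller than
    [1 + P], [1 + Q] and [P + Q] respectively. The first two exclude nonzero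
    [k], [l] of the same sign, the third one those of opposite signs. *)
Lemma hexagon_core_packing o a c P Q k z : wedge a c != 0 -> 0 < P -> 0 < Q ->
  let b := third_edge a c P Q in
  hexagon_core o a c P Q z ->
  hexagon_core o a c P Q (lattice_shift (a + b) (b + c) k z) ->
  lattice_shift (a + b) (b + c) k z = z.
Proof.
move=> w0 P0 Q0 b; rewrite /hexagon_core /preimage /mkset lattice_shift_coord//.
case: (frame_coord o a c z) => s t /= [/andP[s0 s1] /andP[t0 t1] /andP[h0 h1]].
case: k => k l /= [/andP[s0' s1'] /andP[t0' t1'] /andP[h0' h1']].
have trichotomy (n : int) : [\/
   [/\ n = 0, n%:~R = 0 :> R, n%:~R * P = 0 & n%:~R * Q = 0],
   [/\ 1 <= n%:~R :> R, P <= n%:~R * P & Q <= n%:~R * Q] |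
   [/\ n%:~R <= -1 :> R, n%:~R * P <= - P & n%:~R * Q <= - Q]].
  have [n0|n0|->] := ltgtP n 0; last by constructor 1; rewrite mulr0z !mul0r.
    have n1 : n%:~R <= -1 :> R by rewrite -[-1]/((-1)%:~R) ler_int -ltzD1 addNr.
    by constructor 3; split => //; rewrite -mulN1r ler_pM2r.
  have n1 : 1 <= n%:~R :> R by rewrite -[1]/(1%:~R) ler_int.
  by constructor 2; split => //; rewrite -[leLHS]mul1r ler_pM2r.
have [[k0 k1 kP kQ]|[k1 kP kQ]|[k1 kP kQ]] := trichotomy k;
  have [[l0 l1 lP lQ]|[l1 lP lQ]|[l1 lP lQ]] := trichotomy l; try (exfalso; lra).
rewrite k0 l0.
by rewrite /lattice_shift /frame /affine /=; case: (z) => z1 z2 /=; congr (_, _); ring.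
Qed.

Section spectrum.
Variables (o a c : R * R) (P Q : R).
Hypotheses (w0 : wedge a c != 0) (P0 : 0 < P) (Q0 : 0 < Q).
Local Notation L := (dual_lattice a c P Q).

Lemma dual_latticeD x y : L x -> L y -> L (x + y).
Proof.
move=> [[m mE] [n nE]] [[m' mE'] [n' nE']]; split.
  by exists (m + m'); rewrite !dotDl intrD -mE -mE'; ring.
by exists (n + n'); rewrite !dotDl intrD -nE -nE'; ring.
Qed.

Lemma dual_latticeN x : L x -> L (- x).
Proof.
move=> [[m mE] [n nE]]; split.
  by exists (- m); rewrite !dotNl intrN -mE; ring.
by exists (- n); rewrite !dotNl intrN -nE; ring.
Qed.

Lemma dual_lattice_spectrum : is_spectrum (hexagon o a c P Q) L.
Proof.
set b := third_edge a c P Q.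
have uv0 : wedge (a + b) (b + c) != 0.
  rewrite (_ : wedge _ _ = (1 + P + Q) * wedge a c); last by rewrite /wedge /b /third_edge /=; ring.
  by rewrite mulf_neq0// gt_eqF// !addr_gt0.
have [d1 [d1u d1v]] := exists_dots 1 0 uv0.
have [d2 [d2u d2v]] := exists_dots 0 1 uv0.
have LE x : L x <-> (exists m : int, dot x (a + b) = m%:~R) /\
    (exists m : int, dot x (b + c) = m%:~R) by rewrite !dotDr.
split.
- pose f (k : int * int) : R * R := lattice_shift d1 d2 k 0.
  apply: (@sub_countable _ _ _ (f @` [set: int * int])); last first.
    by apply: sub_countable (countableP [set: int * int]); exact: card_image_le.
  apply: subset_card_le => x /LE[[m mE] [n nE]]; exists (m, n) => //.
  have dE y : dot (f (m, n) - x) y = m%:~R * dot d1 y + n%:~R * dot d2 y - dot x y.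
    by rewrite /f /lattice_shift /frame /affine /dot /=; ring.
  apply/eqP; rewrite -subr_eq0; apply/eqP; apply: (dot_eq0 uv0); rewrite dE.
    by rewrite d1u d2u mE; ring.
  by rewrite d1v d2v nE; ring.
- move=> l m Ll Lm lm; rewrite -[LHS]/(inner _ _ _ _) inner_hexagon_ft.
  apply: (hexagon_ft_dual_lattice o w0 P0 Q0); last by rewrite subr_eq0.
  by apply: dual_latticeD => //; exact: dual_latticeN.
- apply: (@complete_exp_of_packing _ _ _ _ _ _ _ _ (a + b) (b + c) d1 d2 _ _ _ _ _ _ _ (hexagon_core o a c P Q)) => //.
  + exact: measurable_hexagon.
  + exact: leb2_hexagon.
  + by apply/LE; split; exists 0; rewrite /dot /=; ring.
  + exact: dual_latticeD.
  + exact: dual_latticeN.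
  + by apply/LE; rewrite d1u d1v; split; [exists 1|exists 0].
  + by apply/LE; rewrite d2u d2v; split; [exists 0|exists 1].
  + exact: measurable_hexagon_core.
  + exact: leb2_hexagon_boundary.
  + by move=> k x; exact: hexagon_core_packing.
Qed.
End spectrum.
End hexagon_dual_lattice.

(** * Convex hulls and extreme points *)

Section convex_geometry.
Context {R : realType}.
Implicit Types (S : set (R * R)) (p q u v w x y z : R * R) (s t : R).

Definition mix t x y : R * R := (t * x.1 + (1 - t) * y.1, t * x.2 + (1 - t) * y.2).

Lemma convex_setP S : convex_set (S : set (convex_lmodType (R * R)%type)) <->
  (forall t x y, 0 <= t -> t <= 1 -> S x -> S y -> S (mix t x y)).
Proof.
split=> [cS t x y t0 t1 Sx Sy|cS x y l]; last first.
  rewrite !inE => Sx Sy; have := cS l%:num x y; rewrite ge0 le1 => /(_ isT isT Sx Sy).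
  by congr S.
have := cS x y (Itv01 t0 t1); rewrite !inE => /(_ Sx Sy).
by congr S.
Qed.

Lemma sub_convex_hull S : S `<=` convex_hull S.
Proof. exact: sub_gen_smallest. Qed.

Lemma convex_hull_sub S (C : set (R * R)) :
  (forall t x y, 0 <= t -> t <= 1 -> C x -> C y -> C (mix t x y)) ->
  S `<=` C -> convex_hull S `<=` C.
Proof. by move=> /convex_setP cC; exact: smallest_sub. Qed.

Lemma convex_hull_mix S t x y : 0 <= t -> t <= 1 ->
  convex_hull S x -> convex_hull S y -> convex_hull S (mix t x y).
Proof.
move=> t0 t1 Sx Sy C [cC SC].
by apply: (proj1 (convex_setP C) cC) => //; [exact: (Sx C)|exact: (Sy C)].
Qed.

Lemma convex_hull_mono S S' : S `<=` S' -> convex_hull S `<=` convex_hull S'.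
Proof.
move=> SS'; apply: convex_hull_sub => [t x y t0 t1|x /SS']; last exact: sub_convex_hull.
exact: convex_hull_mix.
Qed.

(** The segments joining [p] to the hull of [S] already form a convex set. The
    point [q] serves as an end for the degenerate segment reduced to [p]. *)
Lemma convex_hull_adjoin S p q : S q ->
  convex_hull (p |` S) `<=`
  [set x | exists t w, [/\ 0 <= t, t <= 1, convex_hull S w & x = mix t p w]].
Proof.
move=> Sq; apply: convex_hull_sub; last first.
  move=> x [->|Sx].
    exists 1, q; split => //; first exact: sub_convex_hull.
    by rewrite /mix [LHS]surjective_pairing; congr (_, _); ring.
  exists 0, x; split => //; first exact: sub_convex_hull.
  by rewrite /mix [LHS]surjective_pairing; congr (_, _); ring.
move=> k x y k0 k1 [t [w [t0 t1 hw ->]]] [t' [w' [t0' t1' hw' ->]]].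
pose T := k * (1 - t) + (1 - k) * (1 - t').
have A0 : 0 <= k * (1 - t) by rewrite mulr_ge0// subr_ge0.
have B0 : 0 <= (1 - k) * (1 - t') by rewrite mulr_ge0// subr_ge0.
have C0 : 0 <= k * t by rewrite mulr_ge0.
have D0 : 0 <= (1 - k) * t' by rewrite mulr_ge0// subr_ge0.
have T0 : 0 <= T by rewrite addr_ge0.
have T1 : T <= 1 by rewrite /T; lra.
have [T00|Tn0] := eqVneq T 0.
  have A00 : k * (1 - t) = 0 by apply/eqP; rewrite eq_le A0 andbT -T00 lerDl.
  have B00 : (1 - k) * (1 - t') = 0 by apply/eqP; rewrite eq_le B0 andbT -T00 lerDr.
  exists 1, q; split => //; first exact: sub_convex_hull.
  have kt : k * t = k by move: A00; rewrite mulrBr mulr1; lra.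
  have kt' : (1 - k) * t' = 1 - k by move: B00; rewrite mulrBr mulr1; lra.
  by rewrite /mix /= !mulrDr !mulrA A00 B00 kt kt'; congr (_, _); ring.
exists (1 - T), (mix (k * (1 - t) / T) w w'); split.
- by rewrite subr_ge0.
- by rewrite gerBl.
- apply: convex_hull_mix => //; first by rewrite divr_ge0.
  by rewrite ler_pdivrMr ?mul1r ?lt_neqAle ?[0 == _]eq_sym ?Tn0 ?T0// /T lerDl.
- have E (g h e : R) : k * (t * g + (1 - t) * h) + (1 - k) * (t' * g + (1 - t') * e) =
     (1 - T) * g + (1 - (1 - T)) *
       (k * (1 - t) / T * h + (1 - k * (1 - t) / T) * e).
    transitivity ((1 - T) * g + (k * (1 - t) * h + (T - k * (1 - t)) * e)).
      rewrite /T; ring.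
    by field.
  by rewrite /mix /= !E.
Qed.

Definition extreme S x := S x /\ forall t y z, 0 < t -> t < 1 -> S y -> S z ->
  x = mix t y z -> y = x /\ z = x.

(** If [p] lies inside a segment whose ends are written as combinations of [p]
    and of points of the hull of [S], solving for [p] puts it in that hull,
    unless both combinations are [p] itself. *)
Lemma extreme_adjoin S p q : S q -> ~ convex_hull S p ->
  extreme (convex_hull (p |` S)) p.
Proof.
move=> Sq Sp; split; first by apply: sub_convex_hull; left.
move=> k y z k0 k1 /(convex_hull_adjoin Sq)[t [w [t0 t1 hw ->]]].
move=> /(convex_hull_adjoin Sq)[t' [w' [t0' t1' hw' ->]]].
pose T := k * (1 - t) + (1 - k) * (1 - t').
have A0 : 0 <= k * (1 - t) by rewrite mulr_ge0 ?subr_ge0// ltW.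
have B0 : 0 <= (1 - k) * (1 - t') by rewrite mulr_ge0 ?subr_ge0// ltW.
have T0 : 0 <= T by rewrite addr_ge0.
rewrite {1}[p]surjective_pairing /mix /= => -[E1 E2].
have [T00|Tn0] := eqVneq T 0; last first.
  exfalso; apply: Sp.
  rewrite (_ : p = mix (k * (1 - t) / T) w w'); last first.
    have E (g h e : R) : g = k * (t * g + (1 - t) * h) + (1 - k) * (t' * g + (1 - t') * e) ->
       g = k * (1 - t) / T * h + (1 - k * (1 - t) / T) * e.
      move=> H; apply: (mulfI Tn0).
      transitivity (k * (1 - t) * h + (T - k * (1 - t)) * e); last by field.
      have -> : T * g = g - (1 - T) * g by ring.
      by rewrite {1}H /T; ring.
    by rewrite [LHS]surjective_pairing /mix -(E _ _ _ E1) -(E _ _ _ E2).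
  apply: convex_hull_mix => //; first by rewrite divr_ge0.
  by rewrite ler_pdivrMr ?mul1r ?lt_neqAle ?[0 == _]eq_sym ?Tn0 ?T0// /T lerDl.
have A00 : k * (1 - t) = 0 by apply/eqP; rewrite eq_le A0 andbT -T00 lerDl.
have B00 : (1 - k) * (1 - t') = 0 by apply/eqP; rewrite eq_le B0 andbT -T00 lerDr.
have {A00}t1E : t = 1.
  by move/eqP: A00; rewrite mulf_eq0 gt_eqF//= subr_eq0 => /eqP.
have {B00}t1E' : t' = 1.
  by move/eqP: B00; rewrite mulf_eq0 !subr_eq0 gt_eqF//= => /eqP.
by rewrite t1E t1E' !subrr !mul0r !addr0 !mul1r -surjective_pairing.
Qed.

(** Removing an extreme point from the hull leaves a convex set. *)
Lemma extreme_convex_hull S x : extreme (convex_hull S) x -> S x.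
Proof.
move=> [hx ex]; apply: contrapT => nSx.
suff: (convex_hull S `\ x) x by case=> _; apply.
apply: (convex_hull_sub (C := convex_hull S `\ x) (S := S)) => //; last first.
  by move=> y Sy; split; [exact: sub_convex_hull|move=> /= yx; apply: nSx; rewrite -yx].
move=> t y z t0 t1 [hy yx] [hz zx]; split; first exact: convex_hull_mix.
have [t00|tn0] := eqVneq t 0.
  by rewrite t00 /mix !mul0r !add0r subr0 !mul1r -surjective_pairing.
have [t11|tn1] := eqVneq t 1.
  by rewrite t11 /mix subrr !mul0r !addr0 !mul1r -surjective_pairing.
move=> /esym xE; apply: yx.
have t0' : 0 < t by rewrite lt_neqAle eq_sym tn0.
have t1' : t < 1 by rewrite lt_neqAle tn1.
by have [] := ex t y z t0' t1' hy hz xE.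
Qed.

Lemma extreme_reflect S p x : (forall y, S y -> S (p + p - y)) ->
  extreme S x -> extreme S (p + p - x).
Proof.
move=> Sp [Sx ex]; split; first exact: Sp.
move=> t y z t0 t1 Sy Sz xE.
have [|h1 h2] := ex t (p + p - y) (p + p - z) t0 t1 (Sp _ Sy) (Sp _ Sz).
  rewrite -[LHS](subKr (p + p)) xE; case: (p) (y) (z) => p1 p2 [y1 y2] [z1 z2].
  by rewrite /mix /=; congr (_, _) => /=; ring.
by rewrite -{1}h1 -h2 !subKr.
Qed.
End convex_geometry.

(** * The hexagon as a convex hull *)

Section hexagon_hull.
Context {R : realType}.
Implicit Types (S C : set (R * R)) (o a c p q u v w x y z : R * R) (P Q s t : R).

Definition hexagon_vertices o a c P Q : set (R * R) :=
  let b := third_edge a c P Q in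
  [set x | [\/ x = o, x = o + a | x = o + c] \/
           [\/ x = o + a + b, x = o + c + b | x = o + a + b + c]].

Lemma convex_parallelogram C o u v z : wedge u v != 0 ->
  (forall t x y, 0 <= t -> t <= 1 -> C x -> C y -> C (mix t x y)) ->
  C o -> C (o + u) -> C (o + v) -> C (o + u + v) ->
  0 <= (frame_coord o u v z).1 <= 1 -> 0 <= (frame_coord o u v z).2 <= 1 -> C z.
Proof.
move=> w0 cC C0 Cu Cv Cuv; move: (coordK o z w0).
case: (frame_coord o u v z) => s t <- /= /andP[s0 s1] /andP[t0 t1].
have := cC t _ _ t0 t1 (cC s _ _ s0 s1 Cuv Cv) (cC s _ _ s0 s1 Cu C0).
by congr C; rewrite /frame /affine /mix /=; congr (_, _); ring.
Qed.

(** Each of the three parallelograms tiling the hexagon has its corners in the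
    hull: they are vertices of the hexagon, or the common corner [o + a + c],
    which is an average of the vertices [o + a], [o + c] and [o + a + b + c]. *)
Lemma convex_hull_hexagon o a c P Q : wedge a c != 0 -> 0 < P -> 0 < Q ->
  convex_hull (hexagon_vertices o a c P Q) = hexagon o a c P Q.
Proof.
move=> w0 P0 Q0; set b := third_edge a c P Q.
have Pn := lt0r_neq0 P0; have Qn := lt0r_neq0 Q0.
have frameE z : forall x, x = frame o a c z -> hexbox P Q z -> hexagon o a c P Q x.
  by move=> x -> ?; rewrite /hexagon /preimage /mkset frameK.
apply/seteqP; split.
- apply: convex_hull_sub => [t x y t0 t1|x].
    rewrite /hexagon /preimage /mkset.
    have -> : frame_coord o a c (mix t x y) =
        mix t (frame_coord o a c x) (frame_coord o a c y).
      apply: coord_eq => //; rewrite -[in LHS](coordK o x w0) -[in LHS](coordK o y w0).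
      case: (frame_coord o a c x) (frame_coord o a c y) => x1 x2 [y1 y2].
      by rewrite /frame /affine /mix /=; congr (_, _); ring.
    case: (frame_coord o a c x) (frame_coord o a c y) => x1 x2 [y1 y2] /=.
    move=> [/andP[a1 a2] /andP[a3 a4] /andP[a5 a6]] [/andP[b1 b2] /andP[b3 b4] /andP[b5 b6]].
    have between l h (g k : R) : l <= g -> g <= h -> l <= k -> k <= h ->
        l <= t * g + (1 - t) * k <= h.
      move=> *; apply/andP; split; nra.
    split; [exact: between|exact: between|]; rewrite /mix /=.
    rewrite (_ : P * _ - _ = t * (P * x2 - Q * x1) + (1 - t) * (P * y2 - Q * y1)); last by ring.
    exact: between.
  case=> -[] ->.
  + apply: (frameE (0, 0)); first by rewrite /frame /affine; case: (o) => o1 o2 /=; congr (_, _); ring.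
    by split => /=; apply/andP; split; lra.
  + apply: (frameE (1, 0)); first by rewrite /frame /affine /=; congr (_, _); ring.
    by split => /=; apply/andP; split; lra.
  + apply: (frameE (0, 1)); first by rewrite /frame /affine /=; congr (_, _); ring.
    by split => /=; apply/andP; split; lra.
  + apply: (frameE (1 + P, Q)); first by rewrite /frame /affine /b /third_edge; congr (_, _) => /=; ring.
    by split => /=; apply/andP; split; lra.
  + apply: (frameE (P, 1 + Q)); first by rewrite /frame /affine /b /third_edge; congr (_, _) => /=; ring.
    by split => /=; apply/andP; split; lra.
  + apply: (frameE (1 + P, 1 + Q)); first by rewrite /frame /affine /b /third_edge; congr (_, _) => /=; ring.
    by split => /=; apply/andP; split; lra.
- have cC := @convex_hull_mix R (hexagon_vertices o a c P Q).
  have sC := @sub_convex_hull R (hexagon_vertices o a c P Q).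
  set C := convex_hull _ in cC sC *.
  have C0 : C o by apply: sC; left; constructor 1.
  have Ca : C (o + a) by apply: sC; left; constructor 2.
  have Cc : C (o + c) by apply: sC; left; constructor 3.
  have Cab : C (o + a + b) by apply: sC; right; constructor 1.
  have Ccb : C (o + c + b) by apply: sC; right; constructor 2.
  have Cabc : C (o + a + b + c) by apply: sC; right; constructor 3.
  have Cac : C (o + a + c).
    (* the weights are proportional to [Q], [P] and [1] *)
    have PQ0 : 0 < P + Q by exact: addr_gt0.
    have PQ1 : 0 < 1 + (P + Q) by lra.
    have t0 : 0 <= (1 + (P + Q))^-1 by rewrite invr_ge0 ltW.
    have t1 : (1 + (P + Q))^-1 <= 1 by rewrite invf_le1// lerDl ltW.
    have s0 : 0 <= P / (P + Q) by rewrite divr_ge0// ltW.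
    have s1 : P / (P + Q) <= 1 by rewrite ler_pdivrMr// mul1r lerDl ltW.
    have := cC _ _ _ t0 t1 Cabc (cC _ _ _ s0 s1 Cc Ca).
    congr C; rewrite /mix /b /third_edge /=.
    by congr (_, _); field; apply/andP; split; apply: lt0r_neq0.
  have [-> _ _] := hexagon_tiling o w0 P0 Q0.
  have wb : wedge b c != 0 by rewrite wedge_third_edgel mulf_neq0.
  have wb' : wedge a b != 0 by rewrite wedge_third_edger mulf_neq0.
  have E1 : o + c + a = o + a + c by rewrite addrAC.
  have E2 : o + c + a + b = o + a + b + c by rewrite E1 addrAC.
  move=> z [[]|] -[] /=; rewrite !in_itv => /= h1 h2.
  + by apply: (convex_parallelogram w0 cC C0 Ca Cc Cac).
  + apply: (convex_parallelogram wb cC Ca Cab Cac Cabc) => //.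
    by case/andP: h1 => /ltW -> ->.
  + apply: (convex_parallelogram wb' cC Cc); rewrite ?E2 ?E1//.
      by case/andP: h1 => -> /ltW ->.
    by case/andP: h2 => /ltW -> ->.
Qed.
End hexagon_hull.

(** * Normal form of a centrally symmetric hexagon *)

Section symmetric_hexagon.
Context {R : realType}.
Implicit Types (S Omega W : set (R * R)) (o a c p q u v w x y z : R * R) (P Q s t : R).

(** No point of [W] lies in the half of a triangle [w1], [- w1], [w2] on the side
    of [w1]; for symmetric [W] this excludes the whole triangle. *)
Definition avoids_antipodal_triangles W := forall w1 w2 u s t, W w1 -> W w2 -> W u ->
  u <> w1 -> u <> - w1 -> u <> w2 -> 0 <= s -> 0 <= t -> s + t <= 1 ->
  u <> (s * w1.1 + t * w2.1, s * w1.2 + t * w2.2).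

Lemma convex_hull_triangle S p w1 w2 s t : S (p + w1) -> S (p - w1) -> S (p + w2) ->
  0 <= s -> 0 <= t -> s + t <= 1 ->
  convex_hull S (p + (s * w1.1 + t * w2.1, s * w1.2 + t * w2.2)).
Proof.
move=> /sub_convex_hull S1 /sub_convex_hull S2 /sub_convex_hull S3 s0 t0 st.
have t1 : t <= 1 by lra.
have [t11|tn1] := eqVneq t 1.
  rewrite (_ : s = 0); last lra.
  move: S3; congr convex_hull; rewrite t11; case: (p) (w1) (w2) => p1 p2 [x1 x2] [y1 y2].
  by congr (_, _) => /=; ring.
have t1' : 0 < 1 - t by rewrite subr_gt0 lt_neqAle tn1.
pose k := s / (1 - t).
have k0 : 0 <= k by rewrite divr_ge0// ltW.
have k1 : k <= 1 by rewrite ler_pdivrMr// mul1r; lra.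
have h0 : 0 <= (1 + k) / 2 by lra.
have h1 : (1 + k) / 2 <= 1 by lra.
have := convex_hull_mix t0 t1 S3 (convex_hull_mix h0 h1 S1 S2).
congr convex_hull; rewrite /mix /k; case: (p) (w1) (w2) => p1 p2 [x1 x2] [y1 y2].
by congr (_, _) => /=; field; rewrite gt_eqF.
Qed.

Section antipodal_pairs.
Variables (W : set (R * R)).
Hypotheses (WN : forall w, W w -> W (- w)) (cW : avoids_antipodal_triangles W).

Lemma not_collinear_le1 u w l : W u -> W w -> u <> w -> u <> - w ->
  `|l| <= 1 -> u <> (l * w.1, l * w.2).
Proof.
move=> Wu Ww uw uNw l1 uE.
have [l0|l0] := leP 0 l.
  apply: (cW (s := l) (t := 0) Ww (WN Ww) Wu uw uNw uNw l0 (lexx _)).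
    by move: l1; rewrite ger0_norm// addr0.
  by rewrite uE /= !mul0r !addr0.
apply: (cW (s := - l) (t := 0) (WN Ww) Ww Wu uNw _ uw _ (lexx _)).
- by rewrite opprK.
- by rewrite oppr_ge0 ltW.
- by move: l1; rewrite ltr0_norm// addr0.
- by rewrite uE /= !mul0r !addr0 !mulrNN.
Qed.

(** Of two proportional vectors, the shorter one lies between the longer one and
    its opposite. *)
Lemma wedge_neq0 u w : W u -> W w -> u <> 0 -> w <> 0 -> u <> w -> u <> - w ->
  wedge u w != 0.
Proof.
move=> Wu Ww u0 w0 uw uNw; apply/eqP => uw0.
have [l uE] : exists l, u = (l * w.1, l * w.2).
  have n0 : w.1 ^+ 2 + w.2 ^+ 2 != 0.
    apply: contra_notN w0; rewrite paddr_eq0 ?sqr_ge0// !sqrf_eq0 => /andP[/eqP h1 /eqP h2].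
    by rewrite [w]surjective_pairing h1 h2.
  exists ((u.1 * w.1 + u.2 * w.2) / (w.1 ^+ 2 + w.2 ^+ 2)).
  move: uw0 n0; rewrite /wedge; case: (u) (w) => u1 u2 [w1 w2] /= uw0 n0.
  congr (_, _); apply: (mulIf n0); rewrite mulrAC divfK//.
    transitivity ((u1 * w1 + u2 * w2) * w1 + w2 * (u1 * w2 - u2 * w1)); first by ring.
    by rewrite uw0 mulr0 addr0.
  transitivity ((u1 * w1 + u2 * w2) * w2 - w1 * (u1 * w2 - u2 * w1)); first by ring.
  by rewrite uw0 mulr0 subr0.
have [l1|l1] := leP `|l| 1; first exact: (not_collinear_le1 Wu Ww uw uNw l1 uE).
have l0 : l != 0 by rewrite -normr_gt0; apply: lt_trans l1.
apply: (@not_collinear_le1 w u l^-1) => //.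
- by move=> h; apply: uw.
- by move=> h; apply: uNw; rewrite h opprK.
- by rewrite normfV invf_le1 ?ltW// (lt_trans _ l1).
- by rewrite uE /= !mulKf// -surjective_pairing.
Qed.

Definition antipodal_pairs u1 u2 u3 :=
  [/\ u1 <> 0, u2 <> 0 & u3 <> 0] /\
  [/\ u1 <> u2 /\ u1 <> - u2, u1 <> u3 /\ u1 <> - u3 & u2 <> u3 /\ u2 <> - u3] /\
  (forall w, W w <-> (w = u1 \/ w = - u1) \/ (w = u2 \/ w = - u2) \/ (w = u3 \/ w = - u3)).

Lemma antipodal_pairs_neg1 u1 u2 u3 :
  antipodal_pairs u1 u2 u3 -> antipodal_pairs (- u1) u2 u3.
Proof.
move=> [[n1 n2 n3] [[[n4 n5] [n6 n7] n8] WE]]; split; [split => //|split; [split => //|]].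
- by move=> h; apply: n1; rewrite -[u1]opprK h oppr0.
- by split => h; [apply: n5; rewrite -h opprK|apply: n4; exact: oppr_inj].
- by split => h; [apply: n7; rewrite -h opprK|apply: n6; exact: oppr_inj].
- by move=> w; rewrite WE opprK; tauto.
Qed.

Lemma antipodal_pairs_swap u1 u2 u3 :
  antipodal_pairs u1 u2 u3 -> antipodal_pairs u2 u1 u3.
Proof.
move=> [[n1 n2 n3] [[[n4 n5] n6 n8] WE]]; split; [split => //|split; [split => //|]].
- by split => h; [apply: n4|apply: n5; rewrite h opprK].
- by move=> w; rewrite WE; tauto.
Qed.

(** Replacing a vector by its opposite does not change its pair, which leaves the
    choice of the signs of the coefficients. *)
Lemma antipodal_pairs_positive u1 u2 u3 : antipodal_pairs u1 u2 u3 ->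
  exists v1 v2 s t, [/\ antipodal_pairs v1 v2 u3, 0 < s, 0 < t &
    u3 = (s * v1.1 + t * v2.1, s * v1.2 + t * v2.2)].
Proof.
move=> A; case: (A) => [[n1 n2 n3] [[[n4 n5] [n6 n7] [n8 n9]] WE]].
have W1 : W u1 by apply/WE; left; left.
have W2 : W u2 by apply/WE; right; left; left.
have W3 : W u3 by apply/WE; right; right; left.
have w12 := wedge_neq0 W1 W2 n1 n2 n4 n5.
have w13 := wedge_neq0 W1 W3 n1 n3 n6 n7.
have w23 := wedge_neq0 W2 W3 n2 n3 n8 n9.
have : u3 = frame 0 u1 u2 (frame_coord 0 u1 u2 u3) by rewrite coordK.
case: (frame_coord 0 u1 u2 u3) => s t; rewrite /frame /affine /= => uE.
have s0 : s != 0.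
  apply: contra_neq w23 => s0; rewrite uE s0 /wedge /=; ring.
have t0 : t != 0.
  apply: contra_neq w13 => t0; rewrite uE t0 /wedge /=; ring.
have A1 := antipodal_pairs_neg1 A.
have A2 := antipodal_pairs_swap (antipodal_pairs_neg1 (antipodal_pairs_swap A)).
have A3 := antipodal_pairs_swap (antipodal_pairs_neg1 (antipodal_pairs_swap A1)).
have [s1|s1] : 0 < s \/ s < 0 by apply/orP; rewrite orbC -neq_lt.
  have [t1|t1] : 0 < t \/ t < 0 by apply/orP; rewrite orbC -neq_lt.
    by exists u1, u2, s, t; split => //; rewrite {1}uE; congr (_, _); ring.
  exists u1, (- u2), s, (- t); split => //; first by rewrite oppr_gt0.
  by rewrite {1}uE /=; congr (_, _); ring.
have [t1|t1] : 0 < t \/ t < 0 by apply/orP; rewrite orbC -neq_lt.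
  exists (- u1), u2, (- s), t; split => //; first by rewrite oppr_gt0.
  by rewrite {1}uE /=; congr (_, _); ring.
exists (- u1), (- u2), (- s), (- t); split => //; rewrite ?oppr_gt0//.
by rewrite {1}uE /=; congr (_, _); ring.
Qed.

(** Write [u3 = s u1 + t u2] with [s, t > 0]. The points in order around the
    hexagon are then [- u2], [u1], [u3], [u2], [- u1], [- u3]: convex position says
    that [s + t > 1], [t < 1 + s] and [s < 1 + t]. The differences of consecutive
    points are the edges, and [u3 - u1 = P (u1 + u2) + Q (u2 - u3)] is solved
    for [P] and [Q]. *)
Lemma antipodal_hexagon p u1 u2 u3 : antipodal_pairs u1 u2 u3 ->
  exists o a c P Q, [/\ wedge a c != 0, 0 < P, 0 < Q &
    [set p + w | w in W] = hexagon_vertices o a c P Q].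
Proof.
move=> /antipodal_pairs_positive[{}u1 [{}u2 [s [t [A s0 t0 uE]]]]].
case: A => [[n1 n2 n3] [[[n4 n5] [n6 n7] [n8 n9]] WE]].
have W1 : W u1 by apply/WE; left; left.
have W2 : W u2 by apply/WE; right; left; left.
have W3 : W u3 by apply/WE; right; right; left.
have w12 := wedge_neq0 W1 W2 n1 n2 n4 n5.
have neqN (x y : R * R) : x <> - y -> y <> - x by move=> h h'; apply: h; rewrite h' opprK.
have sn := lt0r_neq0 s0; have tn := lt0r_neq0 t0.
have st1 : 1 < s + t.
  rewrite ltNge; apply/negP => st.
  by apply: (cW W1 W2 W3 _ _ _ (ltW s0) (ltW t0) st uE) => [/esym|/neqN|/esym]; tauto.
have ts1 : t < 1 + s.
  rewrite ltNge; apply/negP => st.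
  apply: (cW (u := u2) (s := t^-1) (t := s / t) W3 (WN W1) W2) => //.
  - by move=> /neqN; tauto.
  - by rewrite invr_ge0 ltW.
  - by rewrite divr_ge0// ltW.
  - by rewrite -[X in X + _]mul1r -mulrDl ler_pdivrMr// mul1r.
  - by rewrite [LHS]surjective_pairing uE /=; congr (_, _); field.
have st2 : s < 1 + t.
  rewrite ltNge; apply/negP => st.
  apply: (cW (u := u1) (s := s^-1) (t := t / s) W3 (WN W2) W1) => //.
  - by rewrite invr_ge0 ltW.
  - by rewrite divr_ge0// ltW.
  - by rewrite -[X in X + _]mul1r -mulrDl ler_pdivrMr// mul1r.
  - by rewrite [LHS]surjective_pairing uE /=; congr (_, _); field.
have r0 : 0 < 1 + s - t by rewrite subr_gt0.
have rn := lt0r_neq0 r0.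
pose P := (s + t - 1) / (1 + s - t); pose Q := (1 + t - s) / (1 + s - t).
exists (p - u2), (u1 + u2), (u2 - u3), P, Q; split.
- rewrite (_ : wedge _ _ = (1 + s - t) * wedge u1 u2) ?mulf_neq0//.
  by rewrite uE /wedge /=; ring.
- by rewrite divr_gt0// subr_gt0.
- by rewrite divr_gt0// subr_gt0.
have bE : third_edge (u1 + u2) (u2 - u3) P Q = u3 - u1.
  by rewrite uE /third_edge /P /Q; congr (_, _) => /=; field.
have E1 : p - u2 + (u1 + u2) = p + u1 by rewrite addrCA subrK addrC.
have E2 : p - u2 + (u2 - u3) = p - u3 by rewrite addrA subrK.
have E3 : p + u1 + (u3 - u1) = p + u3 by rewrite addrACA subrr addr0.
have E4 : p - u3 + (u3 - u1) = p - u1 by rewrite addrA subrK.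
have E5 : p + u3 + (u2 - u3) = p + u2 by rewrite addrACA subrr addr0.
rewrite /hexagon_vertices bE E1 E2 E3 E4 E5; apply/seteqP; split.
  move=> _ [w /WE wE <-].
  case: wE => [[->|->]|[[->|->]|[->|->]]];
    [left; constructor 2|right; constructor 2|right; constructor 3|
     left; constructor 1|right; constructor 1|left; constructor 3]; done.
by move=> x [] [] ->; [exists (- u2)|exists u1|exists (- u3)|exists u3|exists (- u1)|exists u2];
  rewrite ?WE//; tauto.
Qed.

End antipodal_pairs.
End symmetric_hexagon.

Lemma exists_ord_notin n (r : seq 'I_n) : (size r < n)%N -> exists i, i \notin r.
Proof.
move=> sr; apply: contrapT => h.
have : (size (enum 'I_n) <= size r)%N.
  apply: uniq_leq_size; first exact: enum_uniq.
  by move=> i _; apply: contrapT => /negP ir; apply: h; exists i.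
by rewrite -cardE card_ord leqNgt sr.
Qed.

Section six_vertices.
Context {R : realType}.
Variables (v : 'I_6 -> R * R) (p : R * R).
Hypothesis v_indep : forall i, ~ convex_hull [set v j | j in [set j | j != i]] (v i).
Hypothesis sym : forall x, convex_hull (range v) x -> convex_hull (range v) (p + p - x).

Lemma vertex_not_in_hull S i : S `<=` range v -> ~ S (v i) -> ~ convex_hull S (v i).
Proof.
move=> Sv Si hi; apply: (v_indep (i := i)); apply: convex_hull_mono hi => x Sx.
have [j _ jx] := Sv _ Sx; exists j => //=.
by apply/eqP => ji; apply: Si; rewrite -ji jx.
Qed.

Lemma vertex_inj : injective v.
Proof.
move=> i j ij; apply: contrapT => /eqP nij; apply: (v_indep (i := i)).
by apply: sub_convex_hull; exists j => //=; rewrite eq_sym.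
Qed.

Lemma vertex_extreme i : extreme (convex_hull (range v)) (v i).
Proof.
have [j] := exists_ord_notin (r := [:: i]) isT; rewrite inE => ji.
have -> : range v = v i |` [set v j | j in [set j | j != i]].
  apply/seteqP; split => [_ [k _ <-]|x [->|[k _ <-]]]; last 2 first.
  - by exists i.
  - by exists k.
  by have [->|ki] := eqVneq k i; [left|right; exists k].
by apply: (extreme_adjoin (q := v j)) => //; exists j.
Qed.

(** The reflection permutes the extreme points. A vertex fixed by it would be the
    centre, hence the midpoint of any other vertex and its reflection. *)
Lemma antipode i : exists2 j, j != i & v j = p + p - v i.
Proof.
have [j _ jE] := extreme_convex_hull (extreme_reflect sym (vertex_extreme i)).
exists j => //; apply/eqP => ji; rewrite {j}ji in jE.
have [k] := exists_ord_notin (r := [:: i]) isT; rewrite inE => ki.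
have [l _ lE] := extreme_convex_hull (extreme_reflect sym (vertex_extreme k)).
have li : l != i.
  apply: contra_neq ki => li; apply: vertex_inj.
  by rewrite -[LHS](subKr (p + p)) -lE li -jE.
apply: (v_indep (i := i)).
have h0 : 0 <= 2^-1 :> R by lra.
have h1 : 2^-1 <= 1 :> R by lra.
have hk : [set v j | j in [set j | j != i]] (v k) by exists k.
have hl : [set v j | j in [set j | j != i]] (v l) by exists l.
have := convex_hull_mix h0 h1 (sub_convex_hull hk) (sub_convex_hull hl).
congr convex_hull; rewrite lE /mix.
have vip : v i = p.
  move: jE; case: (v i) (p) => x1 x2 [p1 p2] [] /= e1 e2; congr (_, _); lra.
by rewrite vip; case: (p) (v k) => p1 p2 [x1 x2] /=; congr (_, _); lra.
Qed.

(* the vertices as seen from the centre *)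
Let W : set (R * R) := [set w | range v (p + w)].

Let WN w : W w -> W (- w).
Proof.
move=> [i _ iE]; have [j _ jE] := antipode i.
by exists j => //; rewrite jE iE opprD addrA addrK.
Qed.

Let cW : avoids_antipodal_triangles W.
Proof.
move=> w1 w2 u s t W1 W2 [i _ iE] u1 u2 u3 s0 t0 st uE.
pose S : set (R * R) := [set x | [\/ x = p + w1, x = p - w1 | x = p + w2]].
apply: (@vertex_not_in_hull S i).
- by move=> x [] ->; [exact: W1|exact: WN|exact: W2].
- by rewrite iE => -[] /addrI.
- rewrite iE uE; apply: convex_hull_triangle => //.
  + by constructor 1.
  + by constructor 2.
  + by constructor 3.
Qed.

Lemma exists_antipodal_pairs : exists u1 u2 u3, antipodal_pairs W u1 u2 u3.
Proof.
have antipode' i : exists j, j != i /\ v j = p + p - v i.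
  by have [j ji jE] := antipode i; exists j.
have [f fE] := choice antipode'.
have fn i : f i != i by case: (fE i).
have fv i : v (f i) = p + p - v i by case: (fE i).
have fK i : f (f i) = i by apply: vertex_inj; rewrite !fv subKr.
have ff i j : f i = j -> i = f j by move=> <-; rewrite fK.
have i1 : 'I_6 := ord0.
have [i2] := exists_ord_notin (r := [:: i1; f i1]) isT; rewrite !inE negb_or => /andP[n21 n21'].
have [i3] := exists_ord_notin (r := [:: i1; f i1; i2; f i2]) isT.
rewrite !inE !negb_or => /and4P[n31 n31' n32 n32'].
have un : uniq [:: i1; f i1; i2; f i2; i3; f i3].
  have ffn i j : i != f j -> f i != j by apply: contra_neq => /ff.
  have fin i j : i != j -> f i != f j by apply: contra_neq => /(congr1 f); rewrite !fK.
  rewrite /= !inE !negb_or.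
  by do ![apply/andP; split] => //; rewrite eq_sym//; (apply: fn || (apply: ffn; done) || (apply: fin; done)).
have all6 i : i \in [:: i1; f i1; i2; f i2; i3; f i3].
  have [||_ ->] := uniq_min_size un (s2 := enum 'I_6); rewrite ?mem_enum//.
    by move=> j _; rewrite mem_enum.
  by rewrite -cardE card_ord.
have fW i : v (f i) - p = - (v i - p).
  by rewrite fv opprB addrAC addrK.
have vn i j : i <> j -> v i - p <> v j - p by move=> ij /addIr/vertex_inj.
have vn' i j : i <> f j -> v i - p <> - (v j - p) by rewrite -fW; exact: vn.
exists (v i1 - p), (v i2 - p), (v i3 - p); split; [|split].
- have v0 i : v i - p <> 0.
    by move=> h; apply: (@vn' i i); [apply/eqP; rewrite eq_sym|rewrite h oppr0].
  by split; exact: v0.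
- have sy (i j : 'I_6) : i != j -> j <> i by rewrite eq_sym => /eqP.
  have sf (i j : 'I_6) : i != f j -> j <> f i.
    by move=> ij ji; move/eqP: ij; apply; rewrite ji fK.
  by split; split; (apply: vn' || apply: vn); (by apply: sf) || (by apply: sy).
- move=> w; split.
    move=> [i _ iE]; have -> : w = v i - p by rewrite iE addrC addKr.
    move: (all6 i); rewrite !inE -!fW.
    case/orP => [/eqP->|]; first by tauto.
    case/orP => [/eqP->|]; first by tauto.
    case/orP => [/eqP->|]; first by tauto.
    case/orP => [/eqP->|]; first by tauto.
    by case/orP => [/eqP->|/eqP->]; tauto.
  have Wv i : W (v i - p) by exists i => //; rewrite addrC subrK.
  by rewrite -!fW => -[[->|->]|[[->|->]|[->|->]]]; exact: Wv.
Qed.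

Lemma hull_six_vertices : exists o a c P Q,
  [/\ wedge a c != 0, 0 < P, 0 < Q & convex_hull (range v) = hexagon o a c P Q].
Proof.
have [u1 [u2 [u3 A]]] := exists_antipodal_pairs.
have [ o [a [c [P [Q [w0 P0 Q0 VE]]]]]] := antipodal_hexagon WN cW p A.
exists o, a, c, P, Q; split => //; rewrite -convex_hull_hexagon// -VE.
congr convex_hull; apply/seteqP; split => [x vx|_ [w Ww <-]//].
by exists (x - p); rewrite /W /= addrC subrK.
Qed.

End six_vertices.

Lemma symmetric_hexagonP (R : realType) (Omega : set (R * R)) :
  convex_hexagon Omega -> centrally_symmetric Omega ->
  exists o a c P Q, [/\ wedge a c != 0, 0 < P, 0 < Q & Omega = hexagon o a c P Q].
Proof.
move=> [v [v_indep ->]] [p pE]; apply: (@hull_six_vertices _ v p) => // x hx.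
have : translate (convex_hull (range v)) (- p) (x - p) by exists x.
rewrite pE => -[_ [y hy <-] yE].
by rewrite (_ : p + p - x = y)// -addrA -opprB -yE opprD opprK addrCA subrr addr0.
Qed.

(** * Existence and uniqueness of the spectrum *)

Lemma translate_translate (R : realType) (S : set (R * R)) t t' :
  translate (translate S t) t' = translate S (t + t').
Proof.
apply/seteqP; split => [_ [_ [x Sx <-] <-]|_ [x Sx <-]]; first by exists x => //; rewrite addrA.
by exists (x + t); [exists x|rewrite addrA].
Qed.

Theorem theorem1p3 (R : realType) (Omega : set (R * R))
    (hexagon_Omega : convex_hexagon Omega)
    (symmetric_Omega : centrally_symmetric Omega) :
  (exists Lambda : set (R * R), is_spectrum Omega Lambda) /\
  (forall Lambda1 Lambda2 : set (R * R),
     is_spectrum Omega Lambda1 -> is_spectrum Omega Lambda2 ->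
     exists t : R * R, Lambda2 = translate Lambda1 t).
Proof.
have [ o [a [c [P [Q [w0 P0 Q0 ->]]]]]] := symmetric_hexagonP hexagon_Omega symmetric_Omega.
split; first by exists (dual_lattice a c P Q); exact: dual_lattice_spectrum.
move=> L1 L2 /(spectrum_hexagonE w0 P0 Q0)[t1 ->] /(spectrum_hexagonE w0 P0 Q0)[t2 ->].
by exists (t2 - t1); rewrite translate_translate addrC subrK.
Qed.
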